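(* Let $0<\lambda<1$ and let $\Phi\in\mathbb T$ be irrational. For every $\theta\in\mathbb T$ such that $\theta-\frac14$ is irrational with respect to $\Phi$, the operator $W_{\lambda,\lambda,\Phi,\theta}$ has empty point spectrum.
   Context: For irrational $\Phi\in\mathbb T=\mathbb R/\mathbb Z$, a number $\phi\in\mathbb T$ is irrational with respect to $\Phi$ if $2\phi+k\Phi\notin\mathbb Z$ for every $k\in\mathbb Z$. For $\lambda\in[0,1]$ put $\lambda'=\sqrt{1-\lambda^2}$. On $\ell^2(\mathbb Z)\otimes\mathbb C^2$ with basis $\delta_n^\pm$ and $\psi_n=(\psi_n^+,\psi_n^-)^\top$, let $S_\lambda\delta_n^\pm=\lambda\delta_{n\pm1}^\pm\pm\lambda'\delta_n^\mp$, $(Q_{\lambda_2,\Phi,\theta}\psi)_n=Q_n\psi_n$ with $$Q_n=\begin{bmatrix}\lambda_2\cos(2\pi(n\Phi+\theta))+i\lambda_2' & -\lambda_2\sin(2\pi(n\Phi+\theta))\\ \lambda_2\sin(2\pi(n\Phi+\theta)) & \lambda_2\cos(2\pi(n\Phi+\theta))-i\lambda_2'\end{bmatrix},$$ and $W_{\lambda_1,\lambda_2,\Phi,\theta}=S_{\lambda_1}Q_{\lambda_2,\Phi,\theta}$ (the unitary almost-Mathieu operator). *)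

(* Defs.v *)
From Stdlib Require Import Reals ZArith.
From Coquelicot Require Import Coquelicot.
Open Scope R_scope.

Definition lamp (l : R) : R := sqrt (1 - l ^ 2).

(* Phi (a representative in R of a point of T) is irrational *)
Definition irrational (x : R) : Prop :=
  forall p q : Z, q <> 0%Z -> x <> IZR p / IZR q.

Definition irrational_wrt (Phi phi : R) : Prop :=
  forall k m : Z, 2 * phi + IZR k * Phi <> IZR m.

(* vectors of l^2(Z) (x) C^2 : psi n = (psi_n^+, psi_n^-) *)
Definition vec := Z -> C * C.

Definition normsq2 (v : C * C) : R := Cmod (fst v) ^ 2 + Cmod (snd v) ^ 2.

Definition in_l2 (psi : vec) : Prop :=
  ex_series (fun k : nat => normsq2 (psi (Z.of_nat k))) /\
  ex_series (fun k : nat => normsq2 (psi (- Z.of_nat k - 1)%Z)).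

Definition Qop (l2 Phi theta : R) (psi : vec) : vec := fun n =>
  let a := 2 * PI * (IZR n * Phi + theta) in
  let p := fst (psi n) in
  let m := snd (psi n) in
  ( ((RtoC (l2 * cos a) + Ci * RtoC (lamp l2)) * p - RtoC (l2 * sin a) * m)%C,
    (RtoC (l2 * sin a) * p + (RtoC (l2 * cos a) - Ci * RtoC (lamp l2)) * m)%C ).

(* S delta_n^+ = l delta_{n+1}^+ + l' delta_n^-,  S delta_n^- = l delta_{n-1}^- - l' delta_n^+,
   hence (S psi)_n^+ = l psi_{n-1}^+ - l' psi_n^-, (S psi)_n^- = l psi_{n+1}^- + l' psi_n^+ *)
Definition Sop (l : R) (psi : vec) : vec := fun n =>
  ( (RtoC l * fst (psi (n - 1)%Z) - RtoC (lamp l) * snd (psi n))%C,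
    (RtoC l * snd (psi (n + 1)%Z) + RtoC (lamp l) * fst (psi n))%C ).

Definition Wop (l1 l2 Phi theta : R) (psi : vec) : vec := Sop l1 (Qop l2 Phi theta psi).

Definition eigenvalue (W : vec -> vec) (z : C) : Prop :=
  exists psi : vec, in_l2 psi /\ (exists n, psi n <> (RtoC 0, RtoC 0)) /\
    forall n, W psi n = ((z * fst (psi n))%C, (z * snd (psi n))%C).

Definition empty_point_spectrum (W : vec -> vec) : Prop :=
  forall z : C, ~ eigenvalue W z.

(* Main.v *)
Require Import Defs.
From Stdlib Require Import Reals ZArith.
From Stdlib Require Import Lra Lia List Permutation FunctionalExtensionality Classical.
From Coquelicot Require Import Coquelicot.
Import ListNotations.
Open Scope R_scope.

(** Read the components of an l^2 eigenvector as Fourier coefficients of L^2 functions. Then S^* acts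
    as multiplication by a trigonometric matrix and Q as translation by Phi, so W psi = z psi becomes a
    first-order cocycle equation lam d(x) phi Psi(x + Phi) = F(x) Psi(x) for Psi = (p, r), with
    phi = e^(2 pi i theta). Unitarity makes |p|^2 - |r|^2 constant.

    If the constant were not zero, Psi and its mirror image (conj r, conj p) would express the n-step
    transfer matrix by products of L^2 functions, translated by n Phi against untranslated. The n-th
    Fourier coefficient of such products is o(rho^n), with rho = lam (1 + lam') / 2 the geometric mean of
    lam |d|, if n is a best approximation denominator of Phi, for then prod_(j<n) d(x + j Phi) is
    comparable to its mean. But the top coefficient of the n-step matrix grows like rho^n: at
    lam1 = lam2 the two rates coincide.

    So |p| = |r|. The reflection n -> -n maps psi to a second solution Psi' = (p', r') of the same
    cocycle equation, with phase -conj(phi). As 2 (theta - 1/4) is not in Z Phi + Z, the conserved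
    function p conj(p') - r conj(r') vanishes, hence by Lagrange's identity p r' - r p' = 0: Psi and
    Psi' are parallel. Comparing them along orbits yields two almost periodic sequences with disjoint
    frequencies that coincide, which forces p p' = 0 coefficientwise and so psi = 0.

    On the level of Fourier coefficients, products of L^2 functions are convolutions of l^2
    sequences. *)

(** * Sums over Z *)

(** Because the two growth rates coincide, there is no exponential margin: the products of d along
    an orbit must be controlled up to a bounded factor, not up to exp(o(n)). The symbol d(x) = lam
    cos(2 pi x) + i lp has no zero on the circle, since lp > 0, and is a constant times (1 + t X)(1
    + t X^-1) with |t| < 1. For arbitrary n the small denominators 1 - v^m stand in the way of such
    control; along best approximations Newton's identities bound the coefficients of the product
    uniformly. What then decides is the Riemann-Lebesgue decay of the coefficients of a product of
    two L^2 functions, which is uniform under translation.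

    Convolutions cover products of two L^2 functions only, whereas Lagrange's identity is quartic.
    It is therefore applied pointwise, to partial sums of Fourier series on finite grids, and in a
    form linear in the moduli of the three Hermitian forms. Fejer means lead from vanishing
    coefficients to small L^1 norms on the grids, so that no integration theory enters. *)

Fixpoint rsum {A} (l : list A) (f : A -> R) : R :=
  match l with nil => 0 | x :: l' => f x + rsum l' f end.

Fixpoint csum {A} (l : list A) (f : A -> C) : C :=
  match l with nil => RtoC 0 | x :: l' => (f x + csum l' f)%C end.

Section FiniteSums.
Context {A : Type}.
Implicit Types (l : list A).

Lemma rsum_ext l (f g : A -> R) :
  (forall x, In x l -> f x = g x) -> rsum l f = rsum l g.
Proof.
  induction l as [|x l IH]; simpl; intros H; auto.
  rewrite (H x), IH; auto.
Qed.

Lemma rsum_plus l (f g : A -> R) : rsum l (fun x => f x + g x) = rsum l f + rsum l g.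
Proof. induction l as [|x l IH]; simpl; [|rewrite IH]; ring. Qed.

Lemma rsum_scal l (c : R) (f : A -> R) : rsum l (fun x => c * f x) = c * rsum l f.
Proof. induction l as [|x l IH]; simpl; [|rewrite IH]; ring. Qed.

Lemma rsum_const l (c : R) : rsum l (fun _ => c) = INR (length l) * c.
Proof.
  induction l as [|x l IH]; cbn [rsum length]; [simpl; ring|].
  rewrite IH, S_INR; ring.
Qed.

Lemma rsum_le l (f g : A -> R) :
  (forall x, In x l -> f x <= g x) -> rsum l f <= rsum l g.
Proof.
  induction l as [|x l IH]; simpl; intros H; [lra|].
  apply Rplus_le_compat; auto.
Qed.

Lemma rsum_ge0 l (f : A -> R) : (forall x, In x l -> 0 <= f x) -> 0 <= rsum l f.
Proof.
  induction l as [|x l IH]; simpl; intros H; [lra|].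
  apply Rplus_le_le_0_compat; auto.
Qed.

Lemma rsum_app l l' (f : A -> R) : rsum (l ++ l') f = rsum l f + rsum l' f.
Proof. induction l as [|x l IH]; simpl; [|rewrite IH]; ring. Qed.

Lemma rsum_perm l l' (f : A -> R) : Permutation l l' -> rsum l f = rsum l' f.
Proof. induction 1; simpl; lra. Qed.

Lemma csum_ext l (f g : A -> C) :
  (forall x, In x l -> f x = g x) -> csum l f = csum l g.
Proof.
  induction l as [|x l IH]; simpl; intros H; auto.
  rewrite (H x), IH; auto.
Qed.

Lemma csum_plus l (f g : A -> C) :
  csum l (fun x => f x + g x)%C = (csum l f + csum l g)%C.
Proof. induction l as [|x l IH]; simpl; [|rewrite IH]; ring. Qed.

Lemma csum_scal l (c : C) (f : A -> C) : csum l (fun x => c * f x)%C = (c * csum l f)%C.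
Proof. induction l as [|x l IH]; simpl; [|rewrite IH]; ring. Qed.

Lemma csum_scal_r l (c : C) (f : A -> C) : csum l (fun x => f x * c)%C = (csum l f * c)%C.
Proof. induction l as [|x l IH]; simpl; [|rewrite IH]; ring. Qed.

Lemma csum_zero l (f : A -> C) : (forall x, In x l -> f x = RtoC 0) -> csum l f = RtoC 0.
Proof.
  induction l as [|x l IH]; simpl; intros H; auto.
  rewrite (H x), IH by auto. ring.
Qed.

Lemma csum_app l l' (f : A -> C) : csum (l ++ l') f = (csum l f + csum l' f)%C.
Proof. induction l as [|x l IH]; simpl; [|rewrite IH]; ring. Qed.

Lemma csum_perm l l' (f : A -> C) : Permutation l l' -> csum l f = csum l' f.
Proof. induction 1; simpl; try congruence. ring. Qed.

Lemma Cmod_csum l (f : A -> C) : Cmod (csum l f) <= rsum l (fun x => Cmod (f x)).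
Proof.
  induction l as [|x l IH]; simpl; [rewrite Cmod_0; lra|].
  eapply Rle_trans; [apply Cmod_triangle|lra].
Qed.

Lemma csum_conj l (f : A -> C) : Cconj (csum l f) = csum l (fun x => Cconj (f x)).
Proof.
  induction l as [|x l IH]; simpl; [apply injective_projections; simpl; ring|].
  rewrite Cplus_conj, IH; reflexivity.
Qed.

Lemma csum_RtoC l (f : A -> R) : csum l (fun x => RtoC (f x)) = RtoC (rsum l f).
Proof. induction l as [|x l IH]; simpl; auto. rewrite IH, RtoC_plus; reflexivity. Qed.

Lemma csum_single (dec : forall x y : A, {x = y} + {x <> y}) l (a : A) (f : A -> C) :
  NoDup l -> (forall x, In x l -> x <> a -> f x = RtoC 0) ->
  csum l f = if in_dec dec a l then f a else RtoC 0.
Proof.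
  intros Hl Hf. induction Hl as [|x l Hx Hl IH]; [reflexivity|].
  cbn [csum]. rewrite IH by (intros; apply Hf; [right|]; auto).
  destruct (in_dec dec a l) as [i|i]; destruct (in_dec dec a (x :: l)) as [j|j];
    simpl in j; try tauto.
  - rewrite (Hf x); [ring|left; auto|]. intros ->; auto.
  - destruct j as [->|j]; [ring|tauto].
  - rewrite (Hf x); [ring|left; auto|]. intros ->; auto.
Qed.

Lemma NoDup_incl_split (dec : forall x y : A, {x = y} + {x <> y}) l l' :
  NoDup l -> NoDup l' -> incl l l' ->
  exists k, Permutation l' (l ++ k) /\ NoDup k /\ (forall x, In x k -> ~ In x l).
Proof.
  revert l'. induction l as [|a l IH]; intros l' H1 H2 H3.
  - exists l'. repeat split; auto.
  - apply NoDup_cons_iff in H1 as [Ha Hl].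
    destruct (in_split a l') as (l1 & l2 & ->); [apply H3; left; auto|].
    assert (P : Permutation (l1 ++ a :: l2) (a :: (l1 ++ l2)))
      by (apply Permutation_sym, Permutation_middle).
    assert (H2' := Permutation_NoDup P H2). apply NoDup_cons_iff in H2' as [Ha' H2'].
    destruct (IH (l1 ++ l2)) as (k & Pk & Nk & Dk); auto.
    { intros x Hx. assert (In x (a :: (l1 ++ l2))) as [->|Hx']; auto; [|tauto].
      eapply Permutation_in; [apply P|]. apply H3; right; auto. }
    exists k. split; [|split]; auto.
    + rewrite P. simpl. constructor. exact Pk.
    + intros x Hx [->|Hx']; [|eapply Dk; eauto].
      apply Ha'. eapply Permutation_in; [apply Permutation_sym, Pk|].
      apply in_or_app; auto.
Qed.

Lemma rsum_incl (dec : forall x y : A, {x = y} + {x <> y}) l l' (f : A -> R) :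
  (forall x, 0 <= f x) -> NoDup l -> NoDup l' -> incl l l' -> rsum l f <= rsum l' f.
Proof.
  intros Hf H1 H2 H3.
  destruct (NoDup_incl_split dec _ _ H1 H2 H3) as (k & P & _ & _).
  rewrite (rsum_perm _ _ _ P), rsum_app.
  assert (0 <= rsum k f) by (apply rsum_ge0; auto). lra.
Qed.
End FiniteSums.

Lemma rsum_map {A B} (l : list B) (h : B -> A) (f : A -> R) :
  rsum (map h l) f = rsum l (fun x => f (h x)).
Proof. induction l as [|x l IH]; simpl; [|rewrite IH]; ring. Qed.

Lemma rsum_swap {A B} (l : list A) (l' : list B) (f : A -> B -> R) :
  rsum l (fun x => rsum l' (f x)) = rsum l' (fun y => rsum l (fun x => f x y)).
Proof.
  induction l as [|x l IH]; simpl.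
  - induction l' as [|y l' IH']; simpl; [reflexivity|]. rewrite <- IH'; ring.
  - rewrite IH, <- rsum_plus. reflexivity.
Qed.

Lemma csum_map {A B} (l : list B) (h : B -> A) (f : A -> C) :
  csum (map h l) f = csum l (fun x => f (h x)).
Proof. induction l as [|x l IH]; simpl; [|rewrite IH]; ring. Qed.

Lemma csum_swap {A B} (l : list A) (l' : list B) (f : A -> B -> C) :
  csum l (fun x => csum l' (f x)) = csum l' (fun y => csum l (fun x => f x y)).
Proof.
  induction l as [|x l IH]; simpl.
  - induction l' as [|y l' IH']; simpl; [reflexivity|]. rewrite <- IH'; ring.
  - rewrite IH, <- csum_plus. reflexivity.
Qed.

(** * Unconditional sums over the integers *)

Fixpoint zbox (N : nat) : list Z :=
  match N with
  | O => [0%Z]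
  | S N' => Z.of_nat N :: (- Z.of_nat N)%Z :: zbox N'
  end.

Lemma In_zbox N n : In n (zbox N) <-> (Z.abs n <= Z.of_nat N)%Z.
Proof.
  induction N as [|N IH].
  - simpl; lia.
  - change (In n (zbox (S N))) with
      (Z.of_nat (S N) = n \/ (- Z.of_nat (S N))%Z = n \/ In n (zbox N)).
    rewrite IH. lia.
Qed.

Lemma NoDup_zbox N : NoDup (zbox N).
Proof.
  induction N as [|N IH].
  - constructor; [easy|constructor].
  - cbn [zbox]. constructor; [|constructor]; auto.
    + intros [H|H]; [lia|]. apply In_zbox in H. lia.
    + intros H. apply In_zbox in H. lia.
Qed.

Lemma incl_zbox_le N N' : (N <= N')%nat -> incl (zbox N) (zbox N').
Proof. intros H n. rewrite !In_zbox. lia. Qed.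

Lemma incl_zbox (l : list Z) : exists K, incl l (zbox K).
Proof.
  induction l as [|x l [K HK]].
  - exists 0%nat. easy.
  - exists (max K (Z.abs_nat x)). intros n [<-|Hn].
    + apply In_zbox. lia.
    + apply HK, In_zbox in Hn. apply In_zbox. lia.
Qed.

Definition zmem (n : Z) (l : list Z) : bool := if in_dec Z.eq_dec n l then true else false.

(* For nonnegative [g]: the sum of [g] over Z exists and is at most [B]. *)
Definition zsum_le (g : Z -> R) (B : R) : Prop :=
  forall l, NoDup l -> rsum l g <= B.

Lemma zsum_le_zbox g B :
  (forall n, 0 <= g n) -> (forall N, rsum (zbox N) g <= B) -> zsum_le g B.
Proof.
  intros Hg HB l Hl. destruct (incl_zbox l) as [K HK].
  eapply Rle_trans; [|apply (HB K)].
  apply rsum_incl; auto using Z.eq_dec, NoDup_zbox.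
Qed.

Lemma zsum_le_reindex g B (h : Z -> Z) :
  (forall x y, h x = h y -> x = y) -> zsum_le g B -> zsum_le (fun n => g (h n)) B.
Proof.
  intros Hh HB l Hl. rewrite <- rsum_map. apply HB.
  apply FinFun.Injective_map_NoDup; auto.
Qed.

(** A box whose sum is within [eps] of the supremum of all box sums leaves at most [eps] to any
    finite set outside it. *)
Lemma zsum_tail g B :
  (forall n, 0 <= g n) -> zsum_le g B ->
  forall eps, 0 < eps -> exists K, forall l, NoDup l ->
    (forall n, In n l -> ~ In n (zbox K)) -> rsum l g <= eps.
Proof.
  intros Hg HB eps Heps.
  destruct (completeness (fun s => exists N, s = rsum (zbox N) g)) as [s [Hs1 Hs2]].
  - exists B. intros s [N ->]. apply HB, NoDup_zbox.
  - exists (rsum (zbox 0) g). exists 0%nat. reflexivity.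
  - assert (HK : exists K, s - eps < rsum (zbox K) g).
    { apply Classical_Prop.NNPP. intros Hn.
      assert (s <= s - eps); [|lra].
      apply Hs2. intros x [N ->]. apply Rnot_lt_le. intros H. apply Hn. exists N; auto. }
    destruct HK as [K HK]. exists K. intros l Hl Hd.
    destruct (incl_zbox (l ++ zbox K)) as [N HN].
    assert (rsum (l ++ zbox K) g <= rsum (zbox N) g).
    { apply rsum_incl; auto using Z.eq_dec, NoDup_zbox.
      apply NoDup_app; auto using NoDup_zbox. }
    rewrite rsum_app in H.
    assert (rsum (zbox N) g <= s) by (apply Hs1; exists N; auto). lra.
Qed.

Definition summable (f : Z -> C) : Prop := exists B, zsum_le (fun n => Cmod (f n)) B.

(** Convergence along the net of all finite sets containing a box, not along the boxes alone: this
    makes the sum invariant under every bijection of Z. *)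
Definition is_zsum (f : Z -> C) (s : C) : Prop :=
  forall eps, 0 < eps -> exists K, forall l, NoDup l -> incl (zbox K) l ->
    Cmod (csum l f - s)%C < eps.

(** [Lim_seq] and [real] are total, so the value is meaningful only where convergence is known, as
    [zsum_correct] provides for summable families. *)
Definition zsum (f : Z -> C) : C :=
  (real (Lim_seq (fun N => fst (csum (zbox N) f))),
   real (Lim_seq (fun N => snd (csum (zbox N) f)))).

Lemma Cmod_fst (z : C) : Rabs (fst z) <= Cmod z.
Proof. eapply Rle_trans; [apply Rmax_l|apply Rmax_Cmod]. Qed.

Lemma Cmod_snd (z : C) : Rabs (snd z) <= Cmod z.
Proof. eapply Rle_trans; [apply Rmax_r|apply Rmax_Cmod]. Qed.

Lemma Cmod_le_sum (z : C) : Cmod z <= Rabs (fst z) + Rabs (snd z).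
Proof.
  replace z with (RtoC (fst z) + Ci * RtoC (snd z))%C at 1
    by (apply injective_projections; simpl; ring).
  eapply Rle_trans; [apply Cmod_triangle|].
  rewrite Cmod_mult, !Cmod_R.
  replace (Cmod Ci) with 1; [lra|].
  unfold Cmod, Ci; simpl. rewrite <- sqrt_1 at 1. f_equal; ring.
Qed.

Lemma csum_split_tail (f : Z -> C) K l :
  NoDup l -> incl (zbox K) l ->
  exists k, NoDup k /\ (forall n, In n k -> ~ In n (zbox K)) /\
    csum l f = (csum (zbox K) f + csum k f)%C.
Proof.
  intros H1 H2.
  destruct (NoDup_incl_split Z.eq_dec _ _ (NoDup_zbox K) H1 H2) as (k & P & Nk & Dk).
  exists k. repeat split; auto. now rewrite (csum_perm _ _ _ P), csum_app.
Qed.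

Lemma zsum_correct f : summable f -> is_zsum f (zsum f).
Proof.
  intros [B HB].
  assert (T := zsum_tail _ _ (fun n => Cmod_ge_0 (f n)) HB).
  assert (TT : forall eps, 0 < eps -> exists K, forall l, NoDup l -> incl (zbox K) l ->
             Cmod (csum l f - csum (zbox K) f)%C <= eps).
  { intros eps Heps. destruct (T eps Heps) as [K HK]. exists K. intros l H1 H2.
    destruct (csum_split_tail f K l H1 H2) as (k & Nk & Dk & ->).
    replace (csum (zbox K) f + csum k f - csum (zbox K) f)%C with (csum k f) by ring.
    eapply Rle_trans; [apply Cmod_csum|]. auto. }
  assert (Cau : forall pr : C -> R, (forall x y, pr (x - y)%C = pr x - pr y) ->
     (forall x, Rabs (pr x) <= Cmod x) ->
     is_lim_seq (fun N => pr (csum (zbox N) f)) (real (Lim_seq (fun N => pr (csum (zbox N) f))))).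
  { intros pr Hpr Hm. apply Lim_seq_correct', ex_lim_seq_cauchy_corr.
    intros eps. destruct (TT (eps / 4)) as [K HK]; [destruct eps; simpl; lra|].
    exists K. intros n m Hn Hm'.
    assert (Hc : forall n, (K <= n)%nat -> Cmod (csum (zbox n) f - csum (zbox K) f)%C <= eps / 4)
      by (intros; apply HK; auto using NoDup_zbox, incl_zbox_le).
    rewrite <- Hpr. eapply Rle_lt_trans; [apply Hm|].
    replace (csum (zbox n) f - csum (zbox m) f)%C with
      ((csum (zbox n) f - csum (zbox K) f) + - (csum (zbox m) f - csum (zbox K) f))%C by ring.
    eapply Rle_lt_trans; [apply Cmod_triangle|]. rewrite Cmod_opp.
    assert (H1 := Hc _ Hn). assert (H2 := Hc _ Hm'). destruct eps as [eps He]; simpl in *. lra. }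
  assert (C1 := Cau fst ltac:(intros; simpl; ring) Cmod_fst).
  assert (C2 := Cau snd ltac:(intros; simpl; ring) Cmod_snd).
  intros eps Heps.
  destruct (TT (eps / 8)) as [K HK]; [lra|].
  apply is_lim_seq_spec in C1. apply is_lim_seq_spec in C2.
  destruct (C1 (mkposreal (eps / 8) ltac:(lra))) as [N1 H1].
  destruct (C2 (mkposreal (eps / 8) ltac:(lra))) as [N2 H2].
  simpl in H1, H2.
  exists K. intros l Hl Hi.
  set (N := max K (max N1 N2)).
  assert (A1 := HK l Hl Hi).
  assert (A2 : Cmod (csum (zbox N) f - csum (zbox K) f)%C <= eps / 8)
    by (apply HK; [apply NoDup_zbox|apply incl_zbox_le; lia]).
  assert (A3 : Cmod (csum (zbox N) f - zsum f)%C <= eps / 4).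
  { eapply Rle_trans; [apply Cmod_le_sum|].
    specialize (H1 N ltac:(lia)). specialize (H2 N ltac:(lia)).
    simpl. unfold Rminus in *. lra. }
  replace (csum l f - zsum f)%C with
    ((csum l f - csum (zbox K) f) + - (csum (zbox N) f - csum (zbox K) f)
     + (csum (zbox N) f - zsum f))%C by ring.
  eapply Rle_lt_trans; [apply Cmod_triangle|].
  eapply Rle_lt_trans; [apply Rplus_le_compat_r, Cmod_triangle|]. rewrite Cmod_opp. lra.
Qed.

Lemma Cmod_small (z : C) : (forall eps, 0 < eps -> Cmod z <= eps) -> z = RtoC 0.
Proof.
  intros H. apply Cmod_eq_0. apply Rle_antisym; [|apply Cmod_ge_0].
  apply Rnot_lt_le. intros Hz. specialize (H (Cmod z / 2)). lra.
Qed.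

Lemma is_zsum_unique f s s' : is_zsum f s -> is_zsum f s' -> s = s'.
Proof.
  intros H H'. assert (E : (s - s')%C = RtoC 0).
  { apply Cmod_small. intros eps He.
    destruct (H (eps / 2)) as [K HK]; [lra|]. destruct (H' (eps / 2)) as [K' HK']; [lra|].
    specialize (HK (zbox (max K K')) (NoDup_zbox _) (incl_zbox_le K (max K K') ltac:(lia))).
    specialize (HK' (zbox (max K K')) (NoDup_zbox _) (incl_zbox_le K' (max K K') ltac:(lia))).
    set (c := csum _ f) in *. replace (s - s')%C with (- (c - s) + (c - s'))%C by ring.
    eapply Rle_trans; [apply Cmod_triangle|]. rewrite Cmod_opp. lra. }
  replace s with ((s - s') + s')%C by ring. rewrite E. ring.
Qed.

Lemma is_zsum_plus f g s t :
  is_zsum f s -> is_zsum g t -> is_zsum (fun n => f n + g n)%C (s + t)%C.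
Proof.
  intros H H' eps He.
  destruct (H (eps / 2)) as [K HK]; [lra|]. destruct (H' (eps / 2)) as [K' HK']; [lra|].
  exists (max K K'). intros l Hl Hi. rewrite csum_plus.
  assert (A := HK l Hl (incl_tran (incl_zbox_le K (max K K') ltac:(lia)) Hi)).
  assert (A' := HK' l Hl (incl_tran (incl_zbox_le K' (max K K') ltac:(lia)) Hi)).
  replace (csum l f + csum l g - (s + t))%C with ((csum l f - s) + (csum l g - t))%C by ring.
  eapply Rle_lt_trans; [apply Cmod_triangle|]. lra.
Qed.

Lemma is_zsum_scal f s c : is_zsum f s -> is_zsum (fun n => c * f n)%C (c * s)%C.
Proof.
  intros H eps He. assert (Hc := Cmod_ge_0 c).
  destruct (H (eps / (Cmod c + 1))) as [K HK]; [apply Rdiv_lt_0_compat; lra|].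
  exists K. intros l Hl Hi. specialize (HK l Hl Hi).
  rewrite csum_scal. replace (c * csum l f - c * s)%C with (c * (csum l f - s))%C by ring.
  rewrite Cmod_mult. apply Rle_lt_trans with (Cmod c * (eps / (Cmod c + 1))).
  - apply Rmult_le_compat_l; lra.
  - apply Rmult_lt_reg_r with (Cmod c + 1); [lra|].
    replace (Cmod c * (eps / (Cmod c + 1)) * (Cmod c + 1)) with (Cmod c * eps) by (field; lra).
    nra.
Qed.

Lemma is_zsum_reindex f s (h h' : Z -> Z) :
  (forall n, h (h' n) = n) -> (forall n, h' (h n) = n) ->
  is_zsum f s -> is_zsum (fun n => f (h n)) s.
Proof.
  intros H1 H2 H eps He. destruct (H eps He) as [K HK].
  destruct (incl_zbox (map h' (zbox K))) as [K' HK'].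
  exists K'. intros l Hl Hi. rewrite <- csum_map. apply HK.
  - apply FinFun.Injective_map_NoDup; auto.
    intros x y E. rewrite <- (H2 x), <- (H2 y), E. reflexivity.
  - intros n Hn. rewrite <- (H1 n). apply in_map, Hi, HK', in_map, Hn.
Qed.

Lemma is_zsum_le f s B :
  (forall l, NoDup l -> Cmod (csum l f) <= B) -> is_zsum f s -> Cmod s <= B.
Proof.
  intros HB H. apply Rnot_lt_le. intros Hlt.
  destruct (H (Cmod s - B)) as [K HK]; [lra|].
  specialize (HK (zbox K) (NoDup_zbox _) (incl_refl _)).
  specialize (HB (zbox K) (NoDup_zbox _)).
  set (c := csum _ f) in *.
  assert (Cmod s <= Cmod c + Cmod (c - s)%C); [|lra].
  replace s with (c + - (c - s))%C at 1 by ring.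
  eapply Rle_trans; [apply Cmod_triangle|]. rewrite Cmod_opp. lra.
Qed.

Lemma is_zsum_ge (g : Z -> R) s n :
  (forall n, 0 <= g n) -> is_zsum (fun n => RtoC (g n)) s -> g n <= fst s.
Proof.
  intros Hg H. apply Rnot_lt_le. intros Hlt.
  destruct (H (g n - fst s)) as [K HK]; [lra|].
  set (N := max K (Z.abs_nat n)).
  specialize (HK (zbox N) (NoDup_zbox _) (incl_zbox_le K N ltac:(lia))).
  rewrite csum_RtoC in HK.
  assert (rsum [n] g <= rsum (zbox N) g).
  { apply rsum_incl; auto using Z.eq_dec, NoDup_zbox.
    - constructor; [easy|constructor].
    - intros x [<-|[]]. apply In_zbox. lia. }
  simpl in H0.
  assert (A := Cmod_fst (RtoC (rsum (zbox N) g) - s)%C). simpl in A.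
  assert (B := Rle_abs (rsum (zbox N) g + - fst s)). lra.
Qed.

(** * Square summable sequences and convolution *)

Ltac zlia := intros; cbv beta in *; lia.

Definition l2 (f : Z -> C) : Prop := exists B, zsum_le (fun n => Cmod (f n) ^ 2) B.

(* Coefficients of the product of the Fourier series with coefficients [f] and [g]. *)
Definition conv (f g : Z -> C) (k : Z) : C := zsum (fun n => f n * g (k - n)%Z)%C.

(** Coefficients of the complex conjugate function. *)
Definition bar (f : Z -> C) (n : Z) : C := Cconj (f (- n)%Z).

(* Multiplication by the Laurent polynomial [u X + v X^-1 + e], where [X] shifts the index by one. *)
Definition laurent (u v e : C) (f : Z -> C) (n : Z) : C :=
  (u * f (n + 1)%Z + v * f (n - 1)%Z + e * f n)%C.

Lemma zsum_le_mono (f g : Z -> R) B :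
  (forall n, f n <= g n) -> zsum_le g B -> zsum_le f B.
Proof. intros H HB l Hl. eapply Rle_trans; [apply rsum_le; auto|auto]. Qed.

Lemma zsum_le_plus f g B B' :
  zsum_le f B -> zsum_le g B' -> zsum_le (fun n => f n + g n) (B + B').
Proof. intros H H' l Hl. rewrite rsum_plus. specialize (H l Hl). specialize (H' l Hl). lra. Qed.

Lemma zsum_le_scal f B c : 0 <= c -> zsum_le f B -> zsum_le (fun n => c * f n) (c * B).
Proof. intros Hc H l Hl. rewrite rsum_scal. apply Rmult_le_compat_l; auto. Qed.

Lemma l2_ext f g : (forall n, f n = g n) -> l2 f -> l2 g.
Proof. intros H. replace g with f; auto. apply functional_extensionality; auto. Qed.

Lemma l2_dominated f g : (forall n, Cmod (g n) <= Cmod (f n)) -> l2 f -> l2 g.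
Proof.
  intros H [B HB]. exists B. eapply zsum_le_mono; [|apply HB].
  intros n. apply pow_incr. split; [apply Cmod_ge_0|auto].
Qed.

Lemma l2_plus f g : l2 f -> l2 g -> l2 (fun n => f n + g n)%C.
Proof.
  intros [B HB] [B' HB']. exists (2 * (B + B')).
  eapply zsum_le_mono; [|apply (zsum_le_scal _ _ 2 ltac:(lra) (zsum_le_plus _ _ _ _ HB HB'))].
  intros n. cbv beta. assert (T := Cmod_triangle (f n) (g n)).
  assert (0 <= Cmod (f n + g n)%C) by apply Cmod_ge_0.
  assert (0 <= (Cmod (f n) - Cmod (g n)) ^ 2) by apply pow2_ge_0. nra.
Qed.

Lemma l2_scal f c : l2 f -> l2 (fun n => c * f n)%C.
Proof.
  intros [B HB]. exists (Cmod c ^ 2 * B).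
  eapply zsum_le_mono; [|apply (zsum_le_scal _ _ (Cmod c ^ 2) (pow2_ge_0 _) HB)].
  intros n. cbv beta. rewrite Cmod_mult. right; ring.
Qed.

Lemma l2_reindex f (h : Z -> Z) :
  (forall x y, h x = h y -> x = y) -> l2 f -> l2 (fun n => f (h n)).
Proof. intros Hh [B HB]. exists B. apply (zsum_le_reindex _ _ h Hh HB). Qed.

Lemma l2_laurent u v e f : l2 f -> l2 (laurent u v e f).
Proof.
  intros H. apply l2_plus; [apply l2_plus|]; apply l2_scal; auto.
  - apply (l2_reindex f (fun n => n + 1)%Z); auto; zlia.
  - apply (l2_reindex f (fun n => n - 1)%Z); auto; zlia.
Qed.

Lemma l2_bar f : l2 f -> l2 (bar f).
Proof.
  intros H. apply l2_dominated with (fun n => f (- n)%Z).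
  - intros n. unfold bar. rewrite Cmod_conj. lra.
  - apply (l2_reindex f (fun n => - n)%Z); auto; zlia.
Qed.

Lemma l2_unimodular f (u : Z -> C) :
  (forall n, Cmod (u n) = 1) -> l2 f -> l2 (fun n => u n * f n)%C.
Proof. intros H. apply l2_dominated. intros n. rewrite Cmod_mult, H. lra. Qed.

Lemma conv_abs_bound f g :
  l2 f -> l2 g -> exists B, forall k, zsum_le (fun n => Cmod (f n) * Cmod (g (k - n)%Z)) B.
Proof.
  intros [B HB] [B' HB']. exists (/ 2 * (B + B')). intros k.
  assert (HB'' := zsum_le_reindex _ _ (fun n => k - n)%Z ltac:(zlia) HB').
  eapply zsum_le_mono; [|apply (zsum_le_scal _ _ (/ 2) ltac:(lra) (zsum_le_plus _ _ _ _ HB HB''))].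
  intros n. cbv beta.
  assert (0 <= (Cmod (f n) - Cmod (g (k - n)%Z)) ^ 2) by apply pow2_ge_0. nra.
Qed.

Lemma zsum_tail_indicator g B :
  (forall n, 0 <= g n) -> zsum_le g B -> forall eps, 0 < eps ->
  exists K, zsum_le (fun n => if zmem n (zbox K) then 0 else g n) eps.
Proof.
  intros Hg HB eps Heps. destruct (zsum_tail g B Hg HB eps Heps) as [K HK].
  exists K. intros l Hl.
  replace (rsum l _) with (rsum (filter (fun n => negb (zmem n (zbox K))) l) g).
  - apply HK; [apply NoDup_filter; auto|]. intros n Hn. apply filter_In in Hn as [_ Hn].
    unfold zmem in Hn. destruct (in_dec _ _ _); simpl in Hn; congruence.
  - clear Hl. induction l as [|x l IH]; [reflexivity|]. simpl.
    destruct (zmem x (zbox K)); simpl; rewrite IH; ring.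
Qed.

(** A Riemann-Lebesgue lemma: for |k| > K1 + K2 the indices n and k - n cannot both lie in the boxes
    that carry almost all of [f] and [g]. Absolute values are summed so that the bound survives
    arbitrary phases, such as those produced by translations. *)
Lemma conv_abs_decay f g :
  l2 f -> l2 g -> forall eps, 0 < eps -> exists K, forall k, (Z.of_nat K < Z.abs k)%Z ->
    zsum_le (fun n => Cmod (f n) * Cmod (g (k - n)%Z)) eps.
Proof.
  intros [B HB] [B' HB'] eps Heps.
  assert (B0 : 0 <= B) by (apply (HB nil); constructor).
  assert (B0' : 0 <= B') by (apply (HB' nil); constructor).
  (* Weight for a b <= (tau a^2 + b^2 / tau) / 2. It is so large that the full square sums, divided
     by 2 tau, contribute at most eps / 2; the tails, weighted by tau, contribute the other half. *)
  set (tau := (B + B' + 1) / eps).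
  assert (Ht : 0 < tau) by (apply Rdiv_lt_0_compat; lra).
  destruct (zsum_tail_indicator _ _ (fun n => pow2_ge_0 (Cmod (f n))) HB (eps / (2 * tau)))
    as [K1 H1]; [apply Rdiv_lt_0_compat; lra|].
  destruct (zsum_tail_indicator _ _ (fun n => pow2_ge_0 (Cmod (g n))) HB' (eps / (2 * tau)))
    as [K2 H2]; [apply Rdiv_lt_0_compat; lra|].
  exists (K1 + K2)%nat. intros k Hk.
  assert (H3 := zsum_le_reindex _ _ (fun n => k - n)%Z ltac:(zlia) HB').
  assert (H4 := zsum_le_reindex _ _ (fun n => k - n)%Z ltac:(zlia) H2).
  assert (It : 0 <= / tau) by (left; apply Rinv_0_lt_compat; auto).
  (* The sum of two bounds, the tail of [f] against all of [g] and conversely; whichever index lies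
     outside its box selects the bound that applies. *)
  assert (T := zsum_le_plus _ _ _ _
    (zsum_le_scal _ _ (/ 2) ltac:(lra) (zsum_le_plus _ _ _ _
       (zsum_le_scal _ _ tau (Rlt_le _ _ Ht) H1) (zsum_le_scal _ _ _ It H3)))
    (zsum_le_scal _ _ (/ 2) ltac:(lra) (zsum_le_plus _ _ _ _
       (zsum_le_scal _ _ _ It HB) (zsum_le_scal _ _ tau (Rlt_le _ _ Ht) H4)))).
  assert (E : / 2 * (tau * (eps / (2 * tau)) + / tau * B') +
     / 2 * (/ tau * B + tau * (eps / (2 * tau))) <= eps).
  { replace (/ 2 * (tau * (eps / (2 * tau)) + / tau * B') +
     / 2 * (/ tau * B + tau * (eps / (2 * tau)))) with (eps / 2 + (B + B') / (2 * tau))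
      by (field; lra).
    assert ((B + B') / (2 * tau) <= eps / 2); [|lra].
    apply Rmult_le_reg_r with (2 * tau); [lra|].
    replace ((B + B') / (2 * tau) * (2 * tau)) with (B + B') by (field; lra).
    replace (eps / 2 * (2 * tau)) with (B + B' + 1) by (unfold tau; field; lra). lra. }
  intros l Hl. eapply Rle_trans; [|apply E]. eapply Rle_trans; [|apply (T l Hl)].
  apply rsum_le. intros n _. cbv beta.
  set (a := Cmod (f n)). set (b := Cmod (g (k - n)%Z)).
  assert (AM1 : a * b <= / 2 * (tau * a ^ 2 + / tau * b ^ 2)).
  { assert (0 <= / tau * (tau * a - b) ^ 2) by (apply Rmult_le_pos; auto; apply pow2_ge_0).
    replace (/ tau * (tau * a - b) ^ 2) with (tau * a ^ 2 - 2 * a * b + / tau * b ^ 2) in H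
      by (field; lra). lra. }
  assert (AM2 : a * b <= / 2 * (/ tau * a ^ 2 + tau * b ^ 2)).
  { assert (0 <= / tau * (tau * b - a) ^ 2) by (apply Rmult_le_pos; auto; apply pow2_ge_0).
    replace (/ tau * (tau * b - a) ^ 2) with (tau * b ^ 2 - 2 * a * b + / tau * a ^ 2) in H
      by (field; lra). lra. }
  assert (P1 : 0 <= / tau * a ^ 2) by (apply Rmult_le_pos; auto; apply pow2_ge_0).
  assert (P2 : 0 <= / tau * b ^ 2) by (apply Rmult_le_pos; auto; apply pow2_ge_0).
  assert (P3 : 0 <= tau * a ^ 2) by (apply Rmult_le_pos; [lra|apply pow2_ge_0]).
  assert (P4 : 0 <= tau * b ^ 2) by (apply Rmult_le_pos; [lra|apply pow2_ge_0]).
  unfold zmem.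
  destruct (in_dec Z.eq_dec n (zbox K1)) as [i1|i1];
  destruct (in_dec Z.eq_dec (k - n)%Z (zbox K2)) as [i2|i2]; try lra.
  exfalso. rewrite In_zbox in i1, i2. lia.
Qed.

Lemma summable_conv f g k : l2 f -> l2 g -> summable (fun n => f n * g (k - n)%Z)%C.
Proof.
  intros Hf Hg. destruct (conv_abs_bound f g Hf Hg) as [B HB]. exists B.
  eapply zsum_le_mono; [|apply (HB k)]. intros n. cbv beta. rewrite Cmod_mult. lra.
Qed.

Lemma conv_correct f g k :
  l2 f -> l2 g -> is_zsum (fun n => f n * g (k - n)%Z)%C (conv f g k).
Proof. intros Hf Hg. apply zsum_correct, summable_conv; auto. Qed.

Lemma is_zsum_ext f g s : (forall n, f n = g n) -> is_zsum f s -> is_zsum g s.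
Proof. intros H. replace g with f; auto. apply functional_extensionality; auto. Qed.

Lemma conv_ext f f' g g' k :
  (forall n, f n = f' n) -> (forall n, g n = g' n) -> conv f g k = conv f' g' k.
Proof.
  intros H H'. replace f' with f by (apply functional_extensionality; auto).
  replace g' with g by (apply functional_extensionality; auto). reflexivity.
Qed.

Lemma conv_comm f g k : l2 f -> l2 g -> conv f g k = conv g f k.
Proof.
  intros Hf Hg. eapply is_zsum_unique; [apply conv_correct; auto|].
  assert (H := is_zsum_reindex _ _ (fun n => k - n)%Z (fun n => k - n)%Z
    ltac:(zlia) ltac:(zlia) (conv_correct g f k Hg Hf)).
  eapply is_zsum_ext; [|apply H]. intros n. cbv beta.
  replace (k - (k - n))%Z with n by lia. ring.
Qed.

Lemma conv_plus_l f f' g k :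
  l2 f -> l2 f' -> l2 g -> conv (fun n => f n + f' n)%C g k = (conv f g k + conv f' g k)%C.
Proof.
  intros Hf Hf' Hg. eapply is_zsum_unique; [apply conv_correct; auto using l2_plus|].
  eapply is_zsum_ext; [|apply is_zsum_plus; apply conv_correct; auto].
  intros n. cbv beta. ring.
Qed.

Lemma conv_scal_l f g k c : l2 f -> l2 g -> conv (fun n => c * f n)%C g k = (c * conv f g k)%C.
Proof.
  intros Hf Hg. eapply is_zsum_unique; [apply conv_correct; auto using l2_scal|].
  eapply is_zsum_ext; [|apply is_zsum_scal; apply conv_correct; auto].
  intros n. cbv beta. ring.
Qed.

Lemma conv_plus_r f g g' k :
  l2 f -> l2 g -> l2 g' -> conv f (fun n => g n + g' n)%C k = (conv f g k + conv f g' k)%C.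
Proof.
  intros. rewrite conv_comm, conv_plus_l; auto using l2_plus.
  f_equal; apply conv_comm; auto.
Qed.

Lemma conv_scal_r f g k c : l2 f -> l2 g -> conv f (fun n => c * g n)%C k = (c * conv f g k)%C.
Proof.
  intros. rewrite conv_comm, conv_scal_l; auto using l2_scal.
  f_equal; apply conv_comm; auto.
Qed.

Lemma conv_shift_l f g j k :
  l2 f -> l2 g -> conv (fun n => f (n + j)%Z) g k = conv f g (k + j)%Z.
Proof.
  intros Hf Hg. eapply is_zsum_unique.
  { apply conv_correct; auto. apply (l2_reindex f (fun n => n + j)%Z); auto. zlia. }
  assert (H := is_zsum_reindex _ _ (fun n => n + j)%Z (fun n => n - j)%Z
    ltac:(zlia) ltac:(zlia) (conv_correct f g (k + j) Hf Hg)).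
  eapply is_zsum_ext; [|apply H]. intros n. cbv beta.
  replace (k + j - (n + j))%Z with (k - n)%Z by lia. reflexivity.
Qed.

Lemma conv_laurent_l u v e f g k :
  l2 f -> l2 g -> conv (laurent u v e f) g k = laurent u v e (conv f g) k.
Proof.
  intros Hf Hg. unfold laurent.
  assert (l2 (fun n => f (n + 1)%Z))
    by (apply (l2_reindex f (fun n => n + 1)%Z); auto; zlia).
  assert (l2 (fun n => f (n - 1)%Z))
    by (apply (l2_reindex f (fun n => n - 1)%Z); auto; zlia).
  rewrite !conv_plus_l, !conv_scal_l; auto using l2_plus, l2_scal.
  rewrite (conv_shift_l f g 1) by auto.
  rewrite (conv_ext (fun n => f (n - 1)%Z) (fun n => f (n + - 1)%Z) g g) by auto.
  rewrite (conv_shift_l f g (- 1)) by auto. reflexivity.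
Qed.

Lemma laurent_ext u v e f g n : (forall n, f n = g n) -> laurent u v e f n = laurent u v e g n.
Proof. intros H. unfold laurent. rewrite !H. reflexivity. Qed.

Lemma conv_laurent_r u v e f g k :
  l2 f -> l2 g -> conv f (laurent u v e g) k = laurent u v e (conv f g) k.
Proof.
  intros. rewrite conv_comm, conv_laurent_l; auto using l2_laurent.
  apply laurent_ext. intros; apply conv_comm; auto.
Qed.

(** Multiplying coefficients by a character translates the function, and translation respects
    products. *)
Lemma conv_character f g (u : Z -> C) k :
  (forall n m, u (n + m)%Z = (u n * u m)%C) -> (forall n, Cmod (u n) = 1) ->
  l2 f -> l2 g ->
  conv (fun n => u n * f n)%C (fun n => u n * g n)%C k = (u k * conv f g k)%C.
Proof.
  intros Hu Hu1 Hf Hg. eapply is_zsum_unique; [apply conv_correct; auto using l2_unimodular|].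
  eapply is_zsum_ext; [|apply is_zsum_scal; apply conv_correct; auto].
  intros n. cbv beta. replace (u k) with (u n * u (k - n)%Z)%C by (rewrite <- Hu; f_equal; lia).
  ring.
Qed.

Lemma conv_bar_0_pos f n : l2 f -> Cmod (f n) ^ 2 <= fst (conv f (bar f) 0%Z).
Proof.
  intros Hf. apply (is_zsum_ge (fun n => Cmod (f n) ^ 2)); [intros; apply pow2_ge_0|].
  eapply is_zsum_ext; [|apply conv_correct; auto using l2_bar].
  intros k. unfold bar. cbv beta. rewrite Cmod2_conj.
  replace (- (0 - k))%Z with k by lia. reflexivity.
Qed.

Lemma conv_bar_0_eq0 f n : l2 f -> conv f (bar f) 0%Z = RtoC 0 -> f n = RtoC 0.
Proof.
  intros Hf H. assert (A := conv_bar_0_pos f n Hf). rewrite H in A. simpl in A.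
  assert (B := Cmod_ge_0 (f n)). apply Cmod_eq_0. nra.
Qed.

(** One [K] serves all sequences with the given moduli, in particular all translates of the two
    functions. *)
Lemma conv_decay f g :
  l2 f -> l2 g -> forall eps, 0 < eps -> exists K, forall k, (Z.of_nat K < Z.abs k)%Z ->
  forall f' g', (forall n, Cmod (f' n) = Cmod (f n)) -> (forall n, Cmod (g' n) = Cmod (g n)) ->
  Cmod (conv f' g' k) <= eps.
Proof.
  intros Hf Hg eps Heps. destruct (conv_abs_decay f g Hf Hg eps Heps) as [K HK].
  exists K. intros k Hk f' g' Hf' Hg'.
  apply (is_zsum_le (fun n => f' n * g' (k - n)%Z)%C).
  - intros l Hl. eapply Rle_trans; [apply Cmod_csum|]. eapply Rle_trans; [|apply (HK k Hk l Hl)].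
    apply rsum_le. intros n _. rewrite Cmod_mult, Hf', Hg'. lra.
  - apply conv_correct; [apply l2_dominated with f|apply l2_dominated with g]; auto;
      intros; rewrite ?Hf', ?Hg'; lra.
Qed.

Lemma conv_bound f g :
  l2 f -> l2 g -> exists B, forall k f' g',
  (forall n, Cmod (f' n) = Cmod (f n)) -> (forall n, Cmod (g' n) = Cmod (g n)) ->
  Cmod (conv f' g' k) <= B.
Proof.
  intros Hf Hg. destruct (conv_abs_bound f g Hf Hg) as [B HB].
  exists B. intros k f' g' Hf' Hg'.
  apply (is_zsum_le (fun n => f' n * g' (k - n)%Z)%C).
  - intros l Hl. eapply Rle_trans; [apply Cmod_csum|]. eapply Rle_trans; [|apply (HB k l Hl)].
    apply rsum_le. intros n _. rewrite Cmod_mult, Hf', Hg'. lra.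
  - apply conv_correct; [apply l2_dominated with f|apply l2_dominated with g]; auto;
      intros; rewrite ?Hf', ?Hg'; lra.
Qed.

(** * The cocycle equation *)

Lemma conv_bilinear a b c d f g f' g' k :
  l2 f -> l2 g -> l2 f' -> l2 g' ->
  conv (fun n => a * f n + b * g n)%C (fun n => c * f' n + d * g' n)%C k =
  (a * c * conv f f' k + a * d * conv f g' k + b * c * conv g f' k + b * d * conv g g' k)%C.
Proof.
  intros. rewrite conv_plus_l, !conv_scal_l, !conv_plus_r, !conv_scal_r;
    auto using l2_scal, l2_plus. ring.
Qed.

Lemma bar_laurent u v e f n :
  bar (laurent u v e f) n = laurent (Cconj v) (Cconj u) (Cconj e) (bar f) n.
Proof.
  unfold bar, laurent. rewrite !Cplus_conj, !Cmult_conj.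
  replace (- (n + 1))%Z with (- n - 1)%Z by lia.
  replace (- (n - 1))%Z with (- n + 1)%Z by lia. ring.
Qed.

Lemma RtoC_neq (x y : R) : x <> y -> RtoC x <> RtoC y.
Proof. intros H E. apply H. injection E; auto. Qed.

Lemma Cconj_R (x : R) : Cconj (RtoC x) = RtoC x.
Proof. apply injective_projections; simpl; ring. Qed.

Lemma Cconj_Ci : Cconj Ci = (- Ci)%C.
Proof. apply injective_projections; simpl; ring. Qed.

Lemma Ci2 : (Ci * Ci)%C = (- (1))%C.
Proof. apply injective_projections; simpl; ring. Qed.

Lemma Cmod_Ci : Cmod Ci = 1.
Proof. transitivity (sqrt 1); [unfold Cmod, Ci; simpl; f_equal; ring|apply sqrt_1]. Qed.

Section Walk.
Variables (lam lp : R) (w : Z -> C).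
Hypothesis lam_pos : 0 < lam.
Hypothesis lp_pos : 0 < lp.
Hypothesis lam_lp : lam * lam + lp * lp = 1.
Hypothesis w_add : forall a b, w (a + b)%Z = (w a * w b)%C.
Hypothesis w_unit : forall a, Cmod (w a) = 1.

(** The symbols of [opA], [opB], [opD] are lam cos(2 pi x) - i lp, - i lam sin(2 pi x) and lam cos(2
    pi x) + i lp. They form the unitary matrix of S^* with rows (opA, opB), (opB, opD) and
    determinant opA opD - opB^2 = 1. *)
Definition opA := laurent (RtoC (lam / 2)) (RtoC (lam / 2)) (- (Ci * RtoC lp))%C.
Definition opB := laurent (RtoC (lam / 2)) (- RtoC (lam / 2))%C (RtoC 0).
Definition opD := laurent (RtoC (lam / 2)) (RtoC (lam / 2)) (Ci * RtoC lp)%C.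

(* In the eigenbasis of the rotation part of Q_n the equation Q psi = z S^* psi reads
   (y, r) = z S^* (p, m), where y and r are the two components of Q psi; S^* acts by Laurent
   polynomials and Q by the character [w]. *)
Record solution (z phi : C) (p m y r : Z -> C) : Prop := {
  sol_p : l2 p; sol_m : l2 m; sol_y : l2 y; sol_r : l2 r;
  sol_Sy : forall n, y n = (z * (opA p n + opB m n))%C;
  sol_Sr : forall n, r n = (z * (opB p n + opD m n))%C;
  sol_Qy : forall n, y n = (RtoC lam * phi * (w n * p n) + Ci * RtoC lp * m n)%C;
  sol_Qr : forall n, (phi * (w n * r n))%C =
             (RtoC lam * m n + Ci * RtoC lp * (phi * (w n * p n)))%C }.

Lemma w_0 : w 0 = RtoC 1.
Proof.
  assert (H := w_add 0 0). simpl in H.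
  assert (Hn : w 0 <> RtoC 0).
  { intros E. assert (U := w_unit 0). rewrite E, Cmod_0 in U. lra. }
  replace (w 0) with (w 0 * w 0 / w 0)%C by (field; auto). rewrite <- H. field; auto.
Qed.

Lemma unimodular_conj (u : C) : Cmod u = 1 -> (u * Cconj u)%C = RtoC 1.
Proof. intros H. rewrite <- Cmod2_conj, H. apply injective_projections; simpl; ring. Qed.

Lemma w_neg n : w (- n) = Cconj (w n).
Proof.
  assert (H : (w n * w (- n))%C = RtoC 1).
  { rewrite <- w_add. replace (n + - n)%Z with 0%Z by lia. apply w_0. }
  assert (H' := unimodular_conj _ (w_unit n)).
  transitivity (w n * Cconj (w n) * w (- n))%C; [rewrite H'; ring|].
  transitivity (w n * w (- n) * Cconj (w n))%C; [ring|rewrite H; ring].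
Qed.

Lemma bar_w f n : bar (fun n => w n * f n)%C n = (w n * bar f n)%C.
Proof.
  unfold bar. rewrite Cmult_conj, w_neg, Cconj_conj. reflexivity.
Qed.

Lemma lp2 : (RtoC lp * RtoC lp)%C = (1 - RtoC lam * RtoC lam)%C.
Proof. rewrite <- !RtoC_mult, <- RtoC_minus. f_equal. lra. Qed.

Lemma bar_opA f n : bar (opA f) n = opD (bar f) n.
Proof.
  unfold opA, opD. rewrite bar_laurent. unfold laurent.
  rewrite Copp_conj, Cmult_conj, !Cconj_R, Cconj_Ci. ring.
Qed.

Lemma bar_opD f n : bar (opD f) n = opA (bar f) n.
Proof.
  unfold opA, opD. rewrite bar_laurent. unfold laurent.
  rewrite Cmult_conj, !Cconj_R, Cconj_Ci. ring.
Qed.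

Lemma bar_opB f n : bar (opB f) n = (- opB (bar f) n)%C.
Proof.
  unfold opB. rewrite bar_laurent. unfold laurent.
  rewrite Copp_conj, !Cconj_R. ring.
Qed.

Lemma lp2_half :
  (RtoC lp * RtoC lp)%C = (1 - (1 + 1 + 1 + 1) * (RtoC (lam / 2) * RtoC (lam / 2)))%C.
Proof. rewrite lp2. replace (RtoC lam) with (RtoC (lam / 2) + RtoC (lam / 2))%C; [ring|].
  rewrite <- RtoC_plus. f_equal. field. Qed.

Ltac laurent_ring :=
  unfold opA, opB, opD, laurent;
  rewrite ?Z.add_simpl_r, ?Z.sub_add; ring [lp2_half Ci2].

Section Pair.
Variables (z phi phi' : C) (p m y r p' m' y' r' : Z -> C).
Hypothesis Hs : solution z phi p m y r.
Hypothesis Hs' : solution z phi' p' m' y' r'.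

(** Unitarity of the symbol of S^* at every point of the circle, polarized to two solutions. *)
Lemma solution_S_isometry k :
  (conv y (bar y') k + conv r (bar r') k =
   z * Cconj z * (conv p (bar p') k + conv m (bar m') k))%C.
Proof.
  destruct Hs as [Lp Lm Ly Lr E1 E2 E3 E4]. destruct Hs' as [Lp' Lm' Ly' Lr' F1 F2 F3 F4].
  assert (G1 : forall n, bar y' n = (Cconj z * opD (bar p') n + (- Cconj z) * opB (bar m') n)%C).
  { intros n. rewrite <- bar_opA. replace (opB (bar m') n) with (- bar (opB m') n)%C
      by (rewrite bar_opB; ring).
    unfold bar. rewrite F1, Cmult_conj, Cplus_conj. ring. }
  assert (G2 : forall n, bar r' n = ((- Cconj z) * opB (bar p') n + Cconj z * opA (bar m') n)%C).
  { intros n. rewrite <- bar_opD. replace (opB (bar p') n) with (- bar (opB p') n)%C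
      by (rewrite bar_opB; ring).
    unfold bar. rewrite F2, Cmult_conj, Cplus_conj. ring. }
  rewrite (conv_ext y (fun n => z * opA p n + z * opB m n)%C _ _ k
    ltac:(intros; rewrite E1; ring) G1).
  rewrite (conv_ext r (fun n => z * opB p n + z * opD m n)%C _ _ k
    ltac:(intros; rewrite E2; ring) G2).
  rewrite !conv_bilinear by (try apply l2_laurent; auto using l2_bar).
  unfold opA, opB, opD.
  rewrite !conv_laurent_l by (try apply l2_laurent; auto using l2_bar).
  (* Under an outer Laurent operator the convolution is not applied to an index, so the inner
     operator is moved out by extensionality. What remains is a Laurent identity in four
     convolutions. *)
  repeat match goal with |- context [laurent ?u ?v ?e (conv ?f (laurent ?u' ?v' ?e' ?g)) ?j] =>
    rewrite (laurent_ext u v e (conv f (laurent u' v' e' g)) (laurent u' v' e' (conv f g)) j)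
      by (intros; apply conv_laurent_r; auto using l2_bar) end.
  laurent_ring.
Qed.

(** The two Q-equations say that the unitary matrix with rows (lam, i lp), (i lp, lam) maps (phi p(x
    + Phi), m(x)) to (y(x), phi r(x + Phi)). The factor [w k] is the translation of the products of
    two solutions. *)
Lemma solution_Q_isometry k :
  (conv y (bar y') k + phi * Cconj phi' * w k * conv r (bar r') k =
   phi * Cconj phi' * w k * conv p (bar p') k + conv m (bar m') k)%C.
Proof.
  destruct Hs as [Lp Lm Ly Lr E1 E2 E3 E4]. destruct Hs' as [Lp' Lm' Ly' Lr' F1 F2 F3 F4].
  assert (G1 : forall n, bar y' n =
    ((RtoC lam * Cconj phi') * (w n * bar p' n) + (- (Ci * RtoC lp)) * bar m' n)%C).
  { intros n. rewrite <- bar_w. unfold bar. rewrite F3, Cplus_conj, !Cmult_conj.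
    rewrite !Cconj_R, Cconj_Ci. ring. }
  assert (X : conv (fun n => w n * r n)%C (fun n => w n * bar r' n)%C k = (w k * conv r (bar r') k)%C)
    by (apply conv_character; auto using l2_bar).
  assert (X' : conv (fun n => w n * p n)%C (fun n => w n * bar p' n)%C k = (w k * conv p (bar p') k)%C)
    by (apply conv_character; auto using l2_bar).
  assert (W : forall f, l2 f -> l2 (fun n => w n * f n)%C) by (intros; apply l2_unimodular; auto).
  transitivity (conv y (bar y') k + conv (fun n => phi * (w n * r n))%C
     (fun n => Cconj phi' * (w n * bar r' n))%C k)%C.
  { rewrite conv_scal_l, conv_scal_r, X; auto using l2_scal, l2_bar. ring. }
  rewrite (conv_ext y (fun n => (RtoC lam * phi) * (w n * p n) + (Ci * RtoC lp) * m n)%C _ _ k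
    E3 G1).
  rewrite (conv_ext (fun n => phi * (w n * r n))%C
    (fun n => (Ci * RtoC lp * phi) * (w n * p n) + RtoC lam * m n)%C
    (fun n => Cconj phi' * (w n * bar r' n))%C
    (fun n => (- (Ci * RtoC lp * Cconj phi')) * (w n * bar p' n) + RtoC lam * bar m' n)%C).
  2:{ intros n. rewrite E4. ring. }
  2:{ intros n. rewrite <- (bar_w p'), <- (bar_w r'). unfold bar.
      rewrite <- Cmult_conj, F4, Cplus_conj, !Cmult_conj, !Cconj_R, Cconj_Ci. ring. }
  rewrite !conv_bilinear by auto using l2_bar.
  rewrite X'. ring [lp2 Ci2].
Qed.

(** Subtracting the two isometries cancels y and m: p conj(p') - r conj(r') is invariant under
    translation by Phi up to the phase phi conj(phi'). *)
Lemma solution_current k :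
  (z * Cconj z)%C = RtoC 1 ->
  (phi * Cconj phi' * w k * (conv p (bar p') k - conv r (bar r') k) =
   conv p (bar p') k - conv r (bar r') k)%C.
Proof.
  intros Hz. assert (A := solution_S_isometry k). assert (B := solution_Q_isometry k).
  rewrite Hz in A.
  transitivity ((phi * Cconj phi' * w k * conv p (bar p') k + conv m (bar m') k)
    - conv m (bar m') k - phi * Cconj phi' * w k * conv r (bar r') k)%C; [ring|].
  rewrite <- B.
  transitivity (1 * (conv p (bar p') k + conv m (bar m') k) - conv r (bar r') k - conv m (bar m') k)%C;
    [rewrite <- A|]; ring.
Qed.
End Pair.

(** At k = 0 the isometries compare total square sums: one multiplies the total by |z|^2, the other
    preserves it, and the total is not zero. *)
Lemma eigenvalue_unimodular z phi p m y r n :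
  Cmod phi = 1 -> solution z phi p m y r -> p n <> RtoC 0 \/ m n <> RtoC 0 ->
  (z * Cconj z)%C = RtoC 1.
Proof.
  intros Hphi Hs Hn.
  assert (A := solution_S_isometry z phi phi p m y r p m y r Hs Hs 0%Z).
  assert (B := solution_Q_isometry z phi phi p m y r p m y r Hs Hs 0%Z).
  rewrite (unimodular_conj phi Hphi), w_0 in B.
  assert (Bp := conv_bar_0_pos p n (sol_p _ _ _ _ _ _ Hs)).
  assert (Bm := conv_bar_0_pos m n (sol_m _ _ _ _ _ _ Hs)).
  set (T := (conv p (bar p) 0%Z + conv m (bar m) 0%Z)%C) in *.
  assert (HT : T <> RtoC 0).
  { intros E. apply (f_equal fst) in E.
    change (fst (conv p (bar p) 0%Z) + fst (conv m (bar m) 0%Z) = 0) in E.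
    assert (Cp := Cmod_ge_0 (p n)). assert (Cm := Cmod_ge_0 (m n)).
    assert (Dp := pow2_ge_0 (Cmod (p n))). assert (Dm := pow2_ge_0 (Cmod (m n))).
    assert (Cmod (p n) = 0) by nra. assert (Cmod (m n) = 0) by nra.
    destruct Hn as [Hn|Hn]; apply Hn, Cmod_eq_0; auto. }
  assert (E : (z * Cconj z * T = T)%C).
  { rewrite <- A. transitivity (1 * 1 * conv p (bar p) 0%Z + conv m (bar m) 0%Z)%C;
      [rewrite <- B|unfold T]; ring. }
  replace (z * Cconj z)%C with (z * Cconj z * T / T)%C by (field; auto).
  rewrite E. field; auto.
Qed.

(** Expressing m and y through p and r requires division by the symbol of [opD]; the denominator is
    kept on the left instead. [K1] rests on opA opD - opB^2 = 1, and [K2] is the second S-equation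
    solved for m. *)
Lemma solution_transfer_p z phi p m y r n :
  (z * Cconj z)%C = RtoC 1 -> solution z phi p m y r ->
  (RtoC lam * phi * opD (fun n => w n * p n) n =
   laurent (Ci * RtoC lp * RtoC (lam / 2)) (- (Ci * RtoC lp * RtoC (lam / 2))) z p n +
   laurent (RtoC (lam / 2)) (- RtoC (lam / 2)) (- (Ci * RtoC lp * Cconj z)) r n)%C.
Proof.
  intros Hz [Lp Lm Ly Lr E1 E2 E3 E4].
  transitivity (opD y n - Ci * RtoC lp * opD m n)%C.
  { unfold opD, laurent. rewrite !E3. ring. }
  assert (K1 : (opD y n = z * p n + opB r n)%C).
  { unfold opD, opB, laurent. rewrite !E1, !E2. laurent_ring. }
  assert (K2 : (opD m n = Cconj z * r n - opB p n)%C).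
  { rewrite E2. transitivity (z * Cconj z * (opB p n + opD m n) - opB p n)%C; [|ring].
    rewrite Hz. ring. }
  rewrite K1, K2. unfold opB, laurent. ring.
Qed.

Lemma solution_transfer_r z phi p m y r n :
  (z * Cconj z)%C = RtoC 1 -> solution z phi p m y r ->
  (RtoC lam * phi * opD (fun n => w n * r n) n =
   laurent (- RtoC (lam / 2)) (RtoC (lam / 2)) (Ci * RtoC lp * z) p n +
   laurent (Ci * RtoC lp * RtoC (lam / 2)) (- (Ci * RtoC lp * RtoC (lam / 2))) (Cconj z) r n)%C.
Proof.
  intros Hz [Lp Lm Ly Lr E1 E2 E3 E4].
  assert (E : forall n, (RtoC lam * phi * (w n * r n) = m n + Ci * RtoC lp * y n)%C).
  { intros j. transitivity (RtoC lam * (phi * (w j * r j)))%C; [ring|].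
    rewrite E4, E3. ring [lp2 Ci2]. }
  transitivity (opD m n + Ci * RtoC lp * opD y n)%C.
  { unfold opD, laurent.
    transitivity (RtoC (lam / 2) * (RtoC lam * phi * (w (n + 1)%Z * r (n + 1)%Z))
      + RtoC (lam / 2) * (RtoC lam * phi * (w (n - 1)%Z * r (n - 1)%Z))
      + Ci * RtoC lp * (RtoC lam * phi * (w n * r n)))%C; [ring|].
    rewrite !E. ring. }
  assert (K1 : (opD y n = z * p n + opB r n)%C).
  { unfold opD, opB, laurent. rewrite !E1, !E2. laurent_ring. }
  assert (K2 : (opD m n = Cconj z * r n - opB p n)%C).
  { rewrite E2. transitivity (z * Cconj z * (opB p n + opD m n) - opB p n)%C; [|ring].
    rewrite Hz. ring. }
  rewrite K1, K2. unfold opB, laurent. ring.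
Qed.

(** If p = 0, equality of the two square sums gives r = 0, and the second Q-equation is left with
    lam m = 0. *)
Lemma solution_p0_m0 z phi p m y r :
  Cmod phi = 1 -> solution z phi p m y r -> (forall n, p n = RtoC 0) ->
  conv p (bar p) 0%Z = conv r (bar r) 0%Z -> forall n, m n = RtoC 0.
Proof.
  intros Hphi Hs Hp HJ n. destruct Hs as [Lp Lm Ly Lr E1 E2 E3 E4].
  assert (Hr : r n = RtoC 0).
  { apply conv_bar_0_eq0; auto. rewrite <- HJ.
    rewrite (conv_ext p (fun n => RtoC 0 * p n)%C (bar p) (bar p)) by
      (auto; intros j; rewrite Hp; ring).
    rewrite conv_scal_l by auto using l2_bar. ring. }
  assert (K := E4 n). rewrite Hr, Hp in K.
  assert (K' : (RtoC lam * m n)%C = RtoC 0).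
  { transitivity (RtoC lam * m n + Ci * RtoC lp * (phi * (w n * 0)))%C; [ring|].
    rewrite <- K. ring. }
  assert (RtoC lam <> RtoC 0) by (apply RtoC_neq; lra).
  replace (m n) with (RtoC lam * m n / RtoC lam)%C by (field; auto).
  rewrite K'. field; auto.
Qed.

(** The substitution x -> 1/2 - x turns the symbol of [opA] into minus that of [opD] and fixes that
    of [opB]; hence p and m change places, and so do y and r. The sign in this exchange ends up in
    the new phase, which is the origin of the 1/4 in the theorem. The half-period shift is the
    factor s n = (-1)^n. *)
Lemma solution_reflect z phi p m y r :
  Cmod phi = 1 -> solution z phi p m y r ->
  exists s : Z -> C, (forall n, s n = RtoC 1 \/ s n = RtoC (- 1)) /\
  solution z (- Cconj phi)%C (fun n => s n * m (- n)%Z)%C (fun n => - (s n * p (- n)%Z))%C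
    (fun n => - (s n * r (- n)%Z))%C (fun n => s n * y (- n)%Z)%C.
Proof.
  intros Hphi [Lp Lm Ly Lr E1 E2 E3 E4].
  set (s := fun n => if Z.even n then RtoC 1 else RtoC (- 1)). exists s.
  assert (Hs : forall n, s n = RtoC 1 \/ s n = RtoC (- 1))
    by (intros n; unfold s; destruct (Z.even n); auto).
  split; auto.
  assert (S1 : forall n, s (n + 1)%Z = (- s n)%C).
  { intros n. unfold s. rewrite Z.even_add. destruct (Z.even n); simpl;
      apply injective_projections; simpl; ring. }
  assert (S2 : forall n, s (n - 1)%Z = (- s n)%C).
  { intros n. unfold s. rewrite Z.even_sub. destruct (Z.even n); simpl;
      apply injective_projections; simpl; ring. }
  assert (L : forall f, l2 f -> l2 (fun n => s n * f (- n)%Z)%C).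
  { intros f Hf. apply l2_unimodular.
    - intros n. destruct (Hs n) as [->| ->]; rewrite Cmod_R.
      + apply Rabs_R1.
      + rewrite Rabs_left; lra.
    - apply (l2_reindex f Z.opp); auto. zlia. }
  assert (L' : forall f, l2 f -> l2 (fun n => - (s n * f (- n)%Z))%C).
  { intros f Hf. apply l2_ext with (fun n => (- (1)) * (s n * f (- n)%Z))%C.
    - intros; ring.
    - apply (l2_scal _ _ (L f Hf)). }
  assert (N1 : forall n, (- (n + 1))%Z = (- n - 1)%Z) by zlia.
  assert (N2 : forall n, (- (n - 1))%Z = (- n + 1)%Z) by zlia.
  assert (U := unimodular_conj _ Hphi).
  assert (W : forall n, (w n * w (- n)%Z)%C = RtoC 1).
  { intros n. rewrite w_neg. apply unimodular_conj, w_unit. }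
  split; auto; intros n.
  - rewrite E2. unfold opA, opB, opD, laurent. rewrite !N1, !N2, S1, S2. ring.
  - rewrite E1. unfold opA, opB, opD, laurent. rewrite !N1, !N2, S1, S2. ring.
  - transitivity (- (s n * (Cconj phi * w n * (phi * (w (- n)%Z * r (- n)%Z)))))%C.
    { transitivity (- (s n * ((phi * Cconj phi) * (w n * w (- n)%Z) * r (- n)%Z)))%C;
        [rewrite U, W|]; ring. }
    rewrite E4.
    transitivity (- (s n * (Cconj phi * w n * (RtoC lam * m (- n)%Z)
      + Ci * RtoC lp * (phi * Cconj phi) * (w n * w (- n)%Z) * p (- n)%Z)))%C;
      [ring|rewrite U, W; ring].
  - rewrite E3.
    transitivity (- (s n * (RtoC lam * (phi * Cconj phi) * (w n * w (- n)%Z) * p (- n)%Z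
       + Ci * RtoC lp * Cconj phi * w n * m (- n)%Z)))%C; [ring|rewrite U, W; ring].
Qed.
End Walk.

(** * Products over best approximation denominators *)

Lemma csum_seq_S n (f : nat -> C) : csum (seq 0 (S n)) f = (csum (seq 0 n) f + f n)%C.
Proof. rewrite seq_S, csum_app. simpl. ring. Qed.

Lemma csum_seq_S_l n (f : nat -> C) :
  csum (seq 0 (S n)) f = (f 0%nat + csum (seq 0 n) (fun i => f (S i)))%C.
Proof. cbn [seq csum]. rewrite <- seq_shift, csum_map. reflexivity. Qed.

Lemma rsum_seq_S n (f : nat -> R) : rsum (seq 0 (S n)) f = rsum (seq 0 n) f + f n.
Proof. rewrite seq_S, rsum_app. simpl. ring. Qed.

(* Coefficients of the product of the [1 + a j X], [j < n]. *)
Fixpoint pcoef (a : nat -> C) (n k : nat) : C :=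
  match n, k with
  | O, O => RtoC 1
  | O, S _ => RtoC 0
  | S n', O => pcoef a n' 0
  | S n', S k' => (pcoef a n' (S k') + a n' * pcoef a n' k')%C
  end.

Definition pow_sum (a : nat -> C) (n m : nat) : C := csum (seq 0 n) (fun j => Cpow (a j) m).

Lemma pcoef_0 a n : pcoef a n 0 = RtoC 1.
Proof. induction n; simpl; auto. Qed.

(* The term [i] is (-1)^i p_(i+1) e_(k-i). *)
Lemma newton_identity a n k :
  (INR (S k) * pcoef a n (S k))%C =
  csum (seq 0 (S k)) (fun i => - (Cpow (- (1)) (S i) * pow_sum a n (S i)) * pcoef a n (k - i))%C.
Proof.
  revert k. induction n as [|n IH]; intros k.
  - rewrite csum_zero; [simpl; ring|]. intros i _. unfold pow_sum. cbn [seq csum]. ring.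
  - set (b := a n). set (g := pcoef a n) in *.
    set (c := fun i => (- (Cpow (- (1)) (S i) * pow_sum a n (S i)))%C).
    assert (Hc : forall i, (- (Cpow (- (1)) (S i) * pow_sum a (S n) (S i)))%C =
                 (c i - Cpow (- b) (S i))%C).
    { intros i. unfold c, pow_sum. rewrite csum_seq_S. fold b.
      replace (- b)%C with (- (1) * b)%C by ring. rewrite Cpow_mult_l. ring. }
    (* In generating functions: the sum of (-b)^(i+1) X^i is -b / (1 + b X), and 1 + b X is the
       factor that [pcoef a (S n)] has beyond [g]. *)
    assert (T : forall k, csum (seq 0 (S k)) (fun i => Cpow (- b) (S i) * pcoef a (S n) (k - i))%C
                 = (- b * g k)%C).
    { clear k. induction k as [|k IHk].
      - cbn [seq csum]. simpl. fold b. fold (g 0%nat). ring.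
      - rewrite csum_seq_S_l.
        rewrite (csum_ext _ _ (fun i => - b * (Cpow (- b) (S i) * pcoef a (S n) (k - i)))%C).
        2:{ intros i _. replace (S k - S i)%nat with (k - i)%nat by lia.
            cbn [Cpow]. ring. }
        rewrite csum_scal, IHk. replace (S k - 0)%nat with (S k) by lia.
        cbn [pcoef]. fold b. change (pcoef a n) with g. simpl Cpow. ring. }
    rewrite (csum_ext _ _ (fun i => c i * pcoef a (S n) (k - i) +
        - (1) * (Cpow (- b) (S i) * pcoef a (S n) (k - i)))%C).
    2:{ intros i _. rewrite Hc. ring. }
    rewrite csum_plus, csum_scal, T.
    assert (E : csum (seq 0 (S k)) (fun i => c i * pcoef a (S n) (k - i))%C =
       (INR (S k) * g (S k) + b * (INR k * g k))%C).
    { rewrite IH. destruct k as [|k].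
      - cbn [seq csum]. simpl. fold (g 0%nat). unfold c. ring.
      - rewrite IH, csum_seq_S, (csum_seq_S (S k)), <- csum_scal.
        rewrite (csum_ext (seq 0 (S k)) (fun i => c i * pcoef a (S n) (S k - i))%C
          (fun i => c i * g (S k - i)%nat + b * (c i * g (k - i)%nat))%C).
        2:{ intros i Hi. apply in_seq in Hi.
            replace (S k - i)%nat with (S (k - i)) by lia. cbn [pcoef]. fold b.
            change (pcoef a n) with g. ring. }
        rewrite csum_plus. replace (S k - S k)%nat with 0%nat by lia.
        rewrite pcoef_0. unfold g at 4. rewrite pcoef_0. unfold c. ring. }
    rewrite E. cbn [pcoef]. fold b. change (pcoef a n) with g.
    rewrite (S_INR k), RtoC_plus. ring.
Qed.

Lemma arith_geom_bound s n :
  0 <= s < 1 -> rsum (seq 0 n) (fun i => INR (S i) * s ^ S i) <= s / (1 - s) ^ 2.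
Proof.
  intros Hs.
  assert (E : rsum (seq 0 n) (fun i => INR (S i) * s ^ S i) * (1 - s) ^ 2 =
              s * (1 - s ^ n * (1 + INR n * (1 - s)))).
  { induction n as [|n IH]; [simpl; ring|].
    rewrite rsum_seq_S, Rmult_plus_distr_r, IH, S_INR. simpl. ring. }
  assert (0 < (1 - s) ^ 2) by (apply pow_lt; lra).
  apply Rmult_le_reg_r with ((1 - s) ^ 2); auto. rewrite E.
  unfold Rdiv. rewrite Rmult_assoc, Rinv_l by lra.
  assert (0 <= s ^ n) by (apply pow_le; lra).
  assert (0 <= INR n) by apply pos_INR.
  assert (0 <= s ^ n * (1 + INR n * (1 - s))) by (apply Rmult_le_pos; nra). nra.
Qed.

(** With equality in the recursion and h 0 = 1 the generating function is exp(tau X / (1 - tau X)),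
    analytic for |X| < 1 / tau. So every kap > tau is possible; the midpoint of tau and 1 is
    taken. *)
Lemma newton_growth tau :
  0 <= tau < 1 -> exists C0 kap, 0 < kap < 1 /\ 0 < C0 /\
  forall h : nat -> R, (forall k, 0 <= h k) -> h 0%nat <= 1 ->
  (forall k, INR (S k) * h (S k) <= rsum (seq 0 (S k)) (fun i => INR (S i) * tau ^ S i * h (k - i)%nat)) ->
  forall k, h k <= C0 * kap ^ k.
Proof.
  intros Ht. set (kap := (1 + tau) / 2). set (sg := tau / kap).
  assert (Hk : 0 < kap < 1) by (unfold kap; lra).
  assert (Hsg : 0 <= sg < 1).
  { unfold sg. split; [apply Rdiv_le_0_compat; lra|].
    apply Rmult_lt_reg_r with kap; [lra|]. unfold Rdiv. rewrite Rmult_assoc, Rinv_l by lra.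
    unfold kap; lra. }
  set (S0 := sg / (1 - sg) ^ 2).
  assert (HS0 : 0 <= S0) by (apply Rdiv_le_0_compat; [lra|apply pow_lt; lra]).
  set (A := S0 + 1).
  destruct (INR_unbounded S0) as [K HK].
  exists (A ^ K), kap. split; [auto|]. split; [apply pow_lt; unfold A; lra|].
  intros h Hh Hh0 Hrec.
  assert (Hkp : forall k, 0 < kap ^ k) by (intros; apply pow_lt; lra).
  (* Passing a bound with constant M through the recursion multiplies the constant by S0 / (k + 1),
     where [S0] bounds the sums of i sg^i. *)
  assert (Step : forall k M, 0 <= M -> (forall j, (j <= k)%nat -> h j <= M * kap ^ j) ->
            INR (S k) * h (S k) <= S0 * M * kap ^ S k).
  { intros k M HM Hj. eapply Rle_trans; [apply Hrec|].
    apply Rle_trans with (rsum (seq 0 (S k)) (fun i => (M * kap ^ S k) * (INR (S i) * sg ^ S i))).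
    - apply rsum_le. intros i Hi. apply in_seq in Hi.
      assert (h (k - i)%nat <= M * kap ^ (k - i)) by (apply Hj; lia).
      assert (E : tau ^ S i * kap ^ (k - i) = kap ^ S k * sg ^ S i).
      { replace (S k) with (S i + (k - i))%nat at 1 by lia. rewrite pow_add.
        replace tau with (sg * kap) by (unfold sg; field; lra). rewrite Rpow_mult_distr. ring. }
      assert (0 <= INR (S i) * tau ^ S i)
        by (apply Rmult_le_pos; [apply pos_INR|apply pow_le; lra]).
      apply Rle_trans with (INR (S i) * tau ^ S i * (M * kap ^ (k - i))).
      + apply Rmult_le_compat_l; auto.
      + right. transitivity (INR (S i) * M * (tau ^ S i * kap ^ (k - i))); [ring|rewrite E; ring].
    - rewrite rsum_scal.
      assert (B := arith_geom_bound sg (S k) Hsg). fold S0 in B.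
      replace (S0 * M * kap ^ S k) with (M * kap ^ S k * S0) by ring.
      apply Rmult_le_compat_l; auto. apply Rmult_le_pos; auto. left; auto. }
  assert (HA : 1 <= A) by (unfold A; lra).
  (* A crude bound, used only up to index [K]; beyond it S0 / (k + 1) is below 1 and the constant
     A^K persists. *)
  assert (Small : forall k, h k <= A ^ k * kap ^ k).
  { intros k. induction k as [k IH] using lt_wf_ind. destruct k as [|k]; [simpl; lra|].
    assert (T := Step k (A ^ k) ltac:(apply pow_le; lra)).
    assert (INR (S k) * h (S k) <= S0 * A ^ k * kap ^ S k).
    { apply T. intros j Hj. eapply Rle_trans; [apply IH; lia|].
      apply Rmult_le_compat_r; [left; auto|]. apply Rle_pow; auto. }
    assert (1 <= INR (S k)) by (rewrite S_INR; assert (X := pos_INR k); lra).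
    apply Rle_trans with (INR (S k) * h (S k)); [specialize (Hh (S k)); nra|].
    eapply Rle_trans; [apply H|]. apply Rmult_le_compat_r; [left; auto|].
    simpl. apply Rmult_le_compat_r; [apply pow_le; lra|unfold A; lra]. }
  intros k. induction k as [k IH] using lt_wf_ind.
  destruct (le_lt_dec k K) as [Hle|Hlt].
  - eapply Rle_trans; [apply Small|]. apply Rmult_le_compat_r; [left; auto|]. apply Rle_pow; auto.
  - destruct k as [|k]; [lia|].
    assert (T := Step k (A ^ K) ltac:(apply pow_le; lra) ltac:(intros; apply IH; lia)).
    assert (S0 <= INR (S k)) by (apply Rlt_le, Rlt_trans with (INR K); [auto|apply lt_INR; auto]).
    assert (0 < INR (S k)) by (apply lt_0_INR; lia).
    apply Rmult_le_reg_l with (INR (S k)); auto. eapply Rle_trans; [apply T|].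
    rewrite Rmult_assoc. apply Rmult_le_compat_r; auto.
    apply Rmult_le_pos; [apply pow_le; lra|left; auto].
Qed.

Lemma geometric_sum (x : C) n : ((1 - x) * csum (seq 0 n) (fun j => Cpow x j) = 1 - Cpow x n)%C.
Proof.
  induction n as [|n IH]; [simpl; ring|].
  rewrite csum_seq_S, Cmult_plus_distr_l, IH. simpl. ring.
Qed.

Lemma one_minus_pow_le (x : C) n : Cmod x = 1 -> Cmod (1 - Cpow x n)%C <= INR n * Cmod (1 - x)%C.
Proof.
  intros Hx. rewrite <- geometric_sum, Cmod_mult, Rmult_comm.
  apply Rmult_le_compat_r; [apply Cmod_ge_0|].
  eapply Rle_trans; [apply Cmod_csum|].
  rewrite (rsum_ext _ _ (fun _ => 1)).
  - rewrite rsum_const, length_seq. lra.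
  - intros j _. rewrite Cmod_pow, Hx. apply pow1.
Qed.

(* [n] is a best approximation denominator: [v^n] is closer to 1 than all previous powers. *)
Definition record (v : C) (n : nat) : Prop :=
  forall m, (0 < m < n)%nat -> Cmod (1 - Cpow v n)%C <= Cmod (1 - Cpow v m)%C.

(* A geometric sum with ratio [v^m] is (1 - v^(mn)) / (1 - v^m); for a record [n] the numerator is
   at most [m |1 - v^n|], so the small denominator cancels. *)
Lemma record_pow_sum v n m :
  Cmod v = 1 -> (forall k, (0 < k)%nat -> Cpow v k <> RtoC 1) -> record v n ->
  (0 < m)%nat -> Cmod (csum (seq 0 n) (fun j => Cpow (Cpow v j) m)) <= INR m.
Proof.
  intros Hv Hirr Hr Hm.
  rewrite (csum_ext _ _ (fun j => Cpow (Cpow v m) j))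
    by (intros; rewrite <- !Cpow_mult_r; f_equal; lia).
  destruct (le_lt_dec n m) as [Hle|Hlt].
  - eapply Rle_trans; [apply Cmod_csum|].
    rewrite (rsum_ext _ _ (fun _ => 1)).
    + rewrite rsum_const, length_seq, Rmult_1_r. apply le_INR; auto.
    + intros j _. rewrite !Cmod_pow, Hv, !pow1. reflexivity.
  - assert (Hd : 0 < Cmod (1 - Cpow v m)%C).
    { apply Cmod_gt_0. intros E. apply (Hirr m Hm).
      transitivity (1 - (1 - Cpow v m))%C; [ring|rewrite E; ring]. }
    apply Rmult_le_reg_l with (Cmod (1 - Cpow v m)%C); auto.
    rewrite <- Cmod_mult, geometric_sum, <- Cpow_mult_r.
    replace (m * n)%nat with (n * m)%nat by lia. rewrite Cpow_mult_r.
    eapply Rle_trans; [apply one_minus_pow_le; rewrite Cmod_pow, Hv, pow1; auto|].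
    rewrite Rmult_comm. apply Rmult_le_compat_r; [apply pos_INR|]. apply Hr; lia.
Qed.

(** By [record_pow_sum] the m-th power sum has modulus at most m tau^m, which is what
    [newton_growth] asks for. The constants depend on tau alone, hence are uniform over all
    records. *)
Lemma record_pcoef_bound tau :
  0 <= tau < 1 -> exists C0 kap, 0 < kap < 1 /\ 0 < C0 /\
  forall t v n, Cmod t = tau -> Cmod v = 1 -> (forall k, (0 < k)%nat -> Cpow v k <> RtoC 1) ->
  record v n -> forall k, Cmod (pcoef (fun j => t * Cpow v j)%C n k) <= C0 * kap ^ k.
Proof.
  intros Ht. destruct (newton_growth tau Ht) as (C0 & kap & Hk & HC & H).
  exists C0, kap. split; auto. split; auto. intros t v n Et Hv Hirr Hr.
  apply H.
  - intros; apply Cmod_ge_0.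
  - rewrite pcoef_0, Cmod_1. lra.
  - intros k. set (a := fun j => (t * Cpow v j)%C).
    apply Rle_trans with (Cmod (INR (S k) * pcoef a n (S k))%C).
    { rewrite Cmod_mult, Cmod_R, Rabs_pos_eq by apply pos_INR. lra. }
    rewrite newton_identity. eapply Rle_trans; [apply Cmod_csum|]. apply rsum_le.
    intros i _. rewrite Cmod_mult, Cmod_opp, Cmod_mult, Cmod_pow, Cmod_opp, Cmod_1, pow1, Rmult_1_l.
    apply Rmult_le_compat_r; [apply Cmod_ge_0|].
    unfold pow_sum, a.
    rewrite (csum_ext _ _ (fun j => Cpow t (S i) * Cpow (Cpow v j) (S i))%C)
      by (intros; apply Cpow_mult_l).
    rewrite csum_scal, Cmod_mult, Cmod_pow, Et, Rmult_comm.
    apply Rmult_le_compat_r; [apply pow_le; lra|].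
    apply record_pow_sum; auto. lia.
Qed.

(** * Existence of arbitrarily large records *)

Lemma least_nat (P : nat -> Prop) :
  (exists n, P n) -> exists n, P n /\ forall m, (m < n)%nat -> ~ P m.
Proof.
  intros [n Hn]. apply NNPP. intros H.
  assert (A : forall k, ~ P k); [|exact (A n Hn)].
  intros k. induction k as [k IH] using lt_wf_ind. intros Hk. apply H. exists k. auto.
Qed.

Lemma Cmod_sqr (x : C) : Cmod x ^ 2 = fst x ^ 2 + snd x ^ 2.
Proof. unfold Cmod. rewrite pow2_sqrt; auto. nra. Qed.

(** Compactness is applied to real parts only. A point of the circle is determined by its real part
    up to the sign of the imaginary part, so among three powers with close real parts two are close
    to each other, and their quotient is close to 1. *)
Lemma pow_near_one (v : C) :
  Cmod v = 1 -> forall delta, 0 < delta ->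
  exists m, (0 < m)%nat /\ Cmod (1 - Cpow v m)%C < delta.
Proof.
  intros Hv delta Hd.
  (* For real parts a, c within eta <= 1 and imaginary parts b, d of equal sign, (a - c)^2 <= eta
     and (b - d)^2 <= |b^2 - d^2| <= 2 eta, so the squared distance stays below delta^2. *)
  set (eta := Rmin 1 (delta ^ 2 / 16)).
  assert (He : 0 < eta) by (apply Rmin_glb_lt; [lra|]; assert (0 < delta ^ 2) by (apply pow_lt; auto); lra).
  assert (He1 : eta <= 1) by apply Rmin_l.
  assert (He2 : eta <= delta ^ 2 / 16) by apply Rmin_r.
  assert (Hn : forall n, fst (Cpow v n) ^ 2 + snd (Cpow v n) ^ 2 = 1).
  { intros n. rewrite <- Cmod_sqr, Cmod_pow, Hv, pow1. ring. }
  destruct (Bolzano_Weierstrass (fun n => fst (Cpow v n)) (fun c => -1 <= c <= 1)) as [l Hl].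
  { apply compact_P3. }
  { intros n. specialize (Hn n). nra. }
  assert (Next : forall N, exists p, (N <= p)%nat /\ Rabs (fst (Cpow v p) - l) < eta / 2).
  { intros N. apply (Hl (disc l (mkposreal (eta / 2) ltac:(lra))) N).
    exists (mkposreal (eta / 2) ltac:(lra)). intros x Hx. exact Hx. }
  destruct (Next 0%nat) as (p1 & _ & H1). destruct (Next (S p1)) as (p2 & L2 & H2).
  destruct (Next (S p2)) as (p3 & L3 & H3).
  assert (Key : forall i j, (i < j)%nat -> Rabs (fst (Cpow v i) - l) < eta / 2 ->
    Rabs (fst (Cpow v j) - l) < eta / 2 -> 0 <= snd (Cpow v i) * snd (Cpow v j) ->
    exists m, (0 < m)%nat /\ Cmod (1 - Cpow v m)%C < delta).
  { intros i j Hij Hi Hj Hs. exists (j - i)%nat. split; [lia|].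
    assert (E : Cmod (1 - Cpow v (j - i))%C = Cmod (Cpow v i - Cpow v j)%C).
    { replace (Cpow v j) with (Cpow v i * Cpow v (j - i))%C by (rewrite <- Cpow_add_r; f_equal; lia).
      replace (Cpow v i - Cpow v i * Cpow v (j - i))%C with (Cpow v i * (1 - Cpow v (j - i)))%C by ring.
      rewrite Cmod_mult, Cmod_pow, Hv, pow1. ring. }
    rewrite E. apply Rsqr_incrst_0; [|apply Cmod_ge_0|lra].
    rewrite !Rsqr_pow2, Cmod_sqr.
    assert (Ni := Hn i). assert (Nj := Hn j).
    set (a := fst (Cpow v i)) in *. set (b := snd (Cpow v i)) in *.
    set (c := fst (Cpow v j)) in *. set (d := snd (Cpow v j)) in *.
    change ((a - c) ^ 2 + (b - d) ^ 2 < delta ^ 2).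
    apply Rabs_def2 in Hi. apply Rabs_def2 in Hj.
    assert (Hac : (a - c) ^ 2 <= eta) by nra.
    assert (Hbd : (b - d) ^ 2 <= 2 * eta).
    { assert (Ha : -1 <= a <= 1) by nra. assert (Hc : -1 <= c <= 1) by nra.
      assert (B : b ^ 2 - d ^ 2 = (c - a) * (c + a)) by nra.
      destruct (Rle_dec (d ^ 2) (b ^ 2)).
      - assert ((b - d) ^ 2 <= b ^ 2 - d ^ 2); [|nra].
        destruct (Rle_dec 0 b); destruct (Rle_dec 0 d); nra.
      - assert ((b - d) ^ 2 <= d ^ 2 - b ^ 2); [|nra].
        destruct (Rle_dec 0 b); destruct (Rle_dec 0 d); nra. }
    assert (0 < delta ^ 2) by (apply pow_lt; auto). lra. }
  destruct (Rle_dec 0 (snd (Cpow v p1) * snd (Cpow v p2))) as [Q|Q];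
    [apply (Key p1 p2); auto; lia|].
  destruct (Rle_dec 0 (snd (Cpow v p2) * snd (Cpow v p3))) as [Q'|Q'];
    [apply (Key p2 p3); auto; lia|].
  apply (Key p1 p3); auto; [lia|].
  assert (0 < (snd (Cpow v p1) * snd (Cpow v p2)) * (snd (Cpow v p2) * snd (Cpow v p3))) by nra.
  assert (0 <= snd (Cpow v p2) ^ 2) by apply pow2_ge_0.
  nra.
Qed.

(** [mu] bounds the distances of v, ..., v^N from 1 below, so the first exponent that beats it
    exceeds N and is a record. *)
Lemma record_unbounded v :
  Cmod v = 1 -> (forall k, (0 < k)%nat -> Cpow v k <> RtoC 1) ->
  forall N, exists n, (N < n)%nat /\ record v n.
Proof.
  intros Hv Hirr N.
  assert (Hmu : exists mu, 0 < mu /\ forall m, (0 < m <= N)%nat -> mu <= Cmod (1 - Cpow v m)%C).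
  { induction N as [|N (mu & Hmu & H)].
    - exists 1. split; [lra|]. intros; lia.
    - assert (Hd : 0 < Cmod (1 - Cpow v (S N))%C).
      { apply Cmod_gt_0. intros E. apply (Hirr (S N)); [lia|].
        transitivity (1 - (1 - Cpow v (S N)))%C; [ring|rewrite E; ring]. }
      exists (Rmin mu (Cmod (1 - Cpow v (S N))%C)). split; [apply Rmin_glb_lt; auto|].
      intros m Hm. destruct (Nat.eq_dec m (S N)) as [->|]; [apply Rmin_r|].
      eapply Rle_trans; [apply Rmin_l|]. apply H. lia. }
  destruct Hmu as (mu & Hmu & H).
  destruct (least_nat (fun n => (0 < n)%nat /\ Cmod (1 - Cpow v n)%C < mu)
     (pow_near_one v Hv mu Hmu)) as (n & [Hn Hlt] & Hmin).
  exists n. split.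
  - apply Nat.nle_gt. intros Hle. specialize (H n ltac:(lia)). lra.
  - intros m Hm. apply Rlt_le, Rlt_le_trans with mu; auto.
    apply Rnot_lt_le. intros Hl. apply (Hmin m); [lia|]. split; [lia|auto].
Qed.

(** * Products of Laurent factors *)

Fixpoint lprod (u v e : nat -> C) (n : nat) (f : Z -> C) : Z -> C :=
  match n with
  | O => f
  | S n' => laurent (u n') (v n') (e n') (lprod u v e n' f)
  end.

Lemma laurent_plus u v e f g k :
  laurent u v e (fun n => f n + g n)%C k = (laurent u v e f k + laurent u v e g k)%C.
Proof. unfold laurent; ring. Qed.

Lemma laurent_scal u v e c f k :
  laurent u v e (fun n => c * f n)%C k = (c * laurent u v e f k)%C.
Proof. unfold laurent; ring. Qed.

Lemma laurent_laurent u v e u' v' e' f k :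
  laurent u v e (laurent u' v' e' f) k = laurent u' v' e' (laurent u v e f) k.
Proof. unfold laurent. rewrite ?Z.add_simpl_r, ?Z.sub_add. ring. Qed.

Lemma lprod_ext u v e n f g k : (forall j, f j = g j) -> lprod u v e n f k = lprod u v e n g k.
Proof. intros H. replace g with f; auto. apply functional_extensionality; auto. Qed.

Lemma lprod_plus u v e n f g k :
  lprod u v e n (fun j => f j + g j)%C k = (lprod u v e n f k + lprod u v e n g k)%C.
Proof.
  revert k. induction n as [|n IH]; intros k; [reflexivity|].
  cbn [lprod]. rewrite (laurent_ext _ _ _ _ _ k IH). apply laurent_plus.
Qed.

Lemma lprod_scal u v e n c f k :
  lprod u v e n (fun j => c * f j)%C k = (c * lprod u v e n f k)%C.
Proof.
  revert k. induction n as [|n IH]; intros k; [reflexivity|].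
  cbn [lprod]. rewrite (laurent_ext _ _ _ _ _ k IH). apply laurent_scal.
Qed.

Lemma lprod_laurent u v e n u' v' e' f k :
  lprod u v e n (laurent u' v' e' f) k = laurent u' v' e' (lprod u v e n f) k.
Proof.
  revert k. induction n as [|n IH]; intros k; [reflexivity|].
  cbn [lprod]. rewrite (laurent_ext _ _ _ _ _ k IH). apply laurent_laurent.
Qed.

Lemma lprod_up a n f k :
  lprod a (fun _ => RtoC 0) (fun _ => RtoC 1) n f k =
  csum (seq 0 (S n)) (fun i => pcoef a n i * f (k + Z.of_nat i)%Z)%C.
Proof.
  revert k. induction n as [|n IH]; intros k.
  - cbn [lprod seq csum pcoef]. rewrite Z.add_0_r. ring.
  - cbn [lprod]. unfold laurent. rewrite !IH.
    rewrite (csum_seq_S_l (S n)), pcoef_0.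
    rewrite (csum_ext _ (fun i => pcoef a (S n) (S i) * f (k + Z.of_nat (S i))%Z)%C
      (fun i => pcoef a n (S i) * f (k + Z.of_nat (S i))%Z +
                a n * (pcoef a n i * f (k + 1 + Z.of_nat i)%Z))%C).
    2:{ intros i _. cbn [pcoef]. replace (k + 1 + Z.of_nat i)%Z with (k + Z.of_nat (S i))%Z by lia. ring. }
    rewrite csum_plus, csum_scal.
    rewrite (csum_seq_S n (fun x => pcoef a n (S x) * _)%C).
    assert (Z0 : forall j i, (j < i)%nat -> pcoef a j i = RtoC 0).
    { induction j as [|j IHj]; intros [|i] Hi; try lia; [reflexivity|].
      cbn [pcoef]. rewrite !IHj by lia. ring. }
    rewrite (Z0 n (S n)) by lia.
    rewrite (csum_seq_S_l n (fun i => pcoef a n i * f (k + Z.of_nat i)%Z)%C), pcoef_0. ring.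
Qed.

Lemma lprod_down a n f k :
  lprod (fun _ => RtoC 0) a (fun _ => RtoC 1) n f k =
  csum (seq 0 (S n)) (fun i => pcoef a n i * f (k - Z.of_nat i)%Z)%C.
Proof.
  transitivity (lprod a (fun _ => RtoC 0) (fun _ => RtoC 1) n (fun j => f (- j)%Z) (- k)%Z).
  - revert k. induction n as [|n IH]; intros k.
    + cbn [lprod]. f_equal; lia.
    + cbn [lprod]. unfold laurent. rewrite !IH.
      replace (- (k + 1))%Z with (- k - 1)%Z by lia.
      replace (- (k - 1))%Z with (- k + 1)%Z by lia. ring.
  - rewrite lprod_up. apply csum_ext. intros i _. do 2 f_equal. lia.
Qed.

Lemma rsum_geometric_tail kap M n :
  0 < kap < 1 ->
  rsum (seq 0 n) (fun i => if Nat.leb M i then kap ^ i else 0) <= kap ^ M / (1 - kap).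
Proof.
  intros Hk. assert (Hp : forall j, 0 < kap ^ j) by (intros; apply pow_lt; lra).
  assert (E : rsum (seq 0 n) (fun i => if Nat.leb M i then kap ^ i else 0) * (1 - kap)
              <= kap ^ M - kap ^ max n M).
  { induction n as [|n IH]; [simpl; lra|].
    rewrite rsum_seq_S, Rmult_plus_distr_r.
    destruct (Nat.leb_spec M n).
    - rewrite Nat.max_l in * by lia. simpl pow. lra.
    - rewrite Nat.max_r in * by lia. lra. }
  apply Rmult_le_reg_r with (1 - kap); [lra|].
  unfold Rdiv. rewrite Rmult_assoc, Rinv_l by lra. specialize (Hp (max n M)). lra.
Qed.

(** The upward product only sees larger indices, where [f] remains small. The downward product
    reaches back i steps with weight kap^i: the steps i >= M have negligible total weight, and for n
    >= M + K + 1 the others do not leave the region where [f] is small. *)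
Lemma lprod_record_small tau :
  0 <= tau < 1 -> forall Gam, 0 <= Gam -> forall eps, 0 < eps -> exists delta, 0 < delta /\
  forall K, exists N, forall t v v' n f, Cmod t = tau -> Cmod v = 1 -> Cmod v' = 1 ->
  (forall k, (0 < k)%nat -> Cpow v k <> RtoC 1) -> (forall k, (0 < k)%nat -> Cpow v' k <> RtoC 1) ->
  record v n -> record v' n -> (N <= n)%nat ->
  (forall k, Cmod (f k) <= Gam) -> (forall k, (K < k)%Z -> Cmod (f k) <= delta) ->
  Cmod (lprod (fun _ => RtoC 0) (fun j => t * Cpow v j)%C (fun _ => RtoC 1) n
    (lprod (fun j => t * Cpow v' j)%C (fun _ => RtoC 0) (fun _ => RtoC 1) n f) (Z.of_nat n)) <= eps.
Proof.
  intros Ht Gam HG eps Heps.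
  destruct (record_pcoef_bound tau Ht) as (C0 & kap & Hk & HC & H).
  set (C1 := C0 / (1 - kap)).
  assert (HC1 : 0 < C1) by (apply Rdiv_lt_0_compat; lra).
  assert (HCC : 0 < C1 * C1) by (apply Rmult_lt_0_compat; auto).
  assert (HCG : 0 < 2 * C1 * C1 * (Gam + 1)) by (apply Rmult_lt_0_compat; lra).
  assert (Hp : forall j, 0 < kap ^ j) by (intros; apply pow_lt; lra).
  assert (S1 : forall n, rsum (seq 0 n) (fun i => C0 * kap ^ i) <= C1).
  { intros n. rewrite rsum_scal. assert (T := rsum_geometric_tail kap 0 n Hk). simpl in T.
    unfold C1, Rdiv. apply Rmult_le_compat_l; [lra|].
    eapply Rle_trans; [exact T|]. right; field; lra. }
  exists (eps / (2 * C1 * C1)).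
  assert (Hd : 0 < eps / (2 * C1 * C1)) by (apply Rdiv_lt_0_compat; lra).
  split; auto. set (delta := eps / (2 * C1 * C1)) in *.
  intros K.
  destruct (pow_lt_1_zero kap ltac:(rewrite Rabs_pos_eq by lra; lra) (eps / (2 * C1 * C1 * (Gam + 1))))
    as [M HM]; [apply Rdiv_lt_0_compat; auto|].
  exists (M + Z.to_nat (K + 1))%nat.
  intros t v v' n f Et Hv Hv' Hi Hi' Hr Hr' HN Hf1 Hf2.
  assert (G1 := H t v n Et Hv Hi Hr). assert (G2 := H t v' n Et Hv' Hi' Hr').
  set (g := lprod (fun j => t * Cpow v' j)%C (fun _ => RtoC 0) (fun _ => RtoC 1) n f).
  assert (Hg : forall b k, 0 <= b -> (forall j, (k <= j)%Z -> Cmod (f j) <= b) -> Cmod (g k) <= C1 * b).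
  { intros b k Hb Hj. unfold g. rewrite lprod_up. eapply Rle_trans; [apply Cmod_csum|].
    eapply Rle_trans; [|apply Rmult_le_compat_r; [auto|apply (S1 (S n))]].
    rewrite Rmult_comm, <- rsum_scal. apply rsum_le. intros i _. rewrite Cmod_mult, Rmult_comm.
    apply Rmult_le_compat; try apply Cmod_ge_0; auto. apply Hj. lia. }
  rewrite lprod_down. eapply Rle_trans; [apply Cmod_csum|].
  apply Rle_trans with (rsum (seq 0 (S n)) (fun i => (C1 * delta) * (C0 * kap ^ i) +
     (C1 * Gam * C0) * (if Nat.leb M i then kap ^ i else 0))).
  - apply rsum_le. intros i Hin. apply in_seq in Hin. rewrite Cmod_mult.
    assert (Bi : Cmod (pcoef (fun j => t * Cpow v j)%C n i) <= C0 * kap ^ i) by auto.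
    assert (P : 0 <= C0 * kap ^ i) by (left; apply Rmult_lt_0_compat; auto).
    assert (P' : 0 <= C1 * delta) by (left; apply Rmult_lt_0_compat; auto).
    destruct (Nat.leb_spec M i).
    + assert (Bg : Cmod (g (Z.of_nat n - Z.of_nat i)%Z) <= C1 * Gam) by (apply Hg; auto).
      apply Rle_trans with ((C0 * kap ^ i) * (C1 * Gam)).
      * apply Rmult_le_compat; auto using Cmod_ge_0.
      * assert (0 <= C1 * delta * (C0 * kap ^ i)) by (apply Rmult_le_pos; auto). lra.
    + assert (Bg : Cmod (g (Z.of_nat n - Z.of_nat i)%Z) <= C1 * delta).
      { apply Hg; [lra|]. intros j Hj. apply Hf2. lia. }
      apply Rle_trans with ((C0 * kap ^ i) * (C1 * delta)).
      * apply Rmult_le_compat; auto using Cmod_ge_0.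
      * lra.
  - rewrite rsum_plus, !rsum_scal.
    assert (T1 := S1 (S n)). rewrite rsum_scal in T1.
    assert (T2 := rsum_geometric_tail kap M (S n) Hk).
    specialize (HM M (le_n _)). rewrite Rabs_pos_eq in HM by (left; auto).
    assert (Q1 : C1 * delta * (C0 * rsum (seq 0 (S n)) (fun x => kap ^ x)) <= eps / 2).
    { apply Rle_trans with (C1 * delta * C1); [apply Rmult_le_compat_l; auto; nra|].
      unfold delta. right. field. lra. }
    assert (Q2 : C1 * Gam * C0 * rsum (seq 0 (S n)) (fun i => if Nat.leb M i then kap ^ i else 0) <= eps / 2).
    { apply Rle_trans with (C1 * Gam * C0 * (kap ^ M / (1 - kap))).
      - apply Rmult_le_compat_l; auto. apply Rmult_le_pos; [|lra]. apply Rmult_le_pos; lra.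
      - replace (C1 * Gam * C0 * (kap ^ M / (1 - kap))) with (C1 * C1 * Gam * kap ^ M)
          by (unfold C1; field; lra).
        apply Rle_trans with (C1 * C1 * Gam * (eps / (2 * C1 * C1 * (Gam + 1)))).
        + apply Rmult_le_compat_l; [|lra]. apply Rmult_le_pos; nra.
        + replace (C1 * C1 * Gam * (eps / (2 * C1 * C1 * (Gam + 1)))) with (eps / 2 * (Gam / (Gam + 1)))
            by (field; lra).
          assert (Gam / (Gam + 1) <= 1); [|nra].
          apply Rmult_le_reg_r with (Gam + 1); [lra|]. unfold Rdiv.
          rewrite Rmult_assoc, Rinv_l by lra. lra. }
    eapply Rle_trans; [apply Rplus_le_compat; [exact Q1|exact Q2]|lra].
Qed.

(** * The conserved current vanishes *)

(** Multiplication by all earlier denominators turns a recursion with fractions into one with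
    Laurent polynomial coefficients, so that nothing is ever divided. *)
Lemma lprod_chain c (u v e : nat -> C) (al ga : nat -> Z -> C) a1 a2 a3 b1 b2 b3 n :
  (forall k, c * laurent (u n) (v n) (e n) (al (S n)) k =
     laurent a1 a2 a3 (al n) k + laurent b1 b2 b3 (ga n) k)%C ->
  forall k, (Cpow c (S n) * lprod u v e (S n) (al (S n)) k =
   laurent a1 a2 a3 (fun j => Cpow c n * lprod u v e n (al n) j) k +
   laurent b1 b2 b3 (fun j => Cpow c n * lprod u v e n (ga n) j) k)%C.
Proof.
  intros H k. rewrite !laurent_scal, <- !lprod_laurent, Cpow_S.
  cbn [lprod]. rewrite <- lprod_laurent.
  transitivity (Cpow c n * (c * lprod u v e n (laurent (u n) (v n) (e n) (al (S n))) k))%C; [ring|].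
  rewrite <- lprod_scal, (lprod_ext _ _ _ _ _ _ k H), lprod_plus. ring.
Qed.

(** Each factor is kap (1 + x X)(1 + y X^-1), and Laurent operators commute. *)
Lemma lprod_factor kap (x y : nat -> C) n f k :
  lprod (fun j => kap * x j)%C (fun j => kap * y j)%C (fun j => kap * (1 + x j * y j))%C n f k =
  (Cpow kap n * lprod (fun _ => RtoC 0) y (fun _ => RtoC 1) n
     (lprod x (fun _ => RtoC 0) (fun _ => RtoC 1) n f) k)%C.
Proof.
  revert k. induction n as [|n IH]; intros k; [cbn [lprod Cpow]; ring|].
  cbn [lprod]. rewrite (laurent_ext _ _ _ _ _ k IH), laurent_scal.
  set (g := lprod x _ _ n f).
  rewrite (laurent_ext (RtoC 0) (y n) (RtoC 1)
    (lprod (fun _ => RtoC 0) y (fun _ => RtoC 1) n (laurent (x n) (RtoC 0) (RtoC 1) g))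
    (laurent (x n) (RtoC 0) (RtoC 1) (lprod (fun _ => RtoC 0) y (fun _ => RtoC 1) n g)) k)
    by (intros; apply lprod_laurent).
  rewrite Cpow_S. unfold laurent. rewrite ?Z.add_simpl_r, ?Z.sub_add. ring.
Qed.

Section Walk.
Variables (lam lp : R) (w : Z -> C).
Hypothesis lam_pos : 0 < lam.
Hypothesis lp_pos : 0 < lp.
Hypothesis lam_lp : lam * lam + lp * lp = 1.
Hypothesis w_add : forall a b, w (a + b)%Z = (w a * w b)%C.
Hypothesis w_unit : forall a, Cmod (w a) = 1.
Hypothesis w_irr : forall k, k <> 0%Z -> w k <> RtoC 1.

Let h : C := RtoC (lam / 2).
(** As a function of X, the symbol of [opD] has zeros of modulus s and 1 / s. By Jensen's formula
    the geometric mean of its modulus on the circle is therefore lam / (2 s) = (1 + lp) / 2. *)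
Let s : R := (1 - lp) / lam.

Lemma s_bounds : 0 < s < 1.
Proof.
  assert (lp < 1) by nra. assert (lam + lp > 1) by nra.
  unfold s. split; [apply Rdiv_lt_0_compat; lra|].
  apply Rmult_lt_reg_r with lam; auto. unfold Rdiv. rewrite Rmult_assoc, Rinv_l by lra. lra.
Qed.

Lemma s_lam : lam / s = 1 + lp.
Proof.
  assert (Hs := s_bounds). apply Rmult_eq_reg_r with s; [|lra].
  unfold Rdiv. rewrite Rmult_assoc, Rinv_l by lra.
  unfold s. apply Rmult_eq_reg_r with lam; [|lra]. field_simplify; lra.
Qed.

Lemma w_pow n : Cpow (w 1) n = w (Z.of_nat n).
Proof.
  induction n as [|n IH]; [simpl; symmetry; apply w_0; auto|].
  rewrite Cpow_S, IH, <- w_add. f_equal. lia.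
Qed.

Lemma w_pow_neg n : Cpow (w (- 1)) n = w (- Z.of_nat n)%Z.
Proof.
  induction n as [|n IH]; [simpl; symmetry; apply w_0; auto|].
  rewrite Cpow_S, IH, <- w_add. f_equal. lia.
Qed.

(** Coefficients of the translate f(x + n Phi). *)
Definition twist (n : nat) (f : Z -> C) (k : Z) : C := (w (Z.of_nat n * k) * f k)%C.

Lemma Cmod_twist n f k : Cmod (twist n f k) = Cmod (f k).
Proof. unfold twist. rewrite Cmod_mult, w_unit. ring. Qed.

Lemma l2_twist n f : l2 f -> l2 (twist n f).
Proof. intros. apply (l2_unimodular f (fun k => w (Z.of_nat n * k))); auto. Qed.

Lemma twist_0 f k : twist 0 f k = f k.
Proof. unfold twist. rewrite Z.mul_0_l, w_0 by auto. ring. Qed.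

Lemma twist_laurent n u v e f k :
  (w (Z.of_nat n * k) * laurent u v e f k =
   laurent (u * w (- Z.of_nat n)%Z) (v * w (Z.of_nat n)) e (twist n f) k)%C.
Proof.
  unfold laurent, twist.
  assert (E1 : w (Z.of_nat n * k) = (w (- Z.of_nat n)%Z * w (Z.of_nat n * (k + 1)))%C)
    by (rewrite <- w_add; f_equal; lia).
  assert (E2 : w (Z.of_nat n * k) = (w (Z.of_nat n)%Z * w (Z.of_nat n * (k - 1)))%C)
    by (rewrite <- w_add; f_equal; lia).
  transitivity (u * (w (Z.of_nat n * k) * f (k + 1)%Z) + v * (w (Z.of_nat n * k) * f (k - 1)%Z)
    + e * (w (Z.of_nat n * k) * f k))%C; [ring|].
  rewrite E1 at 1. rewrite E2 at 1. ring.
Qed.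

(** The cocycle equation translated by n Phi and multiplied by the untranslated function [g]. *)
Lemma twist_step n g c u v e a1 a2 a3 b1 b2 b3 p r :
  l2 p -> l2 r -> l2 g ->
  (forall k, (c * laurent u v e (fun j => w j * p j) k =
    laurent a1 a2 a3 p k + laurent b1 b2 b3 r k)%C) ->
  forall k, (c * laurent (u * w (- Z.of_nat n)%Z) (v * w (Z.of_nat n)) e (conv (twist (S n) p) g) k =
   laurent (a1 * w (- Z.of_nat n)%Z) (a2 * w (Z.of_nat n)) a3 (conv (twist n p) g) k +
   laurent (b1 * w (- Z.of_nat n)%Z) (b2 * w (Z.of_nat n)) b3 (conv (twist n r) g) k)%C.
Proof.
  intros Hp Hr Hg H k.
  rewrite <- !conv_laurent_l by auto using l2_twist.
  rewrite <- conv_scal_l, <- conv_plus_l by auto using l2_laurent, l2_twist.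
  apply conv_ext; auto. intros j.
  rewrite <- !twist_laurent.
  transitivity (w (Z.of_nat n * j) * (c * laurent u v e (fun j => w j * p j) j))%C.
  - rewrite (laurent_ext _ _ _ (twist (S n) p) (twist n (fun j => w j * p j)%C)).
    + rewrite <- twist_laurent. ring.
    + intros i. unfold twist.
      replace (Z.of_nat (S n) * i)%Z with (Z.of_nat n * i + i)%Z by lia. rewrite w_add. ring.
  - rewrite H. ring.
Qed.

Lemma record_neg n : record (w 1) n -> record (w (- 1)) n.
Proof.
  intros H m Hm. specialize (H m Hm).
  assert (E : forall j, Cmod (1 - Cpow (w (- 1)) j)%C = Cmod (1 - Cpow (w 1) j)%C).
  { intros j. rewrite <- (Cmod_conj (1 - Cpow (w 1) j)%C). f_equal.
    rewrite w_pow, w_pow_neg, Cminus_conj, w_neg by auto. rewrite Cconj_R. reflexivity. }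
  rewrite !E. auto.
Qed.

Lemma twisted_product_small (t : C) (f g : Z -> C) :
  Cmod t = s -> l2 f -> l2 g -> forall eps, 0 < eps ->
  exists N, forall n, (N <= n)%nat -> record (w 1) n ->
  Cmod (lprod (fun _ => RtoC 0) (fun j => t * w (Z.of_nat j))%C (fun _ => RtoC 1) n
    (lprod (fun j => t * w (- Z.of_nat j)%Z)%C (fun _ => RtoC 0) (fun _ => RtoC 1) n
      (conv (twist n f) g)) (Z.of_nat n)) <= eps.
Proof.
  intros Ht Hf Hg eps Heps. assert (Hs := s_bounds).
  destruct (conv_bound f g Hf Hg) as [B HB].
  assert (B0 : 0 <= B).
  { eapply Rle_trans; [apply Cmod_ge_0|]. apply (HB 0%Z f g); auto. }
  destruct (lprod_record_small s ltac:(lra) B B0 eps Heps) as (delta & Hd & H).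
  destruct (conv_decay f g Hf Hg delta Hd) as [K HK].
  destruct (H (Z.of_nat K)) as [N HN].
  exists N. intros n Hn Hr.
  assert (E1 : (fun j => t * w (Z.of_nat j))%C = (fun j => t * Cpow (w 1) j)%C)
    by (apply functional_extensionality; intros; rewrite w_pow; auto).
  assert (E2 : (fun j => t * w (- Z.of_nat j)%Z)%C = (fun j => t * Cpow (w (- 1)) j)%C)
    by (apply functional_extensionality; intros; rewrite w_pow_neg; auto).
  rewrite E1, E2. apply HN; auto using record_neg.
  - intros k Hk. rewrite w_pow. apply w_irr. lia.
  - intros k Hk. rewrite w_pow_neg. apply w_irr. lia.
  - intros k. apply HB; auto using Cmod_twist.
  - intros k Hk. apply HK; auto using Cmod_twist. lia.
Qed.

Section Null.
Variables (z phi : C) (p m y r : Z -> C).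
Hypothesis Hz : (z * Cconj z)%C = RtoC 1.
Hypothesis Hphi : Cmod phi = 1.
Hypothesis Hsol : solution lam lp w z phi p m y r.

Let Lp := sol_p _ _ _ _ _ _ _ _ _ Hsol.
Let Lr := sol_r _ _ _ _ _ _ _ _ _ Hsol.
Let il := (Ci * RtoC lp)%C.

(** The entries of the transfer matrix F at x + n Phi. *)
Let F11 n := laurent (il * h * w (- Z.of_nat n)%Z) (- (il * h) * w (Z.of_nat n)) z.
Let F12 n := laurent (h * w (- Z.of_nat n)%Z) (- h * w (Z.of_nat n)) (- (il * Cconj z))%C.
Let F21 n := laurent (- h * w (- Z.of_nat n)%Z) (h * w (Z.of_nat n)) (il * z)%C.
Let F22 n := laurent (il * h * w (- Z.of_nat n)%Z) (- (il * h) * w (Z.of_nat n)) (Cconj z).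

Let PD (e : C) := lprod (fun n => h * w (- Z.of_nat n)%Z)%C (fun n => h * w (Z.of_nat n))%C
  (fun _ => e).

(** Let G have the columns (p, r) and (conj r, conj p), so that det G is the current. The n-step
    matrix maps G(x) to G(x + n Phi) times a diagonal matrix of products of denominators.
    Multiplying by the adjugate of G(x) shows that (U, V) is the first column of the n-step matrix
    times the current. *)
Let U (n : nat) (k : Z) : C :=
  (Cpow (RtoC lam * phi) n * PD il n (conv (twist n p) (bar p)) k -
   Cpow (RtoC lam * Cconj phi) n * PD (- il) n (conv (twist n (bar r)) r) k)%C.
Let V (n : nat) (k : Z) : C :=
  (Cpow (RtoC lam * phi) n * PD il n (conv (twist n r) (bar p)) k -
   Cpow (RtoC lam * Cconj phi) n * PD (- il) n (conv (twist n (bar p)) r) k)%C.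

Lemma transfer_p k :
  (RtoC lam * phi * laurent h h il (fun n => w n * p n) k =
   laurent (il * h) (- (il * h)) z p k + laurent h (- h) (- (il * Cconj z)) r k)%C.
Proof.
  apply (solution_transfer_p lam lp w lam_lp z phi p m y r k Hz Hsol).
Qed.

Lemma transfer_r k :
  (RtoC lam * phi * laurent h h il (fun n => w n * r n) k =
   laurent (- h) h (il * z) p k + laurent (il * h) (- (il * h)) (Cconj z) r k)%C.
Proof.
  apply (solution_transfer_r lam lp w lam_lp z phi p m y r k Hz Hsol).
Qed.

Lemma bar_transfer phi0 a1 a2 a3 b1 b2 b3 f g g' :
  (forall k, (RtoC lam * phi0 * laurent h h il (fun n => w n * f n) k =
   laurent a1 a2 a3 g k + laurent b1 b2 b3 g' k)%C) ->
  forall k, (RtoC lam * Cconj phi0 * laurent h h (- il) (fun n => w n * bar f n) k =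
   laurent (Cconj a2) (Cconj a1) (Cconj a3) (bar g) k +
   laurent (Cconj b2) (Cconj b1) (Cconj b3) (bar g') k)%C.
Proof.
  intros H k. rewrite <- !bar_laurent.
  transitivity (Cconj (RtoC lam * phi0 * laurent h h il (fun n => w n * f n) (- k)%Z))%C.
  - rewrite !Cmult_conj, Cconj_R. f_equal.
    change (Cconj (laurent h h il (fun n => w n * f n) (- k)%Z)%C)
      with (bar (laurent h h il (fun n => w n * f n)%C) k).
    rewrite bar_laurent. unfold il, h. rewrite Cmult_conj, !Cconj_R, Cconj_Ci.
    replace (- Ci * RtoC lp)%C with (- (Ci * RtoC lp))%C by ring.
    apply laurent_ext. intros n. symmetry. apply bar_w; auto.
  - rewrite H, Cplus_conj. unfold bar. ring.
Qed.

Lemma conj_il : Cconj il = (- il)%C.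
Proof. unfold il. rewrite Cmult_conj, Cconj_R, Cconj_Ci. ring. Qed.

Lemma conj_h : Cconj h = h.
Proof. apply Cconj_R. Qed.

(** The transfer matrix satisfies conj(F11) = F22 and conj(F12) = F21; so (conj r, conj p) solves
    the same system, with conjugate phase and conjugate denominator. *)
Lemma transfer_bar_r k :
  (RtoC lam * Cconj phi * laurent h h (- il) (fun n => w n * bar r n) k =
   laurent (il * h) (- (il * h)) z (bar r) k + laurent h (- h) (- (il * Cconj z)) (bar p) k)%C.
Proof.
  rewrite (bar_transfer _ _ _ _ _ _ _ _ _ _ transfer_r k).
  rewrite !Copp_conj, !Cmult_conj, !Cconj_conj, conj_il, conj_h. unfold laurent. ring.
Qed.

Lemma transfer_bar_p k :
  (RtoC lam * Cconj phi * laurent h h (- il) (fun n => w n * bar p n) k =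
   laurent (- h) h (il * z) (bar r) k + laurent (il * h) (- (il * h)) (Cconj z) (bar p) k)%C.
Proof.
  rewrite (bar_transfer _ _ _ _ _ _ _ _ _ _ transfer_p k).
  rewrite !Copp_conj, !Cmult_conj, !Cconj_conj, conj_il, conj_h. unfold laurent. ring.
Qed.

Lemma U_step n k : U (S n) k = (F11 n (U n) k + F12 n (V n) k)%C.
Proof.
  unfold U at 1, PD.
  rewrite (lprod_chain _ _ _ _ (fun n => conv (twist n p) (bar p)) (fun n => conv (twist n r) (bar p))
    _ _ _ _ _ _ n (twist_step n (bar p) _ _ _ _ _ _ _ _ _ _ p r Lp Lr (l2_bar _ Lp) transfer_p)).
  rewrite (lprod_chain _ _ _ _ (fun n => conv (twist n (bar r)) r) (fun n => conv (twist n (bar p)) r)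
    _ _ _ _ _ _ n (twist_step n r _ _ _ _ _ _ _ _ _ _ (bar r) (bar p) (l2_bar _ Lr) (l2_bar _ Lp) Lr
       transfer_bar_r)).
  unfold F11, F12, U, V, PD, laurent. ring.
Qed.

Lemma V_step n k : V (S n) k = (F21 n (U n) k + F22 n (V n) k)%C.
Proof.
  unfold V at 1, PD.
  assert (T1 : forall k, (RtoC lam * phi * laurent h h il (fun n => w n * r n) k =
     laurent (il * h) (- (il * h)) (Cconj z) r k + laurent (- h) h (il * z) p k)%C)
    by (intros; rewrite transfer_r; ring).
  assert (T2 : forall k, (RtoC lam * Cconj phi * laurent h h (- il) (fun n => w n * bar p n) k =
     laurent (il * h) (- (il * h)) (Cconj z) (bar p) k + laurent (- h) h (il * z) (bar r) k)%C)
    by (intros; rewrite transfer_bar_p; ring).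
  rewrite (lprod_chain _ _ _ _ (fun n => conv (twist n r) (bar p)) (fun n => conv (twist n p) (bar p))
    _ _ _ _ _ _ n (twist_step n (bar p) _ _ _ _ _ _ _ _ _ _ r p Lr Lp (l2_bar _ Lp) T1)).
  rewrite (lprod_chain _ _ _ _ (fun n => conv (twist n (bar p)) r) (fun n => conv (twist n (bar r)) r)
    _ _ _ _ _ _ n (twist_step n r _ _ _ _ _ _ _ _ _ _ (bar p) (bar r) (l2_bar _ Lp) (l2_bar _ Lr) Lr
       T2)).
  unfold F21, F22, U, V, PD, laurent. ring.
Qed.

Let a0 := (conv p (bar p) 0%Z - conv r (bar r) 0%Z)%C.

(** For a solution paired with itself the phase is 1, and a function invariant under an irrational
    translation is constant. *)
Lemma current_off_0 k : k <> 0%Z -> (conv p (bar p) k - conv r (bar r) k)%C = RtoC 0.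
Proof.
  intros Hk.
  assert (E := solution_current lam lp w lam_lp w_add w_unit z phi phi p m y r p m y r Hsol Hsol k Hz).
  rewrite (unimodular_conj phi Hphi) in E.
  set (t := (conv p (bar p) k - conv r (bar r) k)%C) in *.
  assert (w k - 1 <> RtoC 0)%C.
  { intros E'. apply (w_irr k Hk). transitivity (w k - 1 + 1)%C; [ring|rewrite E'; ring]. }
  replace t with ((1 * w k * t - t) / (w k - 1))%C by (field; auto).
  rewrite E. field; auto.
Qed.

Lemma U_0 k : U 0 k = (conv p (bar p) k - conv r (bar r) k)%C.
Proof.
  unfold U, PD. cbn [lprod Cpow].
  rewrite (conv_ext (twist 0 p) p (bar p) (bar p)) by (auto; apply twist_0).
  rewrite (conv_ext (twist 0 (bar r)) (bar r) r r) by (auto; apply twist_0).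
  rewrite (conv_comm (bar r) r) by auto using l2_bar. ring.
Qed.

Lemma V_0 k : V 0 k = RtoC 0.
Proof.
  unfold V, PD. cbn [lprod Cpow].
  rewrite (conv_ext (twist 0 r) r (bar p) (bar p)) by (auto; apply twist_0).
  rewrite (conv_ext (twist 0 (bar p)) (bar p) r r) by (auto; apply twist_0).
  rewrite (conv_comm (bar p) r) by auto using l2_bar. ring.
Qed.

Lemma UV_support n : forall k, (Z.of_nat n < k)%Z -> U n k = RtoC 0 /\ V n k = RtoC 0.
Proof.
  induction n as [|n IH]; intros k Hk.
  - rewrite U_0, V_0. split; auto. apply current_off_0. lia.
  - rewrite U_step, V_step. unfold F11, F12, F21, F22, laurent.
    destruct (IH (k + 1)%Z ltac:(lia)) as [-> ->].
    destruct (IH (k - 1)%Z ltac:(lia)) as [-> ->].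
    destruct (IH k ltac:(lia)) as [-> ->]. split; ring.
Qed.

(** (1, -i) is a left eigenvector of the coefficient matrix of the highest power in F, for the
    eigenvalue of larger modulus lam (1 + lp) / 2. This combination excludes cancellation in the top
    degree. *)
Lemma UV_top n :
  Cmod (U n (Z.of_nat n) - Ci * V n (Z.of_nat n))%C = (lam / 2 * (1 + lp)) ^ n * Cmod a0.
Proof.
  induction n as [|n IH].
  - rewrite U_0, V_0. simpl. rewrite Rmult_1_l. f_equal. unfold a0. ring.
  - transitivity (Cmod (- Ci * h * w (Z.of_nat n) * RtoC (1 + lp)
        * (U n (Z.of_nat n) - Ci * V n (Z.of_nat n)))%C).
    + f_equal. rewrite U_step, V_step. unfold F11, F12, F21, F22, laurent.
      replace (Z.of_nat (S n) - 1)%Z with (Z.of_nat n) by lia.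
      destruct (UV_support n (Z.of_nat (S n) + 1)%Z ltac:(lia)) as [-> ->].
      destruct (UV_support n (Z.of_nat (S n)) ltac:(lia)) as [-> ->].
      rewrite RtoC_plus. unfold il. ring [Ci2].
    + rewrite !Cmod_mult, IH, Cmod_opp, Cmod_Ci, w_unit. unfold h. rewrite !Cmod_R.
      rewrite !Rabs_pos_eq by lra. simpl. ring.
Qed.

(** The relation between [t] and [e] says that X = -t is a zero of h X + h X^-1 + e; the other zero
    is -1 / t, which gives the factorization. *)
Lemma PD_factor (t : C) e n f k :
  Cmod t = s -> (h * (1 + t * t) = e * t)%C ->
  Cmod (PD e n f k) = (lam / 2 / s) ^ n *
   Cmod (lprod (fun _ => RtoC 0) (fun j => t * w (Z.of_nat j))%C (fun _ => RtoC 1) n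
    (lprod (fun j => t * w (- Z.of_nat j)%Z)%C (fun _ => RtoC 0) (fun _ => RtoC 1) n f) k).
Proof.
  intros Ht He. assert (Hs := s_bounds).
  assert (Ht0 : t <> RtoC 0) by (intros ->; rewrite Cmod_0 in Ht; lra).
  assert (E : PD e n f k = lprod (fun j => (h / t) * (t * w (- Z.of_nat j)%Z))%C
     (fun j => (h / t) * (t * w (Z.of_nat j)))%C
     (fun j => (h / t) * (1 + (t * w (- Z.of_nat j)%Z) * (t * w (Z.of_nat j))))%C n f k).
  { unfold PD. f_equal; apply functional_extensionality; intros j.
    - field; auto.
    - field; auto.
    - assert (W : (w (- Z.of_nat j)%Z * w (Z.of_nat j))%C = RtoC 1).
      { rewrite <- w_add. replace (- Z.of_nat j + Z.of_nat j)%Z with 0%Z by lia. apply w_0; auto. }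
      transitivity (h * (1 + t * t * (w (- Z.of_nat j)%Z * w (Z.of_nat j))) / t)%C; [|field; auto].
      rewrite W. replace (h * (1 + t * t * 1))%C with (h * (1 + t * t))%C by ring.
      rewrite He. field; auto. }
  rewrite E, lprod_factor, Cmod_mult, Cmod_pow. f_equal. f_equal.
  rewrite Cmod_div by auto. rewrite Ht. unfold h. rewrite Cmod_R, Rabs_pos_eq by lra. reflexivity.
Qed.

Lemma half_lam_s : lam / 2 * (1 + - (s * s)) = lp * s.
Proof.
  assert (Hs := s_bounds). assert (E := s_lam).
  assert (E1 : lam = (1 + lp) * s) by (rewrite <- E; field; lra).
  assert (E2 : s * lam = 1 - lp) by (unfold s; field; lra).
  nra.
Qed.

Lemma Cmod_is : Cmod (Ci * RtoC s)%C = s.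
Proof. assert (Hs := s_bounds). rewrite Cmod_mult, Cmod_Ci, Cmod_R, Rabs_pos_eq; lra. Qed.

(* A nonzero current [a0] would force the leading coefficients of [U n], [V n] to have size rho^n |a0|
   with rho = lam (1 + lp) / 2, while along records [n] they are o(rho^n). *)
Lemma current_0 : a0 = RtoC 0.
Proof.
  assert (Hs := s_bounds).
  apply Cmod_small. intros eps Heps.
  (* t = -i s factors the denominator d, and t = i s its conjugate. *)
  assert (D : (h * (1 + (- (Ci * RtoC s)) * (- (Ci * RtoC s))) = il * (- (Ci * RtoC s)))%C).
  { transitivity (RtoC (lam / 2 * (1 + - (s * s)))).
    - rewrite RtoC_mult, RtoC_plus, RtoC_opp, RtoC_mult. unfold h. ring [Ci2].
    - rewrite half_lam_s, RtoC_mult. unfold il. ring [Ci2]. }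
  assert (D' : (h * (1 + (Ci * RtoC s) * (Ci * RtoC s)) = (- il) * (Ci * RtoC s))%C).
  { transitivity (RtoC (lam / 2 * (1 + - (s * s)))).
    - rewrite RtoC_mult, RtoC_plus, RtoC_opp, RtoC_mult. unfold h. ring [Ci2].
    - rewrite half_lam_s, RtoC_mult. unfold il. ring [Ci2]. }
  assert (T : Cmod (- (Ci * RtoC s))%C = s) by (rewrite Cmod_opp; apply Cmod_is).
  assert (T' := Cmod_is).
  destruct (twisted_product_small _ p (bar p) T Lp (l2_bar _ Lp) (eps / 4)) as [N1 H1]; [lra|].
  destruct (twisted_product_small _ (bar r) r T' (l2_bar _ Lr) Lr (eps / 4)) as [N2 H2]; [lra|].
  destruct (twisted_product_small _ r (bar p) T Lr (l2_bar _ Lp) (eps / 4)) as [N3 H3]; [lra|].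
  destruct (twisted_product_small _ (bar p) r T' (l2_bar _ Lp) Lr (eps / 4)) as [N4 H4]; [lra|].
  destruct (record_unbounded (w 1) (w_unit 1)
    ltac:(intros k Hk; rewrite w_pow; apply w_irr; lia) (N1 + N2 + N3 + N4)%nat) as (n & Hn & Hr).
  specialize (H1 n ltac:(lia) Hr). specialize (H2 n ltac:(lia) Hr).
  specialize (H3 n ltac:(lia) Hr). specialize (H4 n ltac:(lia) Hr).
  assert (E := UV_top n).
  set (rho := lam / 2 * (1 + lp)) in *.
  assert (Hrho : 0 < rho ^ n) by (apply pow_lt; unfold rho; nra).
  (* The mean of the denominators equals the growth rate of the top coefficient; after division by
     rho^n only the small factors from [twisted_product_small] remain. *)
  assert (Er : lam * (lam / 2 / s) = rho) by (unfold rho; rewrite <- s_lam; field; lra).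
  assert (Bd : forall c e t f, Cmod c = 1 -> Cmod t = s -> (h * (1 + t * t) = e * t)%C ->
    Cmod (lprod (fun _ => RtoC 0) (fun j => t * w (Z.of_nat j))%C (fun _ => RtoC 1) n
    (lprod (fun j => t * w (- Z.of_nat j)%Z)%C (fun _ => RtoC 0) (fun _ => RtoC 1) n f) (Z.of_nat n))
      <= eps / 4 ->
    Cmod (Cpow (RtoC lam * c) n * PD e n f (Z.of_nat n))%C <= rho ^ n * (eps / 4)).
  { intros c e t f Hc Ht He Hb.
    rewrite Cmod_mult, Cmod_pow, Cmod_mult, Cmod_R, Hc, Rabs_pos_eq, Rmult_1_r by lra.
    rewrite (PD_factor t e n f _ Ht He), <- Rmult_assoc, <- Rpow_mult_distr, Er.
    apply Rmult_le_compat_l; lra. }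
  assert (Hphi' : Cmod (Cconj phi) = 1) by (rewrite Cmod_conj; auto).
  assert (B1 := Bd _ _ _ _ Hphi T D H1). assert (B2 := Bd _ _ _ _ Hphi' T' D' H2).
  assert (B3 := Bd _ _ _ _ Hphi T D H3). assert (B4 := Bd _ _ _ _ Hphi' T' D' H4).
  apply Rmult_le_reg_l with (rho ^ n); auto. rewrite <- E.
  unfold U, V.
  set (x1 := (Cpow (RtoC lam * phi) n * PD il n (conv (twist n p) (bar p)) _)%C) in *.
  set (x2 := (_ * PD (- il) n (conv (twist n (bar r)) r) _)%C) in *.
  set (x3 := (_ * PD il n (conv (twist n r) (bar p)) _)%C) in *.
  set (x4 := (_ * PD (- il) n (conv (twist n (bar p)) r) _)%C) in *.
  replace (x1 - x2 - Ci * (x3 - x4))%C with (x1 + - x2 + (- (Ci * x3) + Ci * x4))%C by ring.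
  eapply Rle_trans; [apply Cmod_triangle|].
  assert (C1 := Cmod_triangle x1 (- x2)%C). rewrite Cmod_opp in C1.
  assert (C2 := Cmod_triangle (- (Ci * x3)) (Ci * x4)%C).
  rewrite Cmod_opp, !Cmod_mult, Cmod_Ci in C2. lra.
Qed.

Lemma solution_null_current k : conv p (bar p) k = conv r (bar r) k.
Proof.
  assert (E : (conv p (bar p) k - conv r (bar r) k)%C = RtoC 0).
  { destruct (Z.eq_dec k 0) as [->|Hk]; [apply current_0|apply current_off_0; auto]. }
  transitivity (conv p (bar p) k - conv r (bar r) k + conv r (bar r) k)%C; [ring|rewrite E; ring].
Qed.
End Null.
End Walk.

(** * Fourier analysis on finite grids *)

Definition expi (t : R) : C := (cos t, sin t).

Lemma expi_plus a b : expi (a + b) = (expi a * expi b)%C.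
Proof. apply injective_projections; simpl; [rewrite cos_plus|rewrite sin_plus]; ring. Qed.

Lemma Cmod_expi t : Cmod (expi t) = 1.
Proof.
  transitivity (sqrt 1); [|apply sqrt_1]. unfold Cmod, expi. simpl. f_equal.
  assert (H := sin2_cos2 t). unfold Rsqr in H. lra.
Qed.

Lemma expi_2PI (k : Z) : expi (2 * PI * IZR k) = RtoC 1.
Proof.
  apply injective_projections; simpl.
  - replace (2 * PI * IZR k) with (2 * (IZR k * PI)) by ring. rewrite cos_2a_sin.
    rewrite sin_eq_0_1 by (exists k; auto). ring.
  - apply sin_eq_0_1. exists (2 * k)%Z. rewrite mult_IZR. ring.
Qed.

Lemma expi_eq_1 x : expi (2 * PI * x) = RtoC 1 -> exists k : Z, x = IZR k.
Proof.
  intros H. apply (f_equal fst) in H. simpl in H.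
  replace (2 * PI * x) with (2 * (PI * x)) in H by ring. rewrite cos_2a_sin in H.
  assert (S0 : sin (PI * x) = 0) by nra.
  apply sin_eq_0_0 in S0 as [k Hk]. exists k.
  assert (HP := PI_RGT_0). apply Rmult_eq_reg_l with PI; [|lra]. rewrite Hk. ring.
Qed.

Definition trunc (N : nat) (f : Z -> C) (n : Z) : C :=
  if zmem n (zbox N) then f n else RtoC 0.

(** Coefficient k of the product of two partial sums: both sequences are cut to the box. *)
Definition tconv (N : nat) (f g : Z -> C) (k : Z) : C :=
  csum (zbox N) (fun n => f n * trunc N g (k - n)%Z)%C.

Lemma csum_filter {A} (b : A -> bool) l (f : A -> C) :
  csum (filter b l) f = csum l (fun x => if b x then f x else RtoC 0).
Proof.
  induction l as [|x l IH]; [reflexivity|]. simpl. destruct (b x); simpl; rewrite IH; ring.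
Qed.

Lemma zmem_In n l : zmem n l = true <-> In n l.
Proof. unfold zmem. destruct (in_dec Z.eq_dec n l); split; intros; auto; congruence. Qed.

Lemma tconv_cvg f g k :
  l2 f -> l2 g -> forall eps, 0 < eps ->
  exists N1, forall N, (N1 <= N)%nat -> Cmod (tconv N f g k - conv f g k)%C < eps.
Proof.
  intros Hf Hg eps Heps. destruct (conv_correct f g k Hf Hg eps Heps) as [K HK].
  exists (K + Z.abs_nat k)%nat. intros N HN.
  replace (tconv N f g k) with
    (csum (filter (fun n => zmem (k - n)%Z (zbox N)) (zbox N)) (fun n => f n * g (k - n)%Z)%C).
  - apply HK; [apply NoDup_filter, NoDup_zbox|]. intros n Hn. apply In_zbox in Hn.
    apply filter_In. rewrite zmem_In, !In_zbox. lia.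
  - rewrite csum_filter. apply csum_ext. intros n _. unfold trunc.
    destruct (zmem (k - n)%Z (zbox N)); ring.
Qed.

Lemma csum_zbox_opp N (f : Z -> C) : csum (zbox N) (fun n => f (- n)%Z) = csum (zbox N) f.
Proof.
  rewrite <- (csum_map (zbox N) Z.opp f). apply csum_perm.
  apply NoDup_Permutation.
  - apply FinFun.Injective_map_NoDup; [intros x y; lia|apply NoDup_zbox].
  - apply NoDup_zbox.
  - intros x. rewrite in_map_iff, In_zbox. split.
    + intros (y & <- & Hy). apply In_zbox in Hy. lia.
    + intros Hx. exists (- x)%Z. rewrite In_zbox. lia.
Qed.

Section Grid.
Variables (M : nat) (zeta : Z -> C).
Hypothesis zeta_add : forall a b, zeta (a + b)%Z = (zeta a * zeta b)%C.
Hypothesis zeta_unit : forall a, Cmod (zeta a) = 1.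
Hypothesis zeta_M : zeta (Z.of_nat M) = RtoC 1.
Hypothesis zeta_ne1 : forall k, (0 < Z.abs k < Z.of_nat M)%Z -> zeta k <> RtoC 1.

(** [gsum] and [gnorm] are M times means over the grid of points x / M, and [dft] evaluates the N-th
    partial sum of a Fourier series there. *)
Definition gsum (F : Z -> C) : C := csum (seq 0 M) (fun x => F (Z.of_nat x)).
Definition gnorm (F : Z -> C) : R := rsum (seq 0 M) (fun x => Cmod (F (Z.of_nat x))).
Definition dft (N : nat) (f : Z -> C) (x : Z) : C := csum (zbox N) (fun n => f n * zeta (n * x))%C.

Lemma zeta_0 : zeta 0 = RtoC 1.
Proof. apply w_0; auto. Qed.

Lemma zeta_pow k j : Cpow (zeta k) j = zeta (k * Z.of_nat j).
Proof.
  induction j as [|j IH]; [rewrite Z.mul_0_r; symmetry; apply zeta_0|].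
  rewrite Cpow_S, IH, <- zeta_add. f_equal. lia.
Qed.

Lemma zeta_mul_M k : zeta (k * Z.of_nat M) = RtoC 1.
Proof.
  assert (H : forall j, zeta (Z.of_nat j * Z.of_nat M) = RtoC 1)
    by (intros j; rewrite Z.mul_comm, <- zeta_pow, zeta_M; apply Cpow_1_l).
  destruct (Z_le_dec 0 k).
  - rewrite <- (H (Z.to_nat k)). do 2 f_equal. lia.
  - replace (k * Z.of_nat M)%Z with (- (Z.of_nat (Z.to_nat (- k)) * Z.of_nat M))%Z by lia.
    rewrite (w_neg zeta zeta_add zeta_unit), H. apply Cconj_R.
Qed.

Lemma gsum_zeta k :
  (Z.abs k < Z.of_nat M)%Z ->
  gsum (fun x => zeta (k * x)) = if Z.eq_dec k 0 then RtoC (INR M) else RtoC 0.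
Proof.
  intros Hk. unfold gsum. destruct (Z.eq_dec k 0) as [->|Hk0].
  - rewrite (csum_ext _ _ (fun _ => RtoC 1)) by (intros; apply zeta_0).
    rewrite csum_RtoC, rsum_const, length_seq. f_equal; ring.
  - rewrite (csum_ext _ _ (fun x => Cpow (zeta k) x)) by (intros; symmetry; apply zeta_pow).
    assert (G := geometric_sum (zeta k) M). rewrite zeta_pow in G.
    rewrite zeta_mul_M in G.
    set (c := csum _ _) in *.
    assert (Hne : (1 - zeta k)%C <> RtoC 0).
    { intros E. apply (zeta_ne1 k ltac:(lia)).
      transitivity (1 - (1 - zeta k))%C; [ring|rewrite E; ring]. }
    replace c with ((1 - zeta k) * c / (1 - zeta k))%C by (field; auto).
    rewrite G. field; auto.
Qed.

Lemma gsum_scal c F : gsum (fun x => c * F x)%C = (c * gsum F)%C.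
Proof. apply (csum_scal (seq 0 M) c (fun x => F (Z.of_nat x))). Qed.

Lemma gsum_csum {A} (l : list A) (F : A -> Z -> C) :
  gsum (fun x => csum l (fun a => F a x)) = csum l (fun a => gsum (F a)).
Proof. unfold gsum. apply (csum_swap (seq 0 M) l (fun x a => F a (Z.of_nat x))). Qed.

Lemma gsum_ext F G : (forall x, F x = G x) -> gsum F = gsum G.
Proof. intros H. apply csum_ext. intros; apply H. Qed.

Lemma conj_dft N f x : Cconj (dft N f x) = dft N (bar f) x.
Proof.
  unfold dft. rewrite csum_conj.
  rewrite <- (csum_zbox_opp N (fun n => bar f n * zeta (n * x))%C).
  apply csum_ext. intros n _. unfold bar. rewrite Z.opp_involutive, Cmult_conj.
  f_equal. rewrite <- (w_neg zeta zeta_add zeta_unit). f_equal. ring.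
Qed.

(** Exact quadrature: every frequency n + l - k has modulus below M, so there is no aliasing. *)
Lemma dft_coef N f g k :
  (2 * Z.of_nat N + Z.abs k < Z.of_nat M)%Z ->
  gsum (fun x => dft N f x * dft N g x * zeta (- k * x))%C = (RtoC (INR M) * tconv N f g k)%C.
Proof.
  intros Hk.
  rewrite (gsum_ext _ (fun x => csum (zbox N) (fun n => csum (zbox N)
     (fun l => f n * g l * zeta ((n + l - k) * x)))))%C.
  - rewrite gsum_csum. unfold tconv. rewrite <- csum_scal. apply csum_ext. intros n Hn.
    rewrite gsum_csum.
    rewrite (csum_single Z.eq_dec (zbox N) (k - n)%Z).
    + unfold trunc, zmem. destruct (in_dec Z.eq_dec (k - n)%Z (zbox N)); [|ring].
      rewrite gsum_scal, gsum_zeta by lia.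
      destruct (Z.eq_dec _ _); [ring|lia].
    + apply NoDup_zbox.
    + intros l Hl Hne. apply In_zbox in Hn. apply In_zbox in Hl.
      rewrite gsum_scal, gsum_zeta by lia.
      destruct (Z.eq_dec _ _); [lia|ring].
  - intros x. unfold dft. rewrite <- !csum_scal_r. apply csum_ext. intros n _.
    rewrite <- csum_scal, <- csum_scal_r. apply csum_ext. intros l _.
    replace ((n + l - k) * x)%Z with (n * x + (l * x + - k * x))%Z by ring.
    rewrite !zeta_add. ring.
Qed.

Lemma parseval N f :
  (2 * Z.of_nat N < Z.of_nat M)%Z ->
  rsum (seq 0 M) (fun x => Cmod (dft N f (Z.of_nat x)) ^ 2) =
  INR M * rsum (zbox N) (fun n => Cmod (f n) ^ 2).
Proof.
  intros HN. apply RtoC_inj. rewrite RtoC_mult, <- !csum_RtoC.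
  assert (E := dft_coef N f (bar f) 0 ltac:(lia)).
  transitivity (gsum (fun x => dft N f x * dft N (bar f) x * zeta (- (0) * x)))%C.
  - unfold gsum. apply csum_ext. intros x _. rewrite Cmod2_conj, conj_dft.
    replace (- 0 * Z.of_nat x)%Z with 0%Z by lia. rewrite zeta_0. ring.
  - rewrite E. f_equal. unfold tconv. apply csum_ext. intros n Hn. rewrite Cmod2_conj.
    unfold trunc. replace (zmem (0 - n) (zbox N)) with true.
    + unfold bar. do 2 f_equal. f_equal. lia.
    + symmetry. apply zmem_In. apply In_zbox in Hn. apply In_zbox. lia.
Qed.

(** Parseval and a weighted AM-GM inequality; the weight [tau] lets a small [a] compensate for a [b]
    that is merely bounded. *)
Lemma gnorm_dft_mul N f g a b tau :
  (2 * Z.of_nat N < Z.of_nat M)%Z -> 0 < tau ->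
  zsum_le (fun n => Cmod (f n) ^ 2) a -> zsum_le (fun n => Cmod (g n) ^ 2) b ->
  gnorm (fun x => dft N f x * dft N g x)%C <= INR M * ((tau * a + b / tau) / 2).
Proof.
  intros HN Ht Ha Hb. unfold gnorm.
  apply Rle_trans with (rsum (seq 0 M) (fun x =>
    (tau / 2) * Cmod (dft N f (Z.of_nat x)) ^ 2 + (/ (2 * tau)) * Cmod (dft N g (Z.of_nat x)) ^ 2)).
  - apply rsum_le. intros x _. rewrite Cmod_mult.
    set (u := Cmod (dft N f _)). set (v := Cmod (dft N g _)).
    assert (0 <= / (2 * tau) * (tau * u - v) ^ 2).
    { apply Rmult_le_pos; [left; apply Rinv_0_lt_compat; lra|apply pow2_ge_0]. }
    replace (/ (2 * tau) * (tau * u - v) ^ 2) with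
      (tau / 2 * u ^ 2 + / (2 * tau) * v ^ 2 - u * v) in H by (field; lra). lra.
  - rewrite rsum_plus, !rsum_scal, !parseval by auto.
    assert (A := Ha _ (NoDup_zbox N)). assert (B := Hb _ (NoDup_zbox N)).
    set (A' := rsum _ _) in *. set (B' := rsum _ _) in *.
    replace (INR M * ((tau * a + b / tau) / 2)) with
      (tau / 2 * (INR M * a) + / (2 * tau) * (INR M * b)) by (field; lra).
    assert (0 <= INR M) by apply pos_INR.
    assert (0 < / (2 * tau)) by (apply Rinv_0_lt_compat; lra).
    apply Rplus_le_compat; apply Rmult_le_compat_l; try lra; apply Rmult_le_compat_l; auto.
Qed.

(** * Fejer means on the grid *)

Definition hat (F : Z -> C) (k : Z) : C := (gsum (fun x => F x * zeta (- k * x)) / RtoC (INR M))%C.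

(** Frequency k arises from m - |k| pairs, hence has the Fejer weight 1 - |k| / m. The double sum
    exhibits the kernel as |D|^2 / m with a Dirichlet sum D. *)
Definition fejer (m : nat) (F : Z -> C) (x : Z) : C :=
  (csum (seq 0 m) (fun a => csum (seq 0 m) (fun b =>
     hat F (Z.of_nat a - Z.of_nat b) * zeta ((Z.of_nat a - Z.of_nat b) * x))) / RtoC (INR m))%C.

Hypothesis M_pos : (0 < M)%nat.

Lemma INR_M_neq : RtoC (INR M) <> RtoC 0.
Proof. apply RtoC_neq. apply not_0_INR. lia. Qed.

Lemma gnorm_triangle F G : gnorm (fun x => F x + G x)%C <= gnorm F + gnorm G.
Proof.
  unfold gnorm. rewrite <- rsum_plus. apply rsum_le. intros; apply Cmod_triangle.
Qed.

Lemma gnorm_ext F G : (forall x, F x = G x) -> gnorm F = gnorm G.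
Proof. intros H. apply rsum_ext. intros; rewrite H; auto. Qed.

Lemma gnorm_const F c : (forall x, Cmod (F x) <= c) -> gnorm F <= INR M * c.
Proof.
  intros H. unfold gnorm. eapply Rle_trans; [apply rsum_le; intros; apply H|].
  rewrite rsum_const, length_seq. lra.
Qed.

Lemma hat_le F k : Cmod (hat F k) <= gnorm F / INR M.
Proof.
  assert (HM : 0 < INR M) by (apply lt_0_INR; auto).
  unfold hat. rewrite Cmod_div by apply INR_M_neq. rewrite Cmod_R, Rabs_pos_eq by lra.
  apply Rmult_le_compat_r; [left; apply Rinv_0_lt_compat; auto|].
  eapply Rle_trans; [apply Cmod_csum|]. apply rsum_le. intros x _.
  rewrite Cmod_mult, zeta_unit. lra.
Qed.

(** The Fejer mean is convolution with a nonnegative kernel of mean one. *)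
Lemma fejer_contraction m F :
  (0 < m <= M)%nat -> gnorm (fejer m F) <= gnorm F.
Proof.
  intros Hm.
  assert (HM : 0 < INR M) by (apply lt_0_INR; auto).
  assert (Hm' : 0 < INR m) by (apply lt_0_INR; lia).
  set (D := fun t => csum (seq 0 m) (fun a => zeta (Z.of_nat a * t))).
  assert (DD : forall t, RtoC (Cmod (D t) ^ 2) = csum (seq 0 m) (fun a => csum (seq 0 m)
     (fun b => zeta ((Z.of_nat a - Z.of_nat b) * t)))).
  { intros t. rewrite Cmod2_conj. unfold D. rewrite csum_conj, <- csum_scal_r. apply csum_ext.
    intros a _. rewrite <- csum_scal. apply csum_ext. intros b _.
    rewrite <- (w_neg zeta zeta_add zeta_unit), <- zeta_add. f_equal. ring. }
  assert (E : forall x, fejer m F x = (gsum (fun y => F y * RtoC (Cmod (D (x - y)%Z) ^ 2))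
       / RtoC (INR M * INR m))%C).
  { intros x. unfold fejer. rewrite RtoC_mult.
    rewrite (gsum_ext _ (fun y => csum (seq 0 m) (fun a => csum (seq 0 m) (fun b =>
       zeta ((Z.of_nat a - Z.of_nat b) * x) * (F y * zeta (- (Z.of_nat a - Z.of_nat b) * y)))))%C).
    2:{ intros y. rewrite DD, <- csum_scal. apply csum_ext. intros a _.
        rewrite <- csum_scal. apply csum_ext. intros b _.
        replace ((Z.of_nat a - Z.of_nat b) * (x - y))%Z with
          ((Z.of_nat a - Z.of_nat b) * x + - (Z.of_nat a - Z.of_nat b) * y)%Z by ring.
        rewrite zeta_add. ring. }
    rewrite gsum_csum.
    rewrite (csum_ext (seq 0 m) (fun a => gsum _) (fun a => csum (seq 0 m) (fun b =>
       RtoC (INR M) * (hat F (Z.of_nat a - Z.of_nat b) * zeta ((Z.of_nat a - Z.of_nat b) * x))))%C).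
    2:{ intros a _. rewrite gsum_csum. apply csum_ext. intros b _. rewrite gsum_scal.
        unfold hat. field. apply INR_M_neq. }
    rewrite (csum_ext (seq 0 m) (fun a => csum _ (fun b => RtoC (INR M) * _)%C) (fun a => RtoC (INR M) * csum (seq 0 m) (fun b =>
       hat F (Z.of_nat a - Z.of_nat b) * zeta ((Z.of_nat a - Z.of_nat b) * x)))%C) by (intros; apply csum_scal).
    rewrite csum_scal. field. split; [|apply INR_M_neq]. apply RtoC_neq. lra. }
  assert (Dsum : forall y, rsum (seq 0 M) (fun x => Cmod (D (Z.of_nat x - y)%Z) ^ 2) = INR M * INR m).
  { intros y. apply RtoC_inj. rewrite <- csum_RtoC.
    transitivity (gsum (fun x => csum (seq 0 m) (fun a => csum (seq 0 m) (fun b =>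
       zeta (- ((Z.of_nat a - Z.of_nat b) * y)) * zeta ((Z.of_nat a - Z.of_nat b) * x))))%C).
    { unfold gsum. apply csum_ext. intros x _. rewrite DD. apply csum_ext. intros a _.
      apply csum_ext. intros b _. rewrite <- zeta_add. f_equal. ring. }
    rewrite gsum_csum. rewrite (csum_ext _ _ (fun _ => RtoC (INR M))).
    - rewrite csum_RtoC, rsum_const, length_seq. f_equal. ring.
    - intros a Ha. apply in_seq in Ha. rewrite gsum_csum.
      rewrite (csum_single Nat.eq_dec _ a).
      + destruct (in_dec Nat.eq_dec a (seq 0 m)) as [_|n]; [|exfalso; apply n, in_seq; lia].
        rewrite gsum_scal, gsum_zeta by lia. destruct (Z.eq_dec _ _); [|lia].
        rewrite Z.sub_diag. replace (- (0 * y))%Z with 0%Z by lia. rewrite zeta_0. ring.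
      + apply seq_NoDup.
      + intros b Hb Hne. apply in_seq in Hb. rewrite gsum_scal, gsum_zeta by lia.
        destruct (Z.eq_dec _ _); [lia|ring]. }
  apply Rle_trans with (rsum (seq 0 M) (fun x => / (INR M * INR m) *
     rsum (seq 0 M) (fun y => Cmod (F (Z.of_nat y)) * Cmod (D (Z.of_nat x - Z.of_nat y)%Z) ^ 2))).
  - unfold gnorm. apply rsum_le. intros x _. rewrite E.
    rewrite Cmod_div by (apply RtoC_neq; nra). rewrite Cmod_R, Rabs_pos_eq by nra.
    unfold Rdiv. rewrite Rmult_comm. apply Rmult_le_compat_l.
    + left; apply Rinv_0_lt_compat; nra.
    + eapply Rle_trans; [apply Cmod_csum|]. apply rsum_le. intros y _.
      rewrite Cmod_mult, Cmod_R, Rabs_pos_eq by apply pow2_ge_0. lra.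
  - rewrite rsum_scal, rsum_swap.
    rewrite (rsum_ext _ _ (fun y => (INR M * INR m) * Cmod (F (Z.of_nat y)))).
    + rewrite rsum_scal, <- Rmult_assoc, Rinv_l by nra. unfold gnorm. lra.
    + intros y _. rewrite rsum_scal, Dsum. ring.
Qed.

Lemma rsum_lt_count m c : rsum (seq 0 m) (fun a => if Nat.ltb a c then 1 else 0) <= INR (min m c).
Proof.
  induction m as [|m IH]; [simpl; lra|]. rewrite rsum_seq_S.
  destruct (Nat.ltb_spec m c).
  - replace (min (S m) c) with (S (min m c)) by lia. rewrite S_INR. lra.
  - replace (min (S m) c) with (min m c) by lia. lra.
Qed.

Lemma rsum_ge_count m c : rsum (seq 0 m) (fun a => if Nat.leb c a then 1 else 0) <= INR (m - c).
Proof.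
  induction m as [|m IH]; [simpl; lra|]. rewrite rsum_seq_S.
  destruct (Nat.leb_spec c m).
  - replace (S m - c)%nat with (S (m - c)) by lia. rewrite S_INR. lra.
  - replace (S m - c)%nat with (m - c)%nat by lia. lra.
Qed.

(** Each a has exactly one partner b = a - k, except for the at most |k| values of a for which a - k
    leaves the range. *)
Lemma fejer_count m k :
  Cmod (RtoC (INR m) - csum (seq 0 m) (fun a => csum (seq 0 m) (fun b =>
    if Z.eq_dec (Z.of_nat a - Z.of_nat b) k then RtoC 1 else RtoC 0)))%C <= IZR (Z.abs k).
Proof.
  replace (RtoC (INR m)) with (csum (seq 0 m) (fun _ => RtoC 1))
    by (rewrite csum_RtoC, rsum_const, length_seq; f_equal; ring).
  set (g := fun a => csum (seq 0 m) (fun b =>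
    if Z.eq_dec (Z.of_nat a - Z.of_nat b) k then RtoC 1 else RtoC 0)).
  replace (csum (seq 0 m) (fun _ => RtoC 1) - csum (seq 0 m) g)%C with
    (csum (seq 0 m) (fun a => RtoC 1 + - (1) * g a))%C by (rewrite csum_plus, csum_scal; ring).
  eapply Rle_trans; [apply Cmod_csum|].
  assert (Hg : forall a, (0 <= Z.of_nat a - k < Z.of_nat m)%Z -> g a = RtoC 1).
  { intros a Ha. unfold g. rewrite (csum_single Nat.eq_dec _ (Z.to_nat (Z.of_nat a - k))).
    - destruct (in_dec _ _ _) as [_|n]; [|exfalso; apply n, in_seq; lia].
      destruct (Z.eq_dec _ _); [auto|lia].
    - apply seq_NoDup.
    - intros b _ Hb. destruct (Z.eq_dec _ _); [lia|auto]. }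
  assert (Hg' : forall a, ~ (0 <= Z.of_nat a - k < Z.of_nat m)%Z -> g a = RtoC 0).
  { intros a Ha. unfold g. apply csum_zero. intros b Hb. apply in_seq in Hb.
    destruct (Z.eq_dec _ _); [lia|auto]. }
  assert (C0 : Cmod (RtoC 1 + - (1) * RtoC 1)%C = 0)
    by (replace (RtoC 1 + - (1) * RtoC 1)%C with (RtoC 0) by ring; apply Cmod_0).
  assert (C1 : Cmod (RtoC 1 + - (1) * RtoC 0)%C = 1)
    by (replace (RtoC 1 + - (1) * RtoC 0)%C with (RtoC 1) by ring; apply Cmod_1).
  destruct (Z_le_dec 0 k) as [Hk|Hk].
  - apply Rle_trans with (rsum (seq 0 m) (fun a => if Nat.ltb a (Z.to_nat k) then 1 else 0)).
    + apply rsum_le. intros a Ha. apply in_seq in Ha.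
      destruct (Nat.ltb_spec a (Z.to_nat k)).
      * rewrite Hg' by lia. lra.
      * rewrite Hg by lia. lra.
    + eapply Rle_trans; [apply rsum_lt_count|]. rewrite INR_IZR_INZ. apply IZR_le. lia.
  - apply Rle_trans with (rsum (seq 0 m) (fun a => if Nat.leb (m - Z.to_nat (- k)) a then 1 else 0)).
    + apply rsum_le. intros a Ha. apply in_seq in Ha.
      destruct (Nat.leb_spec (m - Z.to_nat (- k)) a).
      * destruct (classic (0 <= Z.of_nat a - k < Z.of_nat m)%Z); [rewrite Hg|rewrite Hg']; auto; lra.
      * rewrite Hg by lia. lra.
    + eapply Rle_trans; [apply rsum_ge_count|]. rewrite INR_IZR_INZ. apply IZR_le. lia.
Qed.

(** The product has degree at most 2 N, and the Fejer weight of frequency k differs from 1 by at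
    most |k| / m. The bound does not depend on the grid. *)
Lemma fejer_dft_mul N f g m x :
  (0 < m)%nat -> (2 * Z.of_nat N + Z.of_nat m < Z.of_nat M)%Z ->
  Cmod (dft N f x * dft N g x - fejer m (fun x => dft N f x * dft N g x) x)%C <=
  rsum (zbox N) (fun n => rsum (zbox N) (fun l => Cmod (f n) * Cmod (g l) * (2 * INR N))) / INR m.
Proof.
  intros Hm HM.
  assert (Hm' : 0 < INR m) by (apply lt_0_INR; lia).
  set (mu := fun k => csum (seq 0 m) (fun a => csum (seq 0 m) (fun b =>
    if Z.eq_dec (Z.of_nat a - Z.of_nat b) k then RtoC 1 else RtoC 0))).
  assert (E : (fejer m (fun x => dft N f x * dft N g x) x =
    csum (zbox N) (fun n => csum (zbox N) (fun l => f n * g l * zeta ((n + l) * x) * mu (n + l)%Z))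
     / RtoC (INR m))%C).
  { unfold fejer. f_equal.
    transitivity (csum (seq 0 m) (fun a => csum (seq 0 m) (fun b => csum (zbox N) (fun n =>
      csum (zbox N) (fun l => f n * g l * zeta ((n + l) * x) *
        (if Z.eq_dec (Z.of_nat a - Z.of_nat b) (n + l) then RtoC 1 else RtoC 0))))))%C.
    - apply csum_ext. intros a Ha. apply in_seq in Ha. apply csum_ext. intros b Hb. apply in_seq in Hb.
      unfold hat. rewrite dft_coef by lia.
      set (k := (Z.of_nat a - Z.of_nat b)%Z).
      transitivity (tconv N f g k * zeta (k * x))%C; [field; apply INR_M_neq|].
      unfold tconv. rewrite <- csum_scal_r. apply csum_ext. intros n Hn.
      rewrite (csum_single Z.eq_dec (zbox N) (k - n)%Z).
      + unfold trunc, zmem. destruct (in_dec Z.eq_dec (k - n)%Z (zbox N)); [|ring].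
        destruct (Z.eq_dec _ _); [|lia]. replace (n + (k - n))%Z with k by lia. ring.
      + apply NoDup_zbox.
      + intros l _ Hl. destruct (Z.eq_dec _ _); [lia|ring].
    - rewrite (csum_ext (seq 0 m) _ (fun a => csum (zbox N) (fun n => csum (zbox N) (fun l =>
         csum (seq 0 m) (fun b => f n * g l * zeta ((n + l) * x) *
        (if Z.eq_dec (Z.of_nat a - Z.of_nat b) (n + l) then RtoC 1 else RtoC 0)))))%C).
      2:{ intros a _. rewrite csum_swap. apply csum_ext. intros n _. apply csum_swap. }
      rewrite csum_swap. apply csum_ext. intros n _. rewrite csum_swap. apply csum_ext. intros l _.
      unfold mu. rewrite <- csum_scal. apply csum_ext. intros a _. apply csum_scal. }
  rewrite E.
  assert (E2 : (dft N f x * dft N g x)%C = csum (zbox N) (fun n => csum (zbox N)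
     (fun l => f n * g l * zeta ((n + l) * x)))%C).
  { unfold dft. rewrite <- csum_scal_r. apply csum_ext. intros n _. rewrite <- csum_scal.
    apply csum_ext. intros l _. replace ((n + l) * x)%Z with (n * x + l * x)%Z by ring.
    rewrite zeta_add. ring. }
  rewrite E2.
  replace (csum (zbox N) (fun n => csum (zbox N) (fun l => f n * g l * zeta ((n + l) * x))) -
    csum (zbox N) (fun n => csum (zbox N) (fun l => f n * g l * zeta ((n + l) * x) * mu (n + l)%Z))
      / RtoC (INR m))%C with
    (csum (zbox N) (fun n => csum (zbox N) (fun l => f n * g l * zeta ((n + l) * x) *
       (RtoC (INR m) - mu (n + l)%Z))) / RtoC (INR m))%C.
  - rewrite Cmod_div by (apply RtoC_neq; lra). rewrite Cmod_R, Rabs_pos_eq by lra.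
    apply Rmult_le_compat_r; [left; apply Rinv_0_lt_compat; auto|].
    eapply Rle_trans; [apply Cmod_csum|]. apply rsum_le. intros n Hn.
    eapply Rle_trans; [apply Cmod_csum|]. apply rsum_le. intros l Hl.
    rewrite !Cmod_mult, zeta_unit, Rmult_1_r. apply Rmult_le_compat_l.
    + apply Rmult_le_pos; apply Cmod_ge_0.
    + eapply Rle_trans; [apply fejer_count|]. apply In_zbox in Hn. apply In_zbox in Hl.
      rewrite INR_IZR_INZ, <- mult_IZR. apply IZR_le. lia.
  - assert (Hne : RtoC (INR m) <> RtoC 0) by (apply RtoC_neq; lra).
    rewrite (csum_ext (zbox N) (fun n => csum (zbox N) (fun l => f n * g l * zeta ((n + l) * x) * (RtoC (INR m) - mu (n + l)%Z))%C) (fun n => RtoC (INR m) * csum (zbox N) (fun l => f n * g l * zeta ((n + l) * x))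
      + - (1) * csum (zbox N) (fun l => f n * g l * zeta ((n + l) * x) * mu (n + l)%Z))%C).
    + rewrite csum_plus, !csum_scal. field; auto.
    + intros n _. rewrite <- !csum_scal, <- csum_plus. apply csum_ext. intros; ring.
Qed.

Lemma fejer_le m F c :
  (0 < m)%nat ->
  (forall k, (Z.abs k < Z.of_nat m)%Z -> Cmod (hat F k) <= c) ->
  gnorm (fejer m F) <= INR M * (INR m * c).
Proof.
  intros Hm Hc. assert (Hm' : 0 < INR m) by (apply lt_0_INR; lia).
  apply gnorm_const. intros x. unfold fejer.
  rewrite Cmod_div by (apply RtoC_neq; lra). rewrite Cmod_R, Rabs_pos_eq by lra.
  apply Rmult_le_reg_r with (INR m); auto. unfold Rdiv. rewrite Rmult_assoc, Rinv_l, Rmult_1_r by lra.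
  eapply Rle_trans; [apply Cmod_csum|].
  apply Rle_trans with (rsum (seq 0 m) (fun _ => INR m * c)).
  - apply rsum_le. intros a Ha. apply in_seq in Ha. eapply Rle_trans; [apply Cmod_csum|].
    eapply Rle_trans; [apply rsum_le with (g := fun _ => c)|].
    + intros b Hb. apply in_seq in Hb. rewrite Cmod_mult, zeta_unit, Rmult_1_r. apply Hc. lia.
    + rewrite rsum_const, length_seq. lra.
  - rewrite rsum_const, length_seq. lra.
Qed.

Lemma fejer_minus m F G x : fejer m (fun x => F x - G x)%C x = (fejer m F x - fejer m G x)%C.
Proof.
  assert (H : forall k, hat (fun x => F x - G x)%C k = (hat F k + - (1) * hat G k)%C).
  { intros k. unfold hat.
    rewrite (gsum_ext _ (fun x => F x * zeta (- k * x) + - (1) * (G x * zeta (- k * x)))%C)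
      by (intros; ring).
    unfold gsum. rewrite csum_plus, csum_scal. field. apply INR_M_neq. }
  unfold fejer. unfold Cdiv.
  rewrite (csum_ext _ _ (fun a => csum (seq 0 m) (fun b =>
     hat F (Z.of_nat a - Z.of_nat b) * zeta ((Z.of_nat a - Z.of_nat b) * x)) +
     - (1) * csum (seq 0 m) (fun b =>
     hat G (Z.of_nat a - Z.of_nat b) * zeta ((Z.of_nat a - Z.of_nat b) * x)))%C).
  - rewrite csum_plus, csum_scal. ring.
  - intros a _. rewrite <- csum_scal, <- csum_plus. apply csum_ext. intros b _. rewrite H. ring.
Qed.
End Grid.

(** * Uniqueness of Fourier coefficients on refining grids *)

Definition rest (N : nat) (f : Z -> C) (n : Z) : C :=
  if zmem n (zbox N) then RtoC 0 else f n.

Definition grid_char (M : nat) (k : Z) : C := expi (2 * PI * (IZR k / INR M)).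

Lemma grid_char_add M a b : grid_char M (a + b) = (grid_char M a * grid_char M b)%C.
Proof. unfold grid_char. rewrite <- expi_plus. f_equal. rewrite plus_IZR. unfold Rdiv. ring. Qed.

Lemma grid_char_unit M a : Cmod (grid_char M a) = 1.
Proof. apply Cmod_expi. Qed.

Lemma grid_char_M M : (0 < M)%nat -> grid_char M (Z.of_nat M) = RtoC 1.
Proof.
  intros HM. unfold grid_char. rewrite <- INR_IZR_INZ.
  replace (INR M / INR M) with 1 by (field; apply not_0_INR; lia). apply expi_2PI.
Qed.

Lemma grid_char_ne1 M k : (0 < Z.abs k < Z.of_nat M)%Z -> grid_char M k <> RtoC 1.
Proof.
  intros Hk H. apply expi_eq_1 in H as [j Hj].
  assert (HM : INR M <> 0) by (apply not_0_INR; lia).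
  assert (E : IZR k = IZR (j * Z.of_nat M)).
  { rewrite mult_IZR, <- INR_IZR_INZ, <- Hj. field; auto. }
  apply eq_IZR in E. subst k. rewrite Z.abs_mul, (Z.abs_eq (Z.of_nat M)) in Hk by lia.
  destruct (Z.eq_dec (Z.abs j) 0) as [E0|E0]; [rewrite E0 in Hk; lia|].
  assert (1 <= Z.abs j)%Z by lia. nia.
Qed.

Lemma l2_tail f : l2 f -> forall eta, 0 < eta ->
  exists K, forall N, (K <= N)%nat -> zsum_le (fun n => Cmod (rest N f n) ^ 2) eta.
Proof.
  intros [B HB] eta He.
  destruct (zsum_tail_indicator _ _ (fun n => pow2_ge_0 (Cmod (f n))) HB eta He) as [K HK].
  exists K. intros N HN. eapply zsum_le_mono; [|exact HK]. intros n. cbv beta.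
  unfold rest, zmem. destruct (in_dec Z.eq_dec n (zbox N)) as [i|i];
    destruct (in_dec Z.eq_dec n (zbox K)) as [j|j].
  - rewrite Cmod_0. simpl; lra.
  - rewrite Cmod_0. simpl. assert (H := pow2_ge_0 (Cmod (f n))). simpl in H. lra.
  - exfalso. apply i. apply (incl_zbox_le K N HN). exact j.
  - lra.
Qed.

Lemma dft_rest (zeta : Z -> C) N0 N f x :
  (N0 <= N)%nat -> dft zeta N f x = (dft zeta N0 f x + dft zeta N (rest N0 f) x)%C.
Proof.
  intros HN. unfold dft.
  destruct (NoDup_incl_split Z.eq_dec _ _ (NoDup_zbox N0) (NoDup_zbox N) (incl_zbox_le _ _ HN))
    as (k & P & _ & D).
  rewrite !(csum_perm _ _ _ P), !csum_app.
  rewrite (csum_zero (zbox N0) (fun n => rest N0 f n * zeta (n * x)%Z)%C).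
  - rewrite (csum_ext k (fun n => rest N0 f n * zeta (n * x)%Z)%C (fun n => f n * zeta (n * x)%Z)%C); [ring|].
    intros n Hn. unfold rest, zmem. destruct (in_dec Z.eq_dec n (zbox N0)) as [i|i]; auto.
    exfalso. exact (D n Hn i).
  - intros n Hn. unfold rest, zmem. destruct (in_dec Z.eq_dec n (zbox N0)) as [i|i]; [ring|tauto].
Qed.

Lemma dft_trunc zeta N0 N f x : (N0 <= N)%nat -> dft zeta N (trunc N0 f) x = dft zeta N0 f x.
Proof.
  intros HN. rewrite (dft_rest zeta N0 N (trunc N0 f) x HN).
  replace (dft zeta N (rest N0 (trunc N0 f)) x) with (RtoC 0).
  - rewrite Cplus_0_r. unfold dft. apply csum_ext. intros n Hn. unfold trunc.
    apply zmem_In in Hn. rewrite Hn. reflexivity.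
  - symmetry. apply csum_zero. intros n _. unfold rest, trunc.
    destruct (zmem n (zbox N0)); ring.
Qed.

(** The difference of the two products is (tail of f) g_N + (tail of g) f_N0: each summand has one
    factor small and the other bounded in l^2, uniformly in the grid. *)
Lemma dft_product_cauchy f g :
  l2 f -> l2 g -> forall eps, 0 < eps ->
  exists K, forall N0 N M, (K <= N0)%nat -> (N0 <= N)%nat -> (2 * N < M)%nat ->
  gnorm M (fun x => dft (grid_char M) N f x * dft (grid_char M) N g x -
     dft (grid_char M) N0 f x * dft (grid_char M) N0 g x)%C <= INR M * eps.
Proof.
  intros Hf Hg eps Heps.
  assert (Hf' := Hf). assert (Hg' := Hg).
  destruct Hf' as [B HB]. destruct Hg' as [B' HB'].
  assert (B0 : 0 <= B) by (apply (HB nil); constructor).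
  assert (B0' : 0 <= B') by (apply (HB' nil); constructor).
  (* Makes b / tau <= eps / 2 for every bound b up to B + B'; the tails are then taken below eps /
     (2 tau). *)
  set (tau := 2 * (B + B') / eps + 1).
  assert (Q0 : 0 <= 2 * (B + B') / eps) by (apply Rdiv_le_0_compat; lra).
  assert (Ht : 0 < tau) by (unfold tau; lra).
  assert (Hq : forall b, 0 <= b <= B + B' -> b / tau <= eps / 2).
  { intros b Hb. apply Rmult_le_reg_r with tau; auto. unfold Rdiv. rewrite Rmult_assoc, Rinv_l by lra.
    unfold tau. replace (eps * / 2 * (2 * (B + B') / eps + 1)) with (B + B' + eps / 2) by (field; lra).
    lra. }
  assert (He : 0 < eps / (2 * tau)) by (apply Rdiv_lt_0_compat; lra).
  destruct (l2_tail f Hf _ He) as [K1 H1]. destruct (l2_tail g Hg _ He) as [K2 H2].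
  exists (max K1 K2). intros N0 N M HN0 HN HM.
  set (z := grid_char M).
  assert (HM2 : (2 * Z.of_nat N < Z.of_nat M)%Z) by lia.
  rewrite (gnorm_ext M _ (fun x => dft z N (rest N0 f) x * dft z N g x +
     dft z N (rest N0 g) x * dft z N (trunc N0 f) x)%C).
  2:{ intros x. rewrite (dft_rest z N0 N f x HN), (dft_rest z N0 N g x HN), dft_trunc by auto. ring. }
  assert (Gz : forall g' b, zsum_le (fun n => Cmod (g' n) ^ 2) b -> 0 <= b <= B + B' -> forall f',
     zsum_le (fun n => Cmod (f' n) ^ 2) (eps / (2 * tau)) ->
     gnorm M (fun x => dft z N f' x * dft z N g' x)%C <= INR M * (eps / 2)).
  { intros g' b Hb Hbb f' Hf'.
    eapply Rle_trans; [apply (gnorm_dft_mul M z (grid_char_add M) (grid_char_unit M)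
      (grid_char_M M ltac:(lia)) (grid_char_ne1 M) N f' g' _ _ tau HM2 Ht Hf' Hb)|].
    apply Rmult_le_compat_l; [apply pos_INR|].
    replace (tau * (eps / (2 * tau))) with (eps / 2) by (field; lra).
    specialize (Hq b Hbb). lra. }
  eapply Rle_trans; [apply gnorm_triangle|].
  assert (G1 := Gz g B' HB' ltac:(lra) _ (H1 N0 ltac:(lia))).
  assert (T : zsum_le (fun n => Cmod (trunc N0 f n) ^ 2) B).
  { eapply zsum_le_mono; [|exact HB]. intros n. cbv beta. unfold trunc.
    destruct (zmem n (zbox N0)); [lra|]. rewrite Cmod_0.
    assert (H := pow2_ge_0 (Cmod (f n))). simpl in *; lra. }
  assert (G2 := Gz _ B T ltac:(lra) _ (H2 N0 ltac:(lia))). lra.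
Qed.

Lemma dft_hat N M f g k :
  (2 * Z.of_nat N + Z.abs k < Z.of_nat M)%Z ->
  hat M (grid_char M) (fun x => dft (grid_char M) N f x * dft (grid_char M) N g x)%C k = tconv N f g k.
Proof.
  intros Hk. unfold hat.
  rewrite (dft_coef M (grid_char M) (grid_char_add M) (grid_char_unit M) (grid_char_M M ltac:(lia))
     (grid_char_ne1 M) N f g k Hk).
  field. apply INR_M_neq. lia.
Qed.

Lemma hat_minus M (zeta : Z -> C) F G k : (0 < M)%nat ->
  hat M zeta (fun x => F x - G x)%C k = (hat M zeta F k - hat M zeta G k)%C.
Proof.
  intros HM. unfold hat.
  rewrite (gsum_ext M _ (fun x => F x * zeta (- k * x)%Z + - (1) * (G x * zeta (- k * x)%Z))%C)
    by (intros; ring).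
  unfold gsum. rewrite csum_plus, csum_scal. field. apply INR_M_neq; auto.
Qed.

Lemma tconv_diff_small f g f' g' (l : list Z) :
  l2 f -> l2 g -> l2 f' -> l2 g' -> (forall k, conv f g k = conv f' g' k) ->
  forall eps, 0 < eps -> exists N1, forall N k, (N1 <= N)%nat -> In k l ->
  Cmod (tconv N f g k - tconv N f' g' k)%C <= eps.
Proof.
  intros Hf Hg Hf' Hg' E eps Heps. induction l as [|k0 l [N1 IH]].
  - exists 0%nat. intros N k _ [].
  - destruct (tconv_cvg f g k0 Hf Hg (eps / 2)) as [N2 H2]; [lra|].
    destruct (tconv_cvg f' g' k0 Hf' Hg' (eps / 2)) as [N3 H3]; [lra|].
    exists (N1 + N2 + N3)%nat. intros N k HN [<-|Hk]; [|apply IH; auto; lia].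
    specialize (H2 N ltac:(lia)). specialize (H3 N ltac:(lia)). rewrite <- E in H3.
    replace (tconv N f g k0 - tconv N f' g' k0)%C with
      ((tconv N f g k0 - conv f g k0) + - (tconv N f' g' k0 - conv f g k0))%C by ring.
    eapply Rle_trans; [apply Cmod_triangle|]. rewrite Cmod_opp. lra.
Qed.

(* Uniqueness of Fourier coefficients for L^1 functions that are differences of products of L^2
   functions: if all coefficients vanish, so does the L^1 norm, measured on finer and finer grids. *)
Lemma gnorm_small_of_conv_eq f g f' g' :
  l2 f -> l2 g -> l2 f' -> l2 g' -> (forall k, conv f g k = conv f' g' k) ->
  forall eps, 0 < eps -> exists N1, forall N M, (N1 <= N)%nat -> (4 * N < M)%nat ->
  gnorm M (fun x => dft (grid_char M) N f x * dft (grid_char M) N g x -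
     dft (grid_char M) N f' x * dft (grid_char M) N g' x)%C <= INR M * eps.
Proof.
  intros Hf Hg Hf' Hg' E eps Heps.
  destruct (dft_product_cauchy f g Hf Hg (eps / 8)) as [K1 H1]; [lra|].
  destruct (dft_product_cauchy f' g' Hf' Hg' (eps / 8)) as [K2 H2]; [lra|].
  (* The order of choices matters: N0 from the Cauchy property, then m such that Fejer means
     reproduce the fixed polynomials of level N0, then N such that the finitely many coefficients
     below m are small. *)
  set (N0 := max K1 K2).
  set (A := rsum (zbox N0) (fun n => rsum (zbox N0) (fun l => Cmod (f n) * Cmod (g l) * (2 * INR N0)))
    + rsum (zbox N0) (fun n => rsum (zbox N0) (fun l => Cmod (f' n) * Cmod (g' l) * (2 * INR N0)))).
  destruct (INR_unbounded (4 * A / eps)) as [m0 Hm0].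
  set (m := S m0).
  assert (Hm : 0 < INR m) by (apply lt_0_INR; unfold m; lia).
  assert (HA : A / INR m <= eps / 4).
  { apply Rmult_le_reg_r with (INR m); auto. unfold Rdiv. rewrite Rmult_assoc, Rinv_l by lra.
    assert (4 * A / eps <= INR m) by (unfold m; rewrite S_INR; lra).
    apply Rmult_le_compat_l with (r := eps / 4) in H; [|lra].
    replace (eps / 4 * (4 * A / eps)) with A in H by (field; lra). lra. }
  destruct (tconv_diff_small f g f' g' (zbox m) Hf Hg Hf' Hg' E (eps / (4 * INR m))) as [N2 HN2];
    [apply Rdiv_lt_0_compat; lra|].
  exists (N0 + m + N2)%nat. intros N M HN HM.
  set (z := grid_char M).
  assert (Za := grid_char_add M). assert (Zu := grid_char_unit M).
  assert (ZM := grid_char_M M ltac:(lia)). assert (Zn := grid_char_ne1 M).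
  set (H := fun n x => (dft z n f x * dft z n g x - dft z n f' x * dft z n g' x)%C).
  assert (S1 : gnorm M (fun x => H N x - H N0 x)%C <= INR M * (eps / 4)).
  { rewrite (gnorm_ext M _ (fun x => (dft z N f x * dft z N g x - dft z N0 f x * dft z N0 g x) +
      - (dft z N f' x * dft z N g' x - dft z N0 f' x * dft z N0 g' x))%C) by (intros; unfold H; ring).
    eapply Rle_trans; [apply gnorm_triangle|].
    assert (T1 := H1 N0 N M ltac:(lia) ltac:(lia) ltac:(lia)).
    assert (T2 := H2 N0 N M ltac:(lia) ltac:(lia) ltac:(lia)).
    fold z in T1, T2.
    assert (T3 : gnorm M (fun x => - (dft z N f' x * dft z N g' x - dft z N0 f' x * dft z N0 g' x))%C
        = gnorm M (fun x => dft z N f' x * dft z N g' x - dft z N0 f' x * dft z N0 g' x)%C)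
      by (apply rsum_ext; intros; apply Cmod_opp).
    rewrite T3. lra. }
  assert (S2 : gnorm M (fun x => H N0 x - fejer M z m (H N0) x)%C <= INR M * (eps / 4)).
  { apply gnorm_const. intros x. unfold H. rewrite (fejer_minus M z ltac:(lia) m).
    set (F := (dft z N0 f x * dft z N0 g x)%C). set (F' := (dft z N0 f' x * dft z N0 g' x)%C).
    replace (F - F' - (fejer M z m (fun x => dft z N0 f x * dft z N0 g x) x -
       fejer M z m (fun x => dft z N0 f' x * dft z N0 g' x) x))%C with ((F - fejer M z m (fun x => dft z N0 f x * dft z N0 g x) x) +
      - (F' - fejer M z m (fun x => dft z N0 f' x * dft z N0 g' x) x))%C by ring.
    eapply Rle_trans; [apply Cmod_triangle|]. rewrite Cmod_opp.
    eapply Rle_trans; [|exact HA]. unfold A, Rdiv. rewrite Rmult_plus_distr_r.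
    apply Rplus_le_compat; apply fejer_dft_mul; auto; unfold m in *; lia. }
  assert (S3 : gnorm M (fejer M z m (fun x => H N0 x - H N x)%C) <= INR M * (eps / 4)).
  { eapply Rle_trans; [apply (fejer_contraction M z Za Zu ZM Zn ltac:(lia) m); unfold m in *; lia|].
    eapply Rle_trans; [|exact S1]. right. apply rsum_ext. intros x _.
    rewrite <- Cmod_opp. f_equal. ring. }
  assert (S4 : gnorm M (fejer M z m (H N)) <= INR M * (eps / 4)).
  { eapply Rle_trans; [apply (fejer_le M z Zu ltac:(lia) m (H N) (eps / (4 * INR m)))|].
    - unfold m; lia.
    - intros k Hk. unfold H. rewrite hat_minus by lia. unfold z. rewrite !dft_hat by lia.
      apply HN2; [lia|]. apply In_zbox. lia.
    - right. field. lra. }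
  rewrite (gnorm_ext M _ (fun x => (H N x - H N0 x) + ((H N0 x - fejer M z m (H N0) x) +
     (fejer M z m (fun x => H N0 x - H N x) x + fejer M z m (H N) x)))%C).
  2:{ intros x. rewrite (fejer_minus M z ltac:(lia) m). unfold H. ring. }
  eapply Rle_trans; [apply gnorm_triangle|].
  eapply Rle_trans; [apply Rplus_le_compat_l, gnorm_triangle|].
  eapply Rle_trans; [apply Rplus_le_compat_l, Rplus_le_compat_l, gnorm_triangle|]. lra.
Qed.

(** From |ad - bc|^2 = |a conj(c) - b conj(d)|^2 - (|a|^2 - |b|^2)(|c|^2 - |d|^2). The bound is made
    linear, because only the L^1 norms of the three forms are known to be small. *)
Lemma lagrange_bound (a b c d : C) :
  Cmod (a * d - b * c)%C <= Cmod (a * Cconj c - b * Cconj d)%C +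
    (Cmod (a * Cconj a - b * Cconj b)%C + Cmod (c * Cconj c - d * Cconj d)%C) / 2.
Proof.
  set (J := Cmod (a * Cconj c - b * Cconj d)%C).
  set (t := Cmod (a * Cconj a - b * Cconj b)%C). set (t' := Cmod (c * Cconj c - d * Cconj d)%C).
  assert (HJ : 0 <= J) by apply Cmod_ge_0. assert (Ht : 0 <= t) by apply Cmod_ge_0.
  assert (Ht' : 0 <= t') by apply Cmod_ge_0.
  apply Rsqr_incr_0; [|apply Cmod_ge_0|lra]. rewrite !Rsqr_pow2.
  assert (E : RtoC (Cmod (a * d - b * c)%C ^ 2) =
    ((a * Cconj c - b * Cconj d) * Cconj (a * Cconj c - b * Cconj d) -
     (a * Cconj a - b * Cconj b) * (c * Cconj c - d * Cconj d))%C).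
  { rewrite Cmod2_conj, !Cminus_conj, !Cmult_conj, !Cconj_conj. ring. }
  rewrite <- Cmod2_conj in E. fold J in E.
  assert (L : Cmod (a * d - b * c)%C ^ 2 <= J ^ 2 + t * t').
  { assert (X : Cmod (RtoC (Cmod (a * d - b * c)%C ^ 2)) <= J ^ 2 + t * t').
    - rewrite E. unfold Cminus at 1. eapply Rle_trans; [apply Cmod_triangle|].
      rewrite Cmod_opp, Cmod_mult, Cmod_R, Rabs_pos_eq by apply pow2_ge_0. unfold t, t'. lra.
    - rewrite Cmod_R, Rabs_pos_eq in X by apply pow2_ge_0. exact X. }
  assert (0 <= (t - t') ^ 2) by apply pow2_ge_0. nra.
Qed.

(* Lagrange's identity turns the vanishing of the three Hermitian forms into that of the determinant. *)
Lemma conv_det_0 p r p' r' :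
  l2 p -> l2 r -> l2 p' -> l2 r' ->
  (forall k, conv p (bar p) k = conv r (bar r) k) ->
  (forall k, conv p' (bar p') k = conv r' (bar r') k) ->
  (forall k, conv p (bar p') k = conv r (bar r') k) ->
  forall k, conv p r' k = conv r p' k.
Proof.
  intros Lp Lr Lp' Lr' T T' J k.
  assert (Z0 : (conv p r' k - conv r p' k)%C = RtoC 0);
    [|transitivity (conv p r' k - conv r p' k + conv r p' k)%C; [ring|rewrite Z0; ring]].
  apply Cmod_small. intros eps Heps.
  destruct (gnorm_small_of_conv_eq _ _ _ _ Lp (l2_bar _ Lp) Lr (l2_bar _ Lr) T (eps / 4)) as [N1 H1]; [lra|].
  destruct (gnorm_small_of_conv_eq _ _ _ _ Lp' (l2_bar _ Lp') Lr' (l2_bar _ Lr') T' (eps / 4)) as [N2 H2]; [lra|].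
  destruct (gnorm_small_of_conv_eq _ _ _ _ Lp (l2_bar _ Lp') Lr (l2_bar _ Lr') J (eps / 4)) as [N3 H3]; [lra|].
  destruct (tconv_cvg p r' k Lp Lr' (eps / 4)) as [N4 H4]; [lra|].
  destruct (tconv_cvg r p' k Lr Lp' (eps / 4)) as [N5 H5]; [lra|].
  (* M exceeds 4 N for the L^1 estimates and 2 N + |k| for the exact evaluation of coefficient k. *)
  set (N := (N1 + N2 + N3 + N4 + N5)%nat). set (M := (4 * N + Z.abs_nat k + 1)%nat).
  specialize (H1 N M ltac:(lia) ltac:(lia)). specialize (H2 N M ltac:(lia) ltac:(lia)).
  specialize (H3 N M ltac:(lia) ltac:(lia)). specialize (H4 N ltac:(lia)). specialize (H5 N ltac:(lia)).
  set (z := grid_char M) in *.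
  assert (Za := grid_char_add M). assert (Zu := grid_char_unit M). fold z in Za, Zu.
  assert (HM : 0 < INR M) by (apply lt_0_INR; lia).
  set (D := fun x => (dft z N p x * dft z N r' x - dft z N r x * dft z N p' x)%C).
  assert (GD : gnorm M D <= INR M * (eps / 2)).
  { unfold gnorm in *.
    apply Rle_trans with (rsum (seq 0 M) (fun x =>
      Cmod (dft z N p (Z.of_nat x) * dft z N (bar p') (Z.of_nat x) - dft z N r (Z.of_nat x) * dft z N (bar r') (Z.of_nat x))%C
      + (/ 2 * Cmod (dft z N p (Z.of_nat x) * dft z N (bar p) (Z.of_nat x) - dft z N r (Z.of_nat x) * dft z N (bar r) (Z.of_nat x))%C
      + / 2 * Cmod (dft z N p' (Z.of_nat x) * dft z N (bar p') (Z.of_nat x) - dft z N r' (Z.of_nat x) * dft z N (bar r') (Z.of_nat x))%C))).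
    - apply rsum_le. intros x _. unfold D.
      assert (X := lagrange_bound (dft z N p (Z.of_nat x)) (dft z N r (Z.of_nat x))
        (dft z N p' (Z.of_nat x)) (dft z N r' (Z.of_nat x))).
      rewrite !(conj_dft z Za Zu) in X. lra.
    - rewrite !rsum_plus, !rsum_scal. lra. }
  assert (HD : Cmod (hat M z D k) <= eps / 2).
  { eapply Rle_trans; [apply (hat_le M z Zu ltac:(lia))|].
    apply Rmult_le_reg_r with (INR M); auto. unfold Rdiv at 1. rewrite Rmult_assoc, Rinv_l by lra. lra. }
  unfold D in HD. rewrite hat_minus in HD by lia. unfold z in HD. rewrite !dft_hat in HD by lia.
  replace (conv p r' k - conv r p' k)%C with ((tconv N p r' k - tconv N r p' k) +
    (- (tconv N p r' k - conv p r' k) + (tconv N r p' k - conv r p' k)))%C by ring.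
  eapply Rle_trans; [apply Cmod_triangle|].
  eapply Rle_trans; [apply Rplus_le_compat_l, Cmod_triangle|]. rewrite Cmod_opp. lra.
Qed.

(** * Parallel solutions *)

Lemma contraction_0 (q : R) (f : nat -> C) B :
  0 <= q < 1 -> (forall n, Cmod (f n) <= q * Cmod (f (S n))) -> (forall n, Cmod (f n) <= B) ->
  f 0%nat = RtoC 0.
Proof.
  intros Hq H HB.
  assert (B0 : 0 <= B) by (eapply Rle_trans; [apply Cmod_ge_0|apply (HB 0%nat)]).
  assert (Hn : forall n, Cmod (f 0%nat) <= q ^ n * Cmod (f n)).
  { induction n as [|n IH]; [simpl; lra|]. eapply Rle_trans; [apply IH|].
    simpl. rewrite (Rmult_comm q), Rmult_assoc. apply Rmult_le_compat_l; [apply pow_le; lra|auto]. }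
  apply Cmod_small. intros eps Heps.
  destruct (pow_lt_1_zero q ltac:(rewrite Rabs_pos_eq; lra) (eps / (B + 1))) as [N HN];
    [apply Rdiv_lt_0_compat; lra|].
  specialize (HN N (le_n _)). rewrite Rabs_pos_eq in HN by (apply pow_le; lra).
  eapply Rle_trans; [apply (Hn N)|]. apply Rle_trans with (eps / (B + 1) * B).
  - apply Rmult_le_compat; auto using Cmod_ge_0; [apply pow_le|]; lra.
  - assert (B / (B + 1) <= 1).
    { apply Rmult_le_reg_r with (B + 1); [lra|]. unfold Rdiv. rewrite Rmult_assoc, Rinv_l by lra. lra. }
    replace (eps / (B + 1) * B) with (eps * (B / (B + 1))) by (field; lra). nra.
Qed.

(* The symbol [opD] has no zero on the unit circle. *)
Lemma opD_injective lam lp f B :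
  0 < lam -> 0 < lp -> lam * lam + lp * lp = 1 ->
  (forall k, Cmod (f k) <= B) -> (forall k, opD lam lp f k = RtoC 0) -> forall k, f k = RtoC 0.
Proof.
  intros Hl Hp Hlp HB H k.
  set (s := (1 - lp) / lam).
  assert (Hs : 0 < s < 1) by (apply (s_bounds lam lp); auto).
  assert (E := half_lam_s lam lp Hl Hp Hlp). fold s in E.
  set (t := (- (Ci * RtoC s))%C).
  assert (Ht : Cmod t = s).
  { unfold t. rewrite Cmod_opp, Cmod_mult, Cmod_Ci, Cmod_R, Rabs_pos_eq; lra. }
  (* The symbol is a multiple of (1 + t X)(1 + t X^-1), and [g] is the image of [f] under the second
     factor. A nonzero kernel element of either factor grows geometrically in one direction, forward
     for [g] and backward for [f], which contradicts boundedness. *)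
  set (g := fun j => (f j + t * f (j - 1)%Z)%C).
  assert (Hg : forall j, (g j + t * g (j + 1)%Z)%C = RtoC 0).
  { intros j. unfold g. replace (j + 1 - 1)%Z with j by lia.
    assert (X : (RtoC (lam / 2) * (f j + t * f (j - 1)%Z + t * (f (j + 1)%Z + t * f j)) =
        t * opD lam lp f j)%C).
    { unfold opD, laurent.
      assert (E' : (RtoC (lam / 2) * (1 + t * t) = t * (Ci * RtoC lp))%C).
      { transitivity (RtoC (lam / 2 * (1 + - (s * s)))).
        - rewrite RtoC_mult, RtoC_plus, RtoC_opp, RtoC_mult. unfold t. ring [Ci2].
        - rewrite E, RtoC_mult. unfold t. ring [Ci2]. }
      transitivity (RtoC (lam / 2) * (1 + t * t) * f j + RtoC (lam / 2) * t * (f (j - 1)%Z + f (j + 1)%Z))%C;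
        [ring|rewrite E'; ring]. }
    rewrite H in X.
    assert (RtoC (lam / 2) <> RtoC 0) by (apply RtoC_neq; lra).
    set (y := (f j + t * f (j - 1)%Z + t * (f (j + 1)%Z + t * f j))%C) in *.
    replace y with (RtoC (lam / 2) * y / RtoC (lam / 2))%C by (field; auto).
    rewrite X. field; auto. }
  assert (G0 : forall j, g j = RtoC 0).
  { intros j. replace j with (j + Z.of_nat 0)%Z by lia.
    apply (contraction_0 s (fun n => g (j + Z.of_nat n)%Z) (B + s * B)).
    - lra.
    - intros n. specialize (Hg (j + Z.of_nat n)%Z).
      replace (j + Z.of_nat (S n))%Z with (j + Z.of_nat n + 1)%Z by lia.
      set (u := g (j + Z.of_nat n)%Z) in *. set (v := g (j + Z.of_nat n + 1)%Z) in *.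
      replace u with ((u + t * v) + - (t * v))%C by ring. rewrite Hg, Cplus_0_l, Cmod_opp, Cmod_mult, Ht. lra.
    - intros n. unfold g. eapply Rle_trans; [apply Cmod_triangle|]. rewrite Cmod_mult, Ht.
      apply Rplus_le_compat; auto. apply Rmult_le_compat_l; auto. lra. }
  replace k with (k - Z.of_nat 0)%Z by lia.
  apply (contraction_0 s (fun n => f (k - Z.of_nat n)%Z) B); auto; [lra|].
  intros n. assert (G := G0 (k - Z.of_nat n)%Z). unfold g in G.
  replace (k - Z.of_nat (S n))%Z with (k - Z.of_nat n - 1)%Z by lia.
  set (u := f (k - Z.of_nat n)%Z) in *. set (v := f (k - Z.of_nat n - 1)%Z) in *.
  replace u with ((u + t * v) + - (t * v))%C by ring. rewrite G, Cplus_0_l, Cmod_opp, Cmod_mult, Ht. lra.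
Qed.

(** Dominated convergence: the bounded weights [ga J] tend pointwise to the indicator of [n0]. *)
Lemma zsum_dominated_0 (be : Z -> C) (ga : nat -> Z -> C) n0 :
  summable be -> (forall J n, Cmod (ga J n) <= 2) ->
  (forall n eps, 0 < eps -> exists J0, forall J, (J0 <= J)%nat ->
     Cmod (ga J n - if Z.eq_dec n n0 then RtoC 1 else RtoC 0)%C <= eps) ->
  (forall J, is_zsum (fun n => be n * ga J n)%C (RtoC 0)) -> be n0 = RtoC 0.
Proof.
  intros [B HB] H2 Hlim H0.
  assert (B0 : 0 <= B) by (apply (HB nil); constructor).
  assert (Hl : forall l eps, 0 < eps -> exists J0, forall J n, (J0 <= J)%nat -> In n l ->
     Cmod (ga J n - if Z.eq_dec n n0 then RtoC 1 else RtoC 0)%C <= eps).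
  { intros l eps He. induction l as [|a l [J1 IH]]; [exists 0%nat; intros J n _ []|].
    destruct (Hlim a eps He) as [J2 HJ]. exists (J1 + J2)%nat.
    intros J n HJn [<-|Hn]; [apply HJ; lia|apply IH; auto; lia]. }
  apply Cmod_small. intros eps Heps.
  (* B e for the weights inside the box, 2 e for the tail, e for the distance of the finite sum from
     its limit 0. *)
  set (e := eps / (B + 3)). assert (He : 0 < e) by (apply Rdiv_lt_0_compat; lra).
  destruct (zsum_tail _ B (fun n => Cmod_ge_0 (be n)) HB e He) as [K1 HK1].
  set (K := max K1 (Z.abs_nat n0)).
  destruct (Hl (zbox K) e He) as [J HJ]. specialize (HJ J).
  destruct (H0 J e He) as [K2 HK2].
  set (N := max K K2).
  assert (Inc : incl (zbox K) (zbox N)) by (apply incl_zbox_le; lia).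
  specialize (HK2 (zbox N) (NoDup_zbox N) (incl_zbox_le K2 N ltac:(lia))).
  destruct (csum_split_tail (fun n => be n * ga J n)%C K (zbox N) (NoDup_zbox N) Inc)
    as (k & Nk & Dk & E).
  rewrite E in HK2.
  assert (T : Cmod (csum k (fun n => be n * ga J n)%C) <= 2 * e).
  { eapply Rle_trans; [apply Cmod_csum|].
    apply Rle_trans with (rsum k (fun n => 2 * Cmod (be n))).
    - apply rsum_le. intros n _. rewrite Cmod_mult, Rmult_comm.
      apply Rmult_le_compat_r; auto using Cmod_ge_0.
    - rewrite rsum_scal. apply Rmult_le_compat_l; [lra|]. apply HK1; auto.
      intros n Hn Hn'. apply (Dk n Hn). apply (incl_zbox_le K1 K ltac:(lia)). auto. }
  assert (S1 : be n0 = csum (zbox K) (fun n => be n * (if Z.eq_dec n n0 then RtoC 1 else RtoC 0))%C).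
  { rewrite (csum_single Z.eq_dec (zbox K) n0).
    - destruct (in_dec _ _ _) as [_|i]; [|exfalso; apply i, In_zbox; lia].
      destruct (Z.eq_dec n0 n0); [ring|congruence].
    - apply NoDup_zbox.
    - intros x _ Hx. destruct (Z.eq_dec x n0); [congruence|ring]. }
  assert (D : Cmod (csum (zbox K) (fun n => be n * ga J n) - be n0)%C <= B * e).
  { rewrite S1.
    replace (csum (zbox K) (fun n => be n * ga J n) -
      csum (zbox K) (fun n => be n * (if Z.eq_dec n n0 then RtoC 1 else RtoC 0)))%C with
      (csum (zbox K) (fun n => be n * (ga J n - (if Z.eq_dec n n0 then RtoC 1 else RtoC 0))))%C.
    - eapply Rle_trans; [apply Cmod_csum|].
      apply Rle_trans with (rsum (zbox K) (fun n => e * Cmod (be n))).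
      + apply rsum_le. intros n Hn. rewrite Cmod_mult, Rmult_comm.
        apply Rmult_le_compat_r; auto using Cmod_ge_0.
      + rewrite rsum_scal, Rmult_comm. apply Rmult_le_compat_r; [lra|]. apply HB, NoDup_zbox.
    - rewrite (csum_ext _ _ (fun n => be n * ga J n + - (1) * (be n *
        (if Z.eq_dec n n0 then RtoC 1 else RtoC 0)))%C) by (intros; ring).
      rewrite csum_plus, csum_scal. ring. }
  set (x := csum (zbox K) (fun n => be n * ga J n)%C) in *. set (y := csum k _) in *.
  replace (be n0) with (- (x - be n0) + ((x + y - 0) + - y))%C by ring.
  eapply Rle_trans; [apply Cmod_triangle|].
  eapply Rle_trans; [apply Rplus_le_compat_l, Cmod_triangle|]. rewrite !Cmod_opp.
  replace eps with (B * e + 3 * e) by (unfold e; field; lra). lra.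
Qed.

Definition mean (J : nat) (u : C) : C := (csum (seq 0 J) (fun j => Cpow u j) / RtoC (INR J))%C.

Lemma mean_le J u : Cmod u = 1 -> (0 < J)%nat -> Cmod (mean J u) <= 1.
Proof.
  intros Hu HJ. assert (HJ' : 0 < INR J) by (apply lt_0_INR; auto).
  unfold mean. rewrite Cmod_div by (apply RtoC_neq; lra). rewrite Cmod_R, Rabs_pos_eq by lra.
  apply Rmult_le_reg_r with (INR J); auto. unfold Rdiv. rewrite Rmult_assoc, Rinv_l by lra.
  eapply Rle_trans; [rewrite Rmult_1_r; apply Cmod_csum|].
  rewrite (rsum_ext _ _ (fun _ => 1)); [rewrite rsum_const, length_seq; lra|].
  intros j _. rewrite Cmod_pow, Hu. apply pow1.
Qed.

Lemma mean_1 J : (0 < J)%nat -> mean J (RtoC 1) = RtoC 1.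
Proof.
  intros HJ. unfold mean. rewrite (csum_ext _ _ (fun _ => RtoC 1)) by (intros; apply Cpow_1_l).
  rewrite csum_RtoC, rsum_const, length_seq, Rmult_1_r. field. apply RtoC_neq, not_0_INR. lia.
Qed.

Lemma mean_cvg_0 u : Cmod u = 1 -> u <> RtoC 1 -> forall eps, 0 < eps ->
  exists J0, forall J, (J0 <= J)%nat -> Cmod (mean J u) <= eps.
Proof.
  intros Hu Hne eps Heps.
  assert (Hd : 0 < Cmod (1 - u)%C).
  { apply Cmod_gt_0. intros E. apply Hne. transitivity (1 - (1 - u))%C; [ring|rewrite E; ring]. }
  destruct (INR_unbounded (2 / (eps * Cmod (1 - u)%C))) as [J0 HJ0].
  exists (S J0). intros J HJ. assert (HJ' : 0 < INR J) by (apply lt_0_INR; lia).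
  assert (HJJ : INR J0 <= INR J) by (apply le_INR; lia).
  unfold mean. rewrite Cmod_div by (apply RtoC_neq; lra). rewrite (Cmod_R (INR J)), Rabs_pos_eq by lra.
  apply Rmult_le_reg_r with (INR J); auto. unfold Rdiv. rewrite Rmult_assoc, Rinv_l, Rmult_1_r by lra.
  apply Rmult_le_reg_l with (Cmod (1 - u)%C); auto. rewrite <- Cmod_mult, geometric_sum.
  apply Rle_trans with 2.
  - eapply Rle_trans; [apply Cmod_triangle|]. rewrite Cmod_1, Cmod_opp, Cmod_pow, Hu, pow1. lra.
  - assert (2 / (eps * Cmod (1 - u)%C) <= INR J) by lra.
    apply Rmult_le_compat_l with (r := eps * Cmod (1 - u)%C) in H; [|nra].
    replace (eps * Cmod (1 - u)%C * (2 / (eps * Cmod (1 - u)%C))) with 2 in H by (field; lra). lra.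
Qed.

(** Bohr means: averaging the relation over j removes every frequency other than 1, and 1 occurs
    only as [u n0]. *)
Lemma bohr_uniqueness (be u v : Z -> C) n0 :
  summable be -> (forall n, Cmod (u n) = 1) -> (forall n, Cmod (v n) = 1) ->
  u n0 = RtoC 1 -> (forall n, n <> n0 -> u n <> RtoC 1) -> (forall n, v n <> RtoC 1) ->
  (forall j, is_zsum (fun n => be n * (Cpow (u n) j - Cpow (v n) j))%C (RtoC 0)) ->
  be n0 = RtoC 0.
Proof.
  intros Hbe Hu Hv Hu0 Hu1 Hv1 H.
  apply (zsum_dominated_0 be (fun J n => mean (S J) (u n) - mean (S J) (v n))%C n0); auto.
  - intros J n. eapply Rle_trans; [apply Cmod_triangle|]. rewrite Cmod_opp.
    assert (A := mean_le (S J) (u n) (Hu n) ltac:(lia)).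
    assert (B := mean_le (S J) (v n) (Hv n) ltac:(lia)). lra.
  - intros n eps Heps.
    destruct (mean_cvg_0 (v n) (Hv n) (Hv1 n) (eps / 2)) as [J1 H1]; [lra|].
    destruct (Z.eq_dec n n0) as [->|Hn].
    + exists J1. intros J HJ. rewrite Hu0, mean_1 by lia.
      replace (1 - mean (S J) (v n0) - 1)%C with (- mean (S J) (v n0))%C by ring.
      rewrite Cmod_opp. specialize (H1 (S J) ltac:(lia)). lra.
    + destruct (mean_cvg_0 (u n) (Hu n) (Hu1 n Hn) (eps / 2)) as [J2 H2]; [lra|].
      exists (J1 + J2)%nat. intros J HJ.
      specialize (H1 (S J) ltac:(lia)). specialize (H2 (S J) ltac:(lia)).
      replace (mean (S J) (u n) - mean (S J) (v n) - 0)%C with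
        (mean (S J) (u n) + - mean (S J) (v n))%C by ring.
      eapply Rle_trans; [apply Cmod_triangle|]. rewrite Cmod_opp. lra.
  - intros J.
    assert (S1 : forall m, is_zsum (fun n => be n * csum (seq 0 m) (fun j => Cpow (u n) j - Cpow (v n) j))%C (RtoC 0)).
    { induction m as [|m IH].
      - eapply is_zsum_ext; [|apply (H 0%nat)]. intros n. cbn [seq csum Cpow]. ring.
      - replace (RtoC 0) with (RtoC 0 + RtoC 0)%C by ring.
        eapply is_zsum_ext; [|apply (is_zsum_plus _ _ _ _ IH (H m))].
        intros n. cbv beta. rewrite csum_seq_S. ring. }
    replace (RtoC 0) with (/ RtoC (INR (S J)) * RtoC 0)%C by ring.
    eapply is_zsum_ext; [|apply (is_zsum_scal _ _ _ (S1 (S J)))].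
    intros n. cbv beta. unfold mean.
    rewrite (csum_ext _ _ (fun j => Cpow (u n) j + - (1) * Cpow (v n) j)%C) by (intros; ring).
    rewrite csum_plus, csum_scal.
    change (csum (seq 0 (S J)) (fun j => Cpow (u n) j)) with (csum (seq 0 (S J)) (Cpow (u n))).
    change (csum (seq 0 (S J)) (fun j => Cpow (v n) j)) with (csum (seq 0 (S J)) (Cpow (v n))).
    field. apply RtoC_neq, not_0_INR. lia.
Qed.

Section Parallel.
Variables (lam lp : R) (w : Z -> C).
Hypothesis lam_pos : 0 < lam.
Hypothesis lp_pos : 0 < lp.
Hypothesis lam_lp : lam * lam + lp * lp = 1.
Hypothesis w_add : forall a b, w (a + b)%Z = (w a * w b)%C.
Hypothesis w_unit : forall a, Cmod (w a) = 1.
Hypothesis w_irr : forall k, k <> 0%Z -> w k <> RtoC 1.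

(** Coefficients of the translate f(x - j Phi). *)
Definition untwist (j : nat) (f : Z -> C) (k : Z) : C := (w (- (Z.of_nat j * k)) * f k)%C.

Lemma Cmod_untwist j f k : Cmod (untwist j f k) = Cmod (f k).
Proof. unfold untwist. rewrite Cmod_mult, w_unit. ring. Qed.

Lemma l2_untwist j f : l2 f -> l2 (untwist j f).
Proof. intros. apply (l2_unimodular f (fun k => w (- (Z.of_nat j * k)))); auto. Qed.

Lemma untwist_step c u v e a1 a2 a3 b1 b2 b3 f p r j :
  l2 f -> l2 p -> l2 r ->
  (forall k, (c * laurent u v e (fun n => w n * p n) k =
    laurent a1 a2 a3 p k + laurent b1 b2 b3 r k)%C) ->
  forall k, (c * laurent u v e (fun n => w n * conv (untwist (S j) f) p n) k =
    laurent a1 a2 a3 (conv (untwist j f) p) k + laurent b1 b2 b3 (conv (untwist j f) r) k)%C.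
Proof.
  intros Lf Lp Lr H k.
  assert (Lw : l2 (fun n => w n * p n)%C) by (apply l2_unimodular; auto).
  rewrite (laurent_ext _ _ _ _ (conv (untwist j f) (fun n => w n * p n)%C)).
  - rewrite <- !conv_laurent_r by auto using l2_untwist.
    rewrite <- conv_scal_r, <- conv_plus_r by auto using l2_laurent, l2_untwist.
    apply conv_ext; auto.
  - intros n. rewrite <- conv_character by auto using l2_untwist.
    apply conv_ext; auto. intros i. unfold untwist.
    replace (- (Z.of_nat j * i))%Z with (i + - (Z.of_nat (S j) * i))%Z by lia.
    rewrite w_add. ring.
Qed.

(** Cancels the denominator d in one step along an orbit. The sequences are convolutions of l^2
    sequences, for which boundedness is what is known. *)
Lemma opD_step (ph ph' : C) j (X X' : Z -> C) (B B' : R) :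
  (forall k, Cmod (X k) <= B) -> (forall k, Cmod (X' k) <= B') ->
  (forall k, Cpow ph' j * (RtoC lam * ph' * opD lam lp (fun n => w n * X n) k) =
             Cpow ph j * (RtoC lam * ph * opD lam lp (fun n => w n * X' n) k))%C ->
  forall k, (Cpow ph' (S j) * X k = Cpow ph (S j) * X' k)%C.
Proof.
  intros HB HB' H k.
  assert (Hl : RtoC lam <> RtoC 0) by (apply RtoC_neq; lra).
  assert (D : forall k, (w k * (Cpow ph' (S j) * X k - Cpow ph (S j) * X' k))%C = RtoC 0).
  { apply (opD_injective lam lp _ (Cmod (Cpow ph' (S j)) * B + Cmod (Cpow ph (S j)) * B')); auto.
    - intros i. rewrite Cmod_mult, w_unit, Rmult_1_l. eapply Rle_trans; [apply Cmod_triangle|].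
      rewrite Cmod_opp, !Cmod_mult.
      apply Rplus_le_compat; apply Rmult_le_compat_l; auto using Cmod_ge_0.
    - intros i. specialize (H i).
      transitivity ((Cpow ph' j * (RtoC lam * ph' * opD lam lp (fun n => w n * X n) i) -
        Cpow ph j * (RtoC lam * ph * opD lam lp (fun n => w n * X' n) i)) / RtoC lam)%C.
      + rewrite !Cpow_S. unfold opD, laurent. field; auto.
      + rewrite H. field; auto. }
  specialize (D k).
  set (x := (Cpow ph' (S j) * X k)%C) in *. set (x' := (Cpow ph (S j) * X' k)%C) in *.
  assert (W := unimodular_conj _ (w_unit k)).
  transitivity (w k * Cconj (w k) * (x - x') + x')%C; [rewrite W; ring|].
  transitivity (Cconj (w k) * (w k * (x - x')) + x')%C; [ring|rewrite D; ring].
Qed.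

Variables (z phi phi' : C) (p m y r p' m' y' r' : Z -> C).
Hypothesis Hz : (z * Cconj z)%C = RtoC 1.
Hypothesis Hphi : Cmod phi = 1.
Hypothesis Hphi' : Cmod phi' = 1.
Hypothesis Hsol : solution lam lp w z phi p m y r.
Hypothesis Hsol' : solution lam lp w z phi' p' m' y' r'.
Hypothesis Hdet : forall k, conv p r' k = conv r p' k.

Let Lp := sol_p _ _ _ _ _ _ _ _ _ Hsol.
Let Lr := sol_r _ _ _ _ _ _ _ _ _ Hsol.
Let Lp' := sol_p _ _ _ _ _ _ _ _ _ Hsol'.
Let Lr' := sol_r _ _ _ _ _ _ _ _ _ Hsol'.

(* The two solutions are proportional at one point of every orbit, hence everywhere on it, up to
   the ratio of their quasi-periods. *)
Lemma parallel_orbit j :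
  (forall k, Cpow phi' j * conv (untwist j p) p' k = Cpow phi j * conv (untwist j p') p k)%C /\
  (forall k, Cpow phi' j * conv (untwist j p) r' k = Cpow phi j * conv (untwist j p') r k)%C.
Proof.
  assert (U0 : forall f k, untwist 0 f k = f k).
  { intros f k. unfold untwist. rewrite Z.mul_0_l. simpl Z.opp. rewrite w_0 by auto. ring. }
  assert (Bd : forall f g i, l2 f -> l2 g -> exists B, forall k, Cmod (conv (untwist i f) g k) <= B).
  { intros f g i Lf Lg. destruct (conv_bound f g Lf Lg) as [B HB]. exists B. intros k.
    apply HB; auto. intros; apply Cmod_untwist. }
  (* Both components enter the induction hypothesis because the transfer matrix mixes them. *)
  induction j as [|j [IH1 IH2]].
  - split; intros k; simpl.
    + rewrite (conv_ext (untwist 0 p) p p' p'), (conv_ext (untwist 0 p') p' p p) by auto.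
      rewrite (conv_comm p p') by auto. reflexivity.
    + rewrite (conv_ext (untwist 0 p) p r' r'), (conv_ext (untwist 0 p') p' r r) by auto.
      rewrite Hdet, (conv_comm r p') by auto. reflexivity.
  - assert (Tp := fun k => solution_transfer_p lam lp w lam_lp z phi p m y r k Hz Hsol).
    assert (Tr := fun k => solution_transfer_r lam lp w lam_lp z phi p m y r k Hz Hsol).
    assert (Tp' := fun k => solution_transfer_p lam lp w lam_lp z phi' p' m' y' r' k Hz Hsol').
    assert (Tr' := fun k => solution_transfer_r lam lp w lam_lp z phi' p' m' y' r' k Hz Hsol').
    split.
    + destruct (Bd p p' (S j) Lp Lp') as [B HB]. destruct (Bd p' p (S j) Lp' Lp) as [B' HB'].
      apply (opD_step phi phi' j _ _ B B' HB HB'). intros k. unfold opD.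
      rewrite (untwist_step _ _ _ _ _ _ _ _ _ _ p p' r' j Lp Lp' Lr' Tp' k).
      rewrite (untwist_step _ _ _ _ _ _ _ _ _ _ p' p r j Lp' Lp Lr Tp k).
      rewrite !Cmult_plus_distr_l, <- !laurent_scal.
      f_equal; apply laurent_ext; auto.
    + destruct (Bd p r' (S j) Lp Lr') as [B HB]. destruct (Bd p' r (S j) Lp' Lr) as [B' HB'].
      apply (opD_step phi phi' j _ _ B B' HB HB'). intros k. unfold opD.
      assert (S1 : forall k, (RtoC lam * phi' * opD lam lp (fun n => w n * r' n) k =
        laurent (Ci * RtoC lp * RtoC (lam / 2)) (- (Ci * RtoC lp * RtoC (lam / 2))) (Cconj z) r' k +
        laurent (- RtoC (lam / 2)) (RtoC (lam / 2)) (Ci * RtoC lp * z) p' k)%C)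
        by (intros; rewrite Cplus_comm; apply Tr').
      assert (S2 : forall k, (RtoC lam * phi * opD lam lp (fun n => w n * r n) k =
        laurent (Ci * RtoC lp * RtoC (lam / 2)) (- (Ci * RtoC lp * RtoC (lam / 2))) (Cconj z) r k +
        laurent (- RtoC (lam / 2)) (RtoC (lam / 2)) (Ci * RtoC lp * z) p k)%C)
        by (intros; rewrite Cplus_comm; apply Tr).
      rewrite (untwist_step _ _ _ _ _ _ _ _ _ _ p r' p' j Lp Lr' Lp' S1 k).
      rewrite (untwist_step _ _ _ _ _ _ _ _ _ _ p' r p j Lp' Lr Lp S2 k).
      rewrite !Cmult_plus_distr_l, <- !laurent_scal.
      f_equal; apply laurent_ext; auto.
Qed.

Hypothesis nonres : forall k, (phi * Cconj phi' * w k)%C <> RtoC 1.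

Lemma parallel_product_0 n0 n1 : (p n0 * p' n1)%C = RtoC 0.
Proof.
  set (k := (n0 + n1)%Z).
  (* Coefficient k of the orbit identity says that the sum of be n ((phi' w(-n))^j - (phi w(n -
     k))^j) vanishes for every j. The factor c^j below rotates the frequency with n = n0 in the
     first family to 1. *)
  set (be := fun n => (p n * p' (k - n)%Z)%C).
  replace (p n0 * p' n1)%C with (be n0) by (unfold be, k; do 2 f_equal; lia).
  set (c := Cconj (phi' * w (- n0)%Z)).
  assert (Hc : Cmod c = 1) by (unfold c; rewrite Cmod_conj, Cmod_mult, Hphi', w_unit; ring).
  assert (Ec : c = (Cconj phi' * w n0)%C).
  { unfold c. rewrite Cmult_conj. f_equal. rewrite <- (w_neg w w_add w_unit). f_equal. lia. }
  assert (Hp' := unimodular_conj _ Hphi').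
  apply (bohr_uniqueness be (fun n => phi' * w (- n)%Z * c)%C (fun n => phi * w (n - k)%Z * c)%C).
  - apply summable_conv; auto.
  - intros n. rewrite !Cmod_mult, Hphi', w_unit, Hc. ring.
  - intros n. rewrite !Cmod_mult, Hphi, w_unit, Hc. ring.
  - unfold c. apply unimodular_conj. rewrite Cmod_mult, Hphi', w_unit. ring.
  - intros n Hn. rewrite Ec.
    replace (phi' * w (- n)%Z * (Cconj phi' * w n0))%C with (phi' * Cconj phi' * (w (- n)%Z * w n0))%C by ring.
    rewrite Hp', <- w_add, Cmult_1_l. apply w_irr. lia.
  - intros n. rewrite Ec.
    replace (phi * w (n - k)%Z * (Cconj phi' * w n0))%C with (phi * Cconj phi' * (w (n - k)%Z * w n0))%C by ring.
    rewrite <- w_add. apply nonres.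
  - intros j. destruct (parallel_orbit j) as [E _]. specialize (E k).
    assert (Z1 := conv_correct (untwist j p) p' k (l2_untwist j p Lp) Lp').
    assert (Z2 := conv_correct p (untwist j p') k Lp (l2_untwist j p' Lp')).
    rewrite (conv_comm p) in Z2 by auto using l2_untwist.
    assert (Z3 := is_zsum_scal _ _ (Cpow c j)
      (is_zsum_plus _ _ _ _ (is_zsum_scal _ _ (Cpow phi' j) Z1)
        (is_zsum_scal _ _ (- Cpow phi j)%C Z2))).
    replace (RtoC 0) with (Cpow c j * (Cpow phi' j * conv (untwist j p) p' k +
       - Cpow phi j * conv (untwist j p') p k))%C by (rewrite E; ring).
    eapply is_zsum_ext; [|exact Z3]. intros n. cbv beta. unfold be, untwist.
    rewrite !Cpow_mult_l, !(zeta_pow w w_add w_unit).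
    replace (- n * Z.of_nat j)%Z with (- (Z.of_nat j * n))%Z by ring.
    replace ((n - k) * Z.of_nat j)%Z with (- (Z.of_nat j * (k - n)))%Z by ring.
    ring.
Qed.
End Parallel.

(** * From eigenvectors to the cocycle equation, and conclusion *)

Lemma l2_half_sums (f : Z -> C) (a b : nat -> R) :
  ex_series a -> ex_series b ->
  (forall k, Cmod (f (Z.of_nat k)) ^ 2 <= a k) ->
  (forall k, Cmod (f (- Z.of_nat k - 1)%Z) ^ 2 <= b k) -> l2 f.
Proof.
  intros [sa Ha] [sb Hb] Fa Fb.
  assert (A0 : forall k, 0 <= a k) by (intros; eapply Rle_trans; [apply pow2_ge_0|apply Fa]).
  assert (B0 : forall k, 0 <= b k) by (intros; eapply Rle_trans; [apply pow2_ge_0|apply Fb]).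
  assert (Inc : forall (u : nat -> R) s, (forall k, 0 <= u k) -> is_series u s ->
            forall n, sum_n u n <= s).
  { intros u s Hu Hs n. apply (is_lim_seq_incr_compare (sum_n u) s Hs).
    intros i. rewrite sum_Sn. unfold plus; simpl. specialize (Hu (S i)). lra. }
  exists (sa + sb). apply zsum_le_zbox; [intros; apply pow2_ge_0|]. intros N.
  apply Rle_trans with (sum_n a N + sum_n b N).
  (* [b k] belongs to the index -k - 1, so the box of radius N contains only the terms with k < N;
     the subtraction expresses this also for N = 0. *)
  - apply Rle_trans with (sum_n a N + (sum_n b N - b N)).
    + induction N as [|N IH].
      * rewrite !sum_O. simpl rsum. specialize (Fa 0%nat). simpl Z.of_nat in Fa. lra.
      * cbn [zbox rsum]. rewrite !sum_Sn. unfold plus; simpl (AbelianMonoid.sort _).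
        assert (Fa' := Fa (S N)). assert (Fb' := Fb N).
        replace (- Z.of_nat N - 1)%Z with (- Z.of_nat (S N))%Z in Fb' by lia.
        cbv [plus AbelianMonoid.plus]. simpl. simpl in IH, Fa', Fb'. lra.
    + specialize (B0 N). lra.
  - apply Rplus_le_compat; apply Inc; auto.
Qed.

Lemma solution_of_eigenvector lam Phi theta z psi :
  0 < lam -> lam * lam + lamp lam * lamp lam = 1 ->
  in_l2 psi ->
  (forall n, Wop lam lam Phi theta psi n = ((z * fst (psi n))%C, (z * snd (psi n))%C)) ->
  let eta := Qop lam Phi theta psi in
  solution lam (lamp lam) (fun n => expi (2 * PI * (IZR n * Phi))) z (expi (2 * PI * theta))
    (fun n => fst (psi n) + Ci * snd (psi n))%C (fun n => fst (psi n) - Ci * snd (psi n))%C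
    (fun n => fst (eta n) + Ci * snd (eta n))%C (fun n => fst (eta n) - Ci * snd (eta n))%C.
Proof.
  intros Hlam Hlp [H1 H2] HW eta.
  set (lp := lamp lam) in *.
  set (w := fun n : Z => expi (2 * PI * (IZR n * Phi))). set (phi := expi (2 * PI * theta)).
  assert (L1 : l2 (fun n => fst (psi n))).
  { apply (l2_half_sums _ _ _ H1 H2); intros; unfold normsq2;
      [assert (X := pow2_ge_0 (Cmod (snd (psi (Z.of_nat k)))))
      |assert (X := pow2_ge_0 (Cmod (snd (psi (- Z.of_nat k - 1)%Z))))]; lra. }
  assert (L2 : l2 (fun n => snd (psi n))).
  { apply (l2_half_sums _ _ _ H1 H2); intros; unfold normsq2;
      [assert (X := pow2_ge_0 (Cmod (fst (psi (Z.of_nat k)))))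
      |assert (X := pow2_ge_0 (Cmod (fst (psi (- Z.of_nat k - 1)%Z))))]; lra. }
  set (p := fun n => (fst (psi n) + Ci * snd (psi n))%C).
  set (m := fun n => (fst (psi n) - Ci * snd (psi n))%C).
  set (y := fun n => (fst (eta n) + Ci * snd (eta n))%C).
  set (r := fun n => (fst (eta n) - Ci * snd (eta n))%C).
  assert (Lp : l2 p) by (apply l2_plus; auto using l2_scal).
  assert (Lm : l2 m).
  { apply l2_ext with (fun n => fst (psi n) + (- Ci) * snd (psi n))%C; [intros; unfold m; ring|].
    apply l2_plus; auto using l2_scal. }
  assert (W1 : forall n, (z * fst (psi n) = RtoC lam * fst (eta (n - 1)%Z) - RtoC lp * snd (eta n))%C)
    by (intros n; assert (E := f_equal fst (HW n)); simpl in E; symmetry; exact E).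
  assert (W2 : forall n, (z * snd (psi n) = RtoC lam * snd (eta (n + 1)%Z) + RtoC lp * fst (eta n))%C)
    by (intros n; assert (E := f_equal snd (HW n)); simpl in E; symmetry; exact E).
  assert (Hh : (RtoC (lam / 2) + RtoC (lam / 2) = RtoC lam)%C)
    by (rewrite <- RtoC_plus; f_equal; field).
  assert (LP2 := lp2 lam lp Hlp).
  assert (Sy : forall n, y n = (z * (opA lam lp p n + opB lam m n))%C).
  { intros n.
    (* W psi = z psi reads S eta = z psi; this is the combination of the components of S^* (z psi)
       that returns eta^+ + i eta^-. *)
    transitivity ((RtoC (lam / 2) + RtoC (lam / 2)) * (z * fst (psi (n + 1)%Z))
      + (RtoC (lam / 2) + RtoC (lam / 2)) * Ci * (z * snd (psi (n - 1)%Z))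
      - Ci * RtoC lp * (z * fst (psi n) + Ci * (z * snd (psi n))))%C.
    - rewrite Hh, !W1, !W2, Z.add_simpl_r, Z.sub_add. unfold y. ring [Ci2 LP2].
    - unfold opA, opB, laurent, p, m. ring. }
  assert (Sr : forall n, r n = (z * (opB lam p n + opD lam lp m n))%C).
  { intros n.
    transitivity ((RtoC (lam / 2) + RtoC (lam / 2)) * (z * fst (psi (n + 1)%Z))
      - (RtoC (lam / 2) + RtoC (lam / 2)) * Ci * (z * snd (psi (n - 1)%Z))
      + Ci * RtoC lp * (z * fst (psi n) - Ci * (z * snd (psi n))))%C.
    - rewrite Hh, !W1, !W2, Z.add_simpl_r, Z.sub_add. unfold r. ring [Ci2 LP2].
    - unfold opB, opD, laurent, p, m. ring. }
  assert (Ly : l2 y).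
  { apply l2_ext with (fun n => z * (opA lam lp p n + opB lam m n))%C; [intros; symmetry; apply Sy|].
    apply l2_scal, l2_plus; apply l2_laurent; auto. }
  assert (Lr : l2 r).
  { apply l2_ext with (fun n => z * (opB lam p n + opD lam lp m n))%C; [intros; symmetry; apply Sr|].
    apply l2_scal, l2_plus; apply l2_laurent; auto. }
  assert (Ea : forall n, (phi * w n)%C = (RtoC (cos (2 * PI * (IZR n * Phi + theta))) +
     Ci * RtoC (sin (2 * PI * (IZR n * Phi + theta))))%C).
  { intros n. unfold phi, w. rewrite <- expi_plus.
    replace (2 * PI * theta + 2 * PI * (IZR n * Phi)) with (2 * PI * (IZR n * Phi + theta)) by ring.
    apply injective_projections; simpl; ring. }
  assert (CS : forall t, (RtoC (cos t) * RtoC (cos t) = 1 - RtoC (sin t) * RtoC (sin t))%C).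
  { intros t. rewrite <- !RtoC_mult, <- RtoC_minus. f_equal.
    assert (H := sin2_cos2 t). unfold Rsqr in H. lra. }
  split; auto.
  - intros n.
    (* The rotation in Q_n multiplies psi^+ + i psi^- by phi w n, while its part i lp diag(1, -1)
       exchanges p and m. *)
    transitivity (RtoC lam * (phi * w n) * p n + Ci * RtoC lp * m n)%C; [|ring].
    rewrite Ea. unfold y, eta, Qop, p, m. cbn [fst snd]. fold lp. rewrite !RtoC_mult. ring [Ci2].
  - intros n.
    transitivity ((phi * w n) * r n)%C; [ring|].
    transitivity (RtoC lam * m n + Ci * RtoC lp * ((phi * w n) * p n))%C; [|ring].
    rewrite Ea. unfold r, eta, Qop, p, m. cbn [fst snd]. fold lp. rewrite !RtoC_mult.
    ring [Ci2 (CS (2 * PI * (IZR n * Phi + theta)))].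
Qed.

Theorem theorem6p4 (lam Phi theta : R) :
  0 < lam < 1 ->
  irrational Phi ->
  irrational_wrt Phi (theta - 1 / 4) ->
  empty_point_spectrum (Wop lam lam Phi theta).
Proof.
  intros Hlam Hirr Hres z (psi & Hl2 & [n0 Hn0] & HW).
  assert (Hlp : lam * lam + lamp lam * lamp lam = 1).
  { unfold lamp. rewrite sqrt_sqrt by nra. ring. }
  assert (lp_pos : 0 < lamp lam) by (apply sqrt_lt_R0; nra).
  assert (Hsol := solution_of_eigenvector lam Phi theta z psi ltac:(lra) Hlp Hl2 HW).
  cbv zeta in Hsol.
  set (lp := lamp lam) in *.
  set (w := fun n : Z => expi (2 * PI * (IZR n * Phi))) in *. set (phi := expi (2 * PI * theta)) in *.
  set (p := fun n => (fst (psi n) + Ci * snd (psi n))%C) in *.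
  set (m := fun n => (fst (psi n) - Ci * snd (psi n))%C) in *.
  assert (w_add : forall a b, w (a + b)%Z = (w a * w b)%C).
  { intros a b. unfold w. rewrite <- expi_plus, plus_IZR. f_equal. ring. }
  assert (w_unit : forall a, Cmod (w a) = 1) by (intros; apply Cmod_expi).
  assert (w_irr : forall k, k <> 0%Z -> w k <> RtoC 1).
  { intros k Hk E. apply expi_eq_1 in E as [j Hj]. apply (Hirr j k Hk).
    rewrite <- Hj. field. intros E. apply Hk, eq_IZR, E. }
  assert (Hphi : Cmod phi = 1) by apply Cmod_expi.
  assert (Hphi' : Cmod (- Cconj phi)%C = 1) by (rewrite Cmod_opp, Cmod_conj; auto).
  assert (nonres : forall k, (phi * Cconj (- Cconj phi) * w k)%C <> RtoC 1).
  { intros k E. rewrite Copp_conj, Cconj_conj in E.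
    (* The product of the phases is - phi^2 w k = exp(2 pi i (1/2 + 2 theta + k Phi)). If it is 1,
       then 2 (theta - 1/4) + k Phi is an integer: it is one less than the integer 1/2 + 2 theta + k
       Phi. *)
    assert (M1 : (- (1))%C = expi (2 * PI * (1 / 2))).
    { replace (2 * PI * (1 / 2)) with PI by field.
      apply injective_projections; simpl; [rewrite cos_PI|rewrite sin_PI]; ring. }
    assert (E' : expi (2 * PI * (1 / 2 + 2 * theta + IZR k * Phi)) = RtoC 1).
    { rewrite <- E.
      transitivity (expi (2 * PI * (1 / 2)) * (phi * phi * w k))%C.
      - unfold phi, w. rewrite <- !expi_plus. f_equal. ring.
      - rewrite <- M1. ring. }
    apply expi_eq_1 in E' as [j Hj]. apply (Hres k (j - 1)%Z). rewrite minus_IZR, <- Hj. field. }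
  assert (Hpm : p n0 <> RtoC 0 \/ m n0 <> RtoC 0).
  { apply not_and_or. intros [Ep Em]. apply Hn0. unfold p, m in *.
    assert (H2 : RtoC 2 <> RtoC 0) by (apply RtoC_neq; lra).
    assert (A : fst (psi n0) = RtoC 0).
    { transitivity (((fst (psi n0) + Ci * snd (psi n0)) + (fst (psi n0) - Ci * snd (psi n0))) / RtoC 2)%C;
        [field; auto|rewrite Ep, Em; field; auto]. }
    assert (B : snd (psi n0) = RtoC 0).
    { rewrite A in Ep. transitivity (- Ci * (0 + Ci * snd (psi n0)))%C; [ring [Ci2]|rewrite Ep; ring]. }
    rewrite (surjective_pairing (psi n0)), A, B. reflexivity. }
  assert (Hz := eigenvalue_unimodular lam lp w Hlp w_add w_unit z phi _ _ _ _ n0 Hphi Hsol Hpm).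
  destruct (solution_reflect lam lp w w_add w_unit z phi _ _ _ _ Hphi Hsol) as (s & Hs & Hsol').
  set (p' := fun n => (s n * m (- n)%Z)%C) in Hsol'.
  assert (lam_pos : 0 < lam) by lra.
  assert (N := solution_null_current lam lp w lam_pos lp_pos Hlp w_add w_unit w_irr
     z phi _ _ _ _ Hz Hphi Hsol).
  assert (N' := solution_null_current lam lp w lam_pos lp_pos Hlp w_add w_unit w_irr
     z _ _ _ _ _ Hz Hphi' Hsol').
  match type of Hsol with solution _ _ _ _ _ _ _ _ ?R => set (r := R) in * end.
  match type of Hsol' with solution _ _ _ _ _ _ _ _ ?R => set (r' := R) in * end.
  assert (J : forall k, conv p (bar p') k = conv r (bar r') k).
  { intros k.
    assert (E := solution_current lam lp w Hlp w_add w_unit z _ _ _ _ _ _ _ _ _ _ Hsol Hsol' k Hz).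
    fold p' in E.
    set (t := (conv p (bar p') k - conv r (bar r') k)%C) in *.
    set (c := (phi * Cconj (- Cconj phi) * w k)%C) in *.
    assert (Hc : (c - 1)%C <> RtoC 0).
    { intros E'. apply (nonres k). fold c. transitivity (c - 1 + 1)%C; [ring|rewrite E'; ring]. }
    assert (T0 : t = RtoC 0).
    { transitivity ((c * t - t) / (c - 1))%C; [field; auto|rewrite E; field; auto]. }
    transitivity (t + conv r (bar r') k)%C; [unfold t; ring|rewrite T0; ring]. }
  assert (D := conv_det_0 p r p' r' (sol_p _ _ _ _ _ _ _ _ _ Hsol) (sol_r _ _ _ _ _ _ _ _ _ Hsol)
     (sol_p _ _ _ _ _ _ _ _ _ Hsol') (sol_r _ _ _ _ _ _ _ _ _ Hsol') N N' J).
  assert (P := parallel_product_0 lam lp w lam_pos lp_pos Hlp w_add w_unit w_irr z phi _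
     _ _ _ _ _ _ _ _ Hz Hphi Hphi' Hsol Hsol' D nonres).
  assert (Pm : forall i j, (p i * m j)%C = RtoC 0).
  { intros i j. specialize (P i (- j)%Z). unfold p' in P. rewrite Z.opp_involutive in P.
    assert (S2 : (s (- j)%Z * s (- j)%Z)%C = RtoC 1)
      by (destruct (Hs (- j)%Z) as [->| ->]; rewrite <- RtoC_mult; f_equal; ring).
    transitivity (s (- j)%Z * (p i * (s (- j)%Z * m j)))%C;
      [transitivity (s (- j)%Z * s (- j)%Z * (p i * m j))%C; [rewrite S2|]; ring|rewrite P; ring]. }
  assert (Zero : forall a b : C, (a * b)%C = RtoC 0 -> a <> RtoC 0 -> b = RtoC 0).
  { intros a b E Ha. transitivity (a * b / a)%C; [field; auto|rewrite E; field; auto]. }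
  (* As all products p i m j vanish, p or m is identically zero. If it is m, the first component of
     the reflected solution is zero, and [solution_p0_m0] is applied to that solution. *)
  destruct Hpm as [Hp|Hm].
  - assert (M0 : forall j, m j = RtoC 0) by (intros j; apply (Zero (p n0)); auto).
    apply Hp.
    assert (Q := solution_p0_m0 lam lp w lam_pos z _ _ _ _ _ Hphi' Hsol'
      ltac:(intros; unfold p'; rewrite M0; ring) (N' 0%Z) (- n0)%Z).
    cbv beta in Q. rewrite Z.opp_involutive in Q.
    destruct (Hs (- n0)%Z) as [E|E]; rewrite E in Q.
    + transitivity (- - (1 * p n0))%C; [ring|rewrite Q; ring].
    + transitivity (- (RtoC (- 1) * p n0))%C; [|exact Q].
      replace (RtoC (- 1)) with (- (1))%C by (rewrite <- RtoC_opp; reflexivity). ring.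
  - assert (P0 : forall j, p j = RtoC 0).
    { intros j. apply (Zero (m n0)); auto. rewrite Cmult_comm. auto. }
    apply Hm. apply (solution_p0_m0 lam lp w lam_pos z _ _ _ _ _ Hphi Hsol P0 (N 0%Z)).
Qed.
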